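(* Let $n\ge 1$ and let $f\in S^0(\mathbb{B}^n)$. Then for every $r\in(0,1)$ the following inequality holds: $$\big\|df(z)\big\|\le\frac{(1+\sqrt{r})^2}{(1-r)^3}\qquad\text{for all } z\in\mathbb{B}^n \text{ with } \|z\|\le r.$$
   Context: $\mathbb{B}^n=\{z\in\mathbb{C}^n:\|z\|<1\}$ is the Euclidean unit ball. For a holomorphic map $f:\mathbb{B}^n\to\mathbb{C}^n$, $df(z):\mathbb{C}^n\to\mathbb{C}^n$ denotes its (complex) differential at $z$, and for a linear map $L:\mathbb{C}^n\to\mathbb{C}^n$, $\|L\|$ denotes the operator norm with respect to the Euclidean norm. $S(\mathbb{B}^n)$ is the set of all injective holomorphic maps $f:\mathbb{B}^n\to\mathbb{C}^n$ with $f(0)=0$ and $df(0)=\mathsf{Id}$. A family $(f_t)_{t\ge 0}$ of holomorphic mappings $f_t:\mathbb{B}^n\to\mathbb{C}^n$ is a Loewner chain if $e^{-t}f_t\in S(\mathbb{B}^n)$ for all $t\ge 0$ and $f_s(\mathbb{B}^n)\subseteq f_t(\mathbb{B}^n)$ whenever $0\le s\le t<\infty$. It is a normal Loewner chain if, in addition, $\{e^{-t}f_t\}_{t\ge 0}$ is a normal family. $S^0(\mathbb{B}^n)$ is the set of $f\in S(\mathbb{B}^n)$ for which there is a normal Loewner chain $(f_t)_{t\ge 0}$ with $f_0=f$. *)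

(* Defs.v *)
From HB Require Import structures.
From mathcomp Require Import all_boot all_order all_algebra.
From mathcomp Require Import all_classical all_reals all_analysis.
From mathcomp.real_closed Require Import complex.

Set Implicit Arguments.
Unset Strict Implicit.
Unset Printing Implicit Defensive.

Import Order.TTheory GRing.Theory Num.Theory.
Import numFieldNormedType.Exports.

Local Open Scope classical_set_scope.
Local Open Scope ring_scope.

(* The ascription to [numClosedFieldType] is what makes the library infer the
   modulus topology on the complex numbers, hence the normed [Cplx R]-module
   structure on column vectors. *)
Definition Cplx (R : realType) : numClosedFieldType := R[i].

Section Loewner.
Variables (R : realType) (n : nat).
Local Notation C := (Cplx R).
Local Notation V := 'cV[C]_n.

Definition RtoC (x : R) : C := x%:C%C.

(* The library's norm on matrices is the sup norm: it induces the same topology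
   (hence the same differentials) as the Euclidean norm. *)
Definition enorm (z : V) : R := Num.sqrt (\sum_i Normc.normc (z i 0) ^+ 2).

Definition eball : set V := [set z | enorm z < 1].

Definition opnorm (L : {linear V -> V}) : R :=
  sup [set enorm (L v) | v in [set v | enorm v <= 1]].

(* Maps from the ball are total functions of which only the values on the
   (open) ball matter. *)
Definition holomorphic (f : V -> V) := forall z, eball z -> differentiable f z.

Definition class_S (f : V -> V) :=
  [/\ holomorphic f, set_inj eball f, f 0 = 0 & 'd f 0 = id :> (V -> V)].

Definition compact_in_eball (K : set V) := compact K /\ K `<=` eball.

Definition normal_family (F : set (V -> V)) :=
  forall u : nat -> V -> V, (forall k, F (u k)) ->
  exists2 phi : nat -> nat, {homo phi : i j / (i < j)%N} &
  exists g : V -> V, {family compact_in_eball, (u \o phi) @ \oo --> g}.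

Definition rescaled (f : R -> V -> V) (t : R) : V -> V :=
  fun z => RtoC (expR (- t)) *: f t z.

Definition Loewner_chain (f : R -> V -> V) :=
  [/\ forall t, 0 <= t -> holomorphic (f t),
      forall t, 0 <= t -> class_S (rescaled f t) &
      forall s t, 0 <= s -> s <= t -> f s @` eball `<=` f t @` eball].

Definition normal_Loewner_chain (f : R -> V -> V) :=
  Loewner_chain f /\ normal_family [set rescaled f t | t in [set t | 0 <= t]].

Definition class_S0 (f : V -> V) :=
  class_S f /\
  exists2 ft : R -> V -> V,
    normal_Loewner_chain ft & forall z, eball z -> ft 0 z = f z.

End Loewner.

(* Main.v *)
Require Import Defs.
From HB Require Import structures.
From mathcomp Require Import all_boot all_order all_algebra.
From mathcomp Require Import all_classical all_reals all_analysis.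
From mathcomp.real_closed Require Import complex.
From mathcomp Require Import ring lra.

Set Implicit Arguments.
Unset Strict Implicit.
Unset Printing Implicit Defensive.

Import Order.TTheory GRing.Theory Num.Theory.
Import numFieldNormedType.Exports.
Local Open Scope classical_set_scope.
Local Open Scope ring_scope.

(** The bound combines a growth theorem with a Schwarz-Pick inequality.  If
    |f x| <= |x| / (1 - |x|)^2 on the ball, then on the ball of radius
    rho = sqrt r the map [f] is bounded by rho / (1 - rho)^2.  On the disc cut
    out of that ball by a complex line through [z], the infinitesimal
    Schwarz-Pick inequality bounds the derivative of [f] by
    rho^2 / ((1 - rho)^2 (rho^2 - |z|^2)), which for |z| <= r = rho^2 is at most
    (1 + rho)^2 / (1 - r)^3 ([distortion], [proposition1p6]).

    The growth theorem ([growth]) comes from the chain.  For s < t a point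
    [x] has an image [y] in the ball with f_t(y) = f_s(x); Schwarz's lemma for
    this transition map, whose differential at the origin is e^(s-t) times the
    identity, gives |y| <= |x| (a + |x|) / (1 + a |x|) with a = e^(s-t)
    ([transition_bound]).  In terms of the Koebe function k(x) = x / (1 - x)^2
    this reads k(|y|) <= ((1 + a) / 2)^2 k(|x|), which agrees with e^(s-t) k(|x|)
    to first order in t - s.  Cutting a time interval [0, t] into many short
    steps therefore yields k(|y|) <= e^-t k(|x|) for f_t(y) = f_0(x)
    ([chain_decay]).  As t grows, y tends to 0, where e^-t f_t is the identity up
    to a quadratic error that normality makes uniform in t ([chain_bounded],
    [enorm_second_order]); hence |f_0(x)| <= k(|x|).

    The transition map is the inverse of an injective holomorphic map composed
    with another one, so one needs that such inverses are continuous and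
    holomorphic along complex lines.  Both are obtained without proving that the
    Jacobian determinant has no zeros.  The function equal to the Jacobian
    determinant at the preimage, and to 0 off the image of a closed ball, is
    continuous, and holomorphic off its zeros; by Rado's theorem it cannot vanish
    on an open set, so the map is open ([open_mapping]).  The transition map is
    then continuous, and holomorphic on each line off the zeros of a continuous
    function [h] of the same kind; the maximum principle ignores these zeros,
    because |q|^N |h| obeys it for every N ([max_modulus_exceptional]).

    Everything rests on complex differentiability alone.  Goursat's theorem on
    rectangles in logarithmic polar coordinates compares the value of a
    holomorphic function at the centre of a circle with its values on the circle
    ([center_le]); this gives the maximum principle, and the latter gives
    Schwarz's lemma ([schwarz_pick]) and Cauchy estimates for difference quotients
    ([second_order]), hence the continuity of partial derivatives. *)

(** * The complex plane with its real-valued modulus *)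

Section Plane.
Variable R : realType.
Local Notation C := (Cplx R).
Implicit Types (z w x y : C).

Definition cabs (z : Cplx R) : R := Normc.normc z.
Definition cre (z : Cplx R) : R := complex.Re z.
Definition cim (z : Cplx R) : R := complex.Im z.
Definition cconj (z : Cplx R) : Cplx R := conjc z.
Definition mkC (a b : R) : Cplx R := Complex a b.

Lemma cabsE z : `|z| = RtoC (cabs z).
Proof. by []. Qed.

Lemma cabs_ge0 z : 0 <= cabs z.
Proof. by case: z => a b; exact: sqrtr_ge0. Qed.

Lemma cabsM z w : cabs (z * w) = cabs z * cabs w.
Proof. exact: Normc.normcM. Qed.

Lemma cabsD z w : cabs (z + w) <= cabs z + cabs w.
Proof. exact: le_normcD. Qed.

Lemma cabsN z : cabs (- z) = cabs z.
Proof. exact: normcN. Qed.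

Lemma cabsB z w : cabs (z - w) <= cabs z + cabs w.
Proof. by rewrite -(cabsN w); exact: cabsD. Qed.

Lemma cabsBC z w : cabs (z - w) = cabs (w - z).
Proof. by rewrite -cabsN opprB. Qed.

Lemma cabs0 : cabs 0 = 0.
Proof. exact: Normc.normc0. Qed.

Lemma cabs1 : cabs 1 = 1.
Proof. exact: Normc.normc1. Qed.

Lemma cabs_eq0 z : (cabs z == 0) = (z == 0).
Proof. by apply/eqP/eqP => [/Normc.eq0_normc //|->]; rewrite cabs0. Qed.

Lemma cabs_gt0 z : (0 < cabs z) = (z != 0).
Proof. by rewrite lt_neqAle cabs_ge0 andbT eq_sym cabs_eq0. Qed.

Lemma cabsV z : cabs z^-1 = (cabs z)^-1.
Proof. exact: Normc.normcV. Qed.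

Lemma cabsX z k : cabs (z ^+ k) = cabs z ^+ k.
Proof. by elim: k => [|k IH]; rewrite ?cabs1 // !exprS cabsM IH. Qed.

Lemma cabs_dist z w : `|cabs z - cabs w| <= cabs (z - w).
Proof.
rewrite ler_norml; apply/andP; split.
  have := cabsD (w - z) z; rewrite subrK [cabs (w - z)]cabsBC; lra.
have := cabsD (z - w) w; rewrite subrK; lra.
Qed.

Lemma RtoC_is_zmod : zmod_morphism (@RtoC R).
Proof. by move=> a b; exact: (rmorphB (real_complex R)). Qed.

Lemma RtoC_is_monoid : monoid_morphism (@RtoC R).
Proof. by split=> // a b; exact: (rmorphM (real_complex R)). Qed.

HB.instance Definition _ :=
  GRing.isZmodMorphism.Build R (Cplx R) (@RtoC R) RtoC_is_zmod.
HB.instance Definition _ :=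
  GRing.isMonoidMorphism.Build R (Cplx R) (@RtoC R) RtoC_is_monoid.

Lemma cabs_RtoC (a : R) : cabs (RtoC a) = `|a|.
Proof. by rewrite /cabs /RtoC /= expr0n /= addr0 sqrtr_sqr. Qed.

Lemma RtoC_eq0 (a : R) : (RtoC a == 0) = (a == 0).
Proof. by rewrite -cabs_eq0 cabs_RtoC normr_eq0. Qed.

Lemma creD z w : cre (z + w) = cre z + cre w.
Proof. by case: z w => [a b] [c d]. Qed.
Lemma cimD z w : cim (z + w) = cim z + cim w.
Proof. by case: z w => [a b] [c d]. Qed.
Lemma creN z : cre (- z) = - cre z.
Proof. by case: z => a b. Qed.
Lemma cimN z : cim (- z) = - cim z.
Proof. by case: z => a b. Qed.
Lemma creM z w : cre (z * w) = cre z * cre w - cim z * cim w.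
Proof. by case: z w => [a b] [c d]. Qed.
Lemma cimM z w : cim (z * w) = cre z * cim w + cim z * cre w.
Proof. by case: z w => [a b] [c d]. Qed.
Lemma creR (a : R) : cre (RtoC a) = a. Proof. by []. Qed.
Lemma cimR (a : R) : cim (RtoC a) = 0. Proof. by []. Qed.
Lemma cre_conj z : cre (cconj z) = cre z. Proof. by case: z. Qed.
Lemma cim_conj z : cim (cconj z) = - cim z. Proof. by case: z. Qed.
Lemma eqC z w : cre z = cre w -> cim z = cim w -> z = w.
Proof. by case: z w => [a b] [c d] /= -> ->. Qed.

Lemma cabs_sqr z : cabs z ^+ 2 = cre z ^+ 2 + cim z ^+ 2.
Proof. by case: z => a b; rewrite /cabs /= sqr_sqrtr // addr_ge0 // sqr_ge0. Qed.

Lemma mul_conj z : cconj z * z = RtoC (cabs z ^+ 2).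
Proof.
apply: eqC; rewrite ?(creM, cimM, cre_conj, cim_conj, creR, cimR, cabs_sqr); ring.
Qed.

Lemma cconj_RtoC (a : R) : cconj (RtoC a) = RtoC a.
Proof. by apply: eqC; rewrite ?cre_conj ?cim_conj ?cimR ?oppr0. Qed.

Lemma cconj0 : cconj (0 : C) = 0.
Proof. by rewrite -(rmorph0 (@RtoC R)) cconj_RtoC. Qed.

Lemma cabs_conj z : cabs (cconj z) = cabs z.
Proof. by case: z => a b; rewrite /cabs /= sqrrN. Qed.

Lemma cre_le z : `|cre z| <= cabs z.
Proof.
rewrite -(@ler_pXn2r _ 2) ?nnegrE ?cabs_ge0 //.
by rewrite cabs_sqr real_normK ?num_real // lerDl sqr_ge0.
Qed.

Lemma cim_le z : `|cim z| <= cabs z.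
Proof.
rewrite -(@ler_pXn2r _ 2) ?nnegrE ?cabs_ge0 //.
by rewrite cabs_sqr real_normK ?num_real // lerDr sqr_ge0.
Qed.

Lemma cabs_le z : cabs z <= `|cre z| + `|cim z|.
Proof.
rewrite -(@ler_pXn2r _ 2) ?nnegrE ?cabs_ge0 ?addr_ge0 //.
rewrite cabs_sqr sqrrD !real_normK ?num_real //.
by rewrite -addrA lerD2l lerDr mulrn_wge0 // mulr_ge0.
Qed.

Lemma rotation z : exists2 u : C, cabs u = 1 & u * z = RtoC (cabs z).
Proof.
have [->|z0] := eqVneq z 0; first by exists 1; rewrite ?cabs1 // cabs0 mulr0 rmorph0.
have a0 : cabs z != 0 by rewrite cabs_eq0.
exists (cconj z * RtoC (cabs z)^-1).
  rewrite cabsM cabs_conj cabs_RtoC ger0_norm ?invr_ge0 ?cabs_ge0 //.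
  by rewrite mulfV.
rewrite mulrAC mul_conj -rmorphM; congr RtoC.
by rewrite expr2 mulfK.
Qed.

Lemma nbhsC (z : C) (P : set C) :
  nbhs z P <-> exists2 d : R, 0 < d & forall x, cabs (x - z) < d -> P x.
Proof.
split.
- move=> /nbhs_ballP [[e ei] /= ]; rewrite ltcE /= => /andP[/eqP -> e0] eP.
  exists e => // x xz; apply: eP; rewrite -ball_normE /ball_ /= cabsE.
  by rewrite cabsBC in xz; rewrite ltcE /= eqxx.
- move=> [d d0 dP]; apply/nbhs_ballP; exists (RtoC d) => /=; first by rewrite ltcE /= eqxx.
  move=> x; rewrite -ball_normE /ball_ /= cabsE ltcE /= eqxx /= => xz.
  by apply: dP; rewrite cabsBC.
Qed.

Lemma continuousCP (T : topologicalType) (f : T -> C) (z : T) :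
  {for z, continuous f} <-> forall e : R, 0 < e ->
    \forall x \near z, cabs (f x - f z) < e.
Proof.
split=> [fz e e0|H P /nbhsC [d d0 dP]].
  have N : nbhs (f z) [set y | cabs (y - f z) < e] by apply/nbhsC; exists e.
  exact: (fz _ N).
by apply: filterS (H _ d0) => x; exact: dP.
Qed.

End Plane.

(** * Complex derivatives *)

Lemma nbhsW (T : topologicalType) (z : T) (P : set T) : (forall x, P x) -> nbhs z P.
Proof. by move=> H; apply: filterS (@filterT _ _ _). Qed.

Section Derivative.
Variable C : numFieldType.
Implicit Types (f g : C -> C) (z w d : C).

(** Caratheodory's form of the derivative: the product and chain rules become
    identities between continuous factors. *)
Definition cderiv g z d := exists psi : C -> C,
  [/\ {for z, continuous psi}, psi z = d &
      \forall x \near z, g x = g z + psi x * (x - z)].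

Definition cdiff g z := exists d, cderiv g z d.

Lemma cderiv_continuous g z d : cderiv g z d -> {for z, continuous g}.
Proof.
move=> [psi [cpsi _ E]].
have c1 : {for z, continuous (fun x => g z + psi x * (x - z))}.
  apply: continuousD; first exact: cst_continuous.
  apply: continuousM => //.
  by apply: continuousB; [exact: cvg_id|exact: cst_continuous].
have E0 : g z + psi z * (z - z) = g z by rewrite subrr mulr0 addr0.
move=> A NA; have /c1 : nbhs (g z + psi z * (z - z)) A by rewrite E0.
by apply: filterS2 E => x /= ->.
Qed.

Lemma cdiff_continuous g z : cdiff g z -> {for z, continuous g}.
Proof. by move=> [d]; exact: cderiv_continuous. Qed.

Lemma cderiv_ext f g z d : (\forall x \near z, f x = g x) ->
  cderiv f z d -> cderiv g z d.
Proof.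
move=> fg [psi [c e E]]; exists psi; split=> //.
have fgz : f z = g z by exact: (nbhs_singleton fg).
near=> x; rewrite -fgz -(_ : f x = g x); by near: x.
Unshelve. all: by end_near. Qed.

Lemma cderiv_cst (a : C) z : cderiv (fun _ => a) z 0.
Proof.
exists (fun _ => 0); split=> //; first exact: cst_continuous.
by apply: nbhsW => x; rewrite mul0r addr0.
Qed.

Lemma cderiv_id z : cderiv id z 1.
Proof.
exists (fun _ => 1); split=> //; first exact: cst_continuous.
by apply: nbhsW => x; rewrite mul1r addrC subrK.
Qed.

Lemma cderivD f g z df dg : cderiv f z df -> cderiv g z dg ->
  cderiv (fun x => f x + g x) z (df + dg).
Proof.
move=> [p [cp <- pE]] [q [cq <- qE]]; exists (fun x => p x + q x); split=> //.
  exact: continuousD.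
near=> x; rewrite (_ : f x = f z + p x * (x - z)); last by near: x.
rewrite (_ : g x = g z + q x * (x - z)); last by near: x.
by ring.
Unshelve. all: by end_near. Qed.

Lemma cderivM f g z df dg : cderiv f z df -> cderiv g z dg ->
  cderiv (fun x => f x * g x) z (df * g z + f z * dg).
Proof.
move=> [p [cp <- pE]] gd; have cg := cderiv_continuous gd.
case: gd => [q [cq <- qE]]; exists (fun x => p x * g x + f z * q x); split=> //.
  apply: continuousD; first exact: continuousM.
  by apply: continuousM => //; exact: cst_continuous.
near=> x; rewrite (_ : f x = f z + p x * (x - z)); last by near: x.
rewrite (_ : g x = g z + q x * (x - z)); last by near: x.
by ring.
Unshelve. all: by end_near. Qed.

Lemma cderiv_comp f g z df dg : cderiv f z df -> cderiv g (f z) dg ->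
  cderiv (fun x => g (f x)) z (dg * df).
Proof.
move=> fd; have cf := cderiv_continuous fd.
case: fd => [p [cp <- pE]] [q [cq <- qE]].
exists (fun x => q (f x) * p x); split=> //.
  by apply: continuousM => //; exact: continuous_comp.
have {}qE : \forall x \near z, g (f x) = g (f z) + q (f x) * (f x - f z).
  exact: (cf _ qE).
apply: filterS2 qE pE => x E2 E1.
have E3 : f x - f z = p x * (x - z) by rewrite E1 addrAC subrr add0r.
by rewrite E2 E3 mulrA.
Qed.

Lemma cderivV_id z : z != 0 -> cderiv (fun x => x^-1) z (- z^-1 * z^-1).
Proof.
move=> z0; exists (fun x => - z^-1 * x^-1); split=> //.
  by apply: continuousM; [exact: cst_continuous|exact: inv_continuous].
have : \forall x \near z, x != 0.
  apply/nbhs_ballP; exists `|z| => /=; first by rewrite normr_gt0.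
  move=> x; rewrite -ball_normE /ball_ /=.
  by apply: contraTneq => ->; rewrite subr0 ltxx.
apply: filterS => x x0; by field; rewrite x0 z0.
Qed.

Lemma cdiff_cst (a : C) z : cdiff (fun _ => a) z.
Proof. by exists 0; exact: cderiv_cst. Qed.
Lemma cdiff_id z : cdiff id z.
Proof. by exists 1; exact: cderiv_id. Qed.
Lemma cdiffD f g z : cdiff f z -> cdiff g z -> cdiff (fun x => f x + g x) z.
Proof. by move=> [a fa] [b gb]; exists (a + b); exact: cderivD. Qed.
Lemma cdiffM f g z : cdiff f z -> cdiff g z -> cdiff (fun x => f x * g x) z.
Proof. by move=> [a fa] [b gb]; exists (a * g z + f z * b); exact: cderivM. Qed.
Lemma cdiffN g z : cdiff g z -> cdiff (fun x => - g x) z.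
Proof.
move=> cg; have [d H] := cdiffM (cdiff_cst (-1) z) cg.
by exists d; apply: cderiv_ext H; apply: nbhsW => x; rewrite mulN1r.
Qed.
Lemma cdiffB f g z : cdiff f z -> cdiff g z -> cdiff (fun x => f x - g x) z.
Proof. by move=> cf cg; apply: cdiffD => //; exact: cdiffN. Qed.
Lemma cdiff_comp f g z : cdiff f z -> cdiff g (f z) -> cdiff (fun x => g (f x)) z.
Proof. by move=> [a fa] [b gb]; exists (b * a); exact: cderiv_comp. Qed.
Lemma cdiffV g z : cdiff g z -> g z != 0 -> cdiff (fun x => (g x)^-1) z.
Proof.
move=> cg g0; apply: (cdiff_comp (g := fun x => x^-1)) => //.
by eexists; exact: cderivV_id.
Qed.
Lemma cdiff_ext f g z : (\forall x \near z, f x = g x) -> cdiff f z -> cdiff g z.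
Proof. by move=> fg [d fd]; exists d; exact: cderiv_ext fd. Qed.
Lemma cdiff_affine (a b : C) z : cdiff (fun x => a + b * x) z.
Proof. by apply: cdiffD; [exact: cdiff_cst|apply: cdiffM; [exact: cdiff_cst|exact: cdiff_id]]. Qed.

End Derivative.

Lemma cderivP (R : realType) (g : Cplx R -> Cplx R) (z d : Cplx R) :
  cderiv g z d <-> forall e : R, 0 < e ->
  \forall x \near z, cabs (g x - g z - d * (x - z)) <= e * cabs (x - z).
Proof.
split=> [[psi [/continuousCP cpsi <- E]] e e0|H].
  near=> x.
  have -> : g x = g z + psi x * (x - z) by near: x.
  rewrite (_ : _ - _ - _ = (psi x - psi z) * (x - z)); last by ring.
  rewrite cabsM ler_wpM2r ?cabs_ge0 //.
  by apply: ltW; near: x; exact: cpsi.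
exists (fun x => if x == z then d else (g x - g z) / (x - z)).
split; rewrite ?eqxx //.
- apply/continuousCP => e e0.
  have e20 : 0 < e / 2 by rewrite divr_gt0.
  near=> x; rewrite eqxx; have [_|xz] := eqVneq; first by rewrite subrr cabs0.
  have xz0 : x - z != 0 by rewrite subr_eq0.
  have -> : (g x - g z) / (x - z) - d = (g x - g z - d * (x - z)) / (x - z).
    by rewrite [RHS]mulrBl mulfK.
  rewrite cabsM cabsV ltr_pdivrMr ?cabs_gt0 //.
  apply: (@le_lt_trans _ _ (e / 2 * cabs (x - z))).
    by near: x; exact: H.
  by rewrite ltr_pM2r ?cabs_gt0 // ltr_pdivrMr //; lra.
- near=> x; have [->|xz] := eqVneq; first by rewrite subrr mulr0 addr0.
  by rewrite divfK ?subr_eq0 // addrC subrK.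
Unshelve. all: by end_near. Qed.

(** * Integrals of continuous functions over segments *)

Section SegmentIntegral.
Variable R : realType.
Local Notation mu := (@lebesgue_measure R).
Implicit Types (f g : R -> R) (a b l m : R).

Definition scont f a l := forall x, a <= x <= a + l -> {for x, continuous f}.

Definition sint f a l : R := (\int[mu]_(x in `[a, a + l]) f x)%R.

Lemma scont_integrable f a l : scont f a l -> mu.-integrable `[a, a + l] (EFin \o f).
Proof.
move=> cf; apply: continuous_compact_integrable; first exact: segment_compact.
apply: continuous_in_subspaceT => x; rewrite inE /= in_itv /=; exact: cf.
Qed.

Lemma scontB f g a l : scont f a l -> scont g a l ->
  scont (fun x => f x - g x) a l.
Proof. by move=> cf cg x xal; apply: continuousB; [exact: cf|exact: cg]. Qed.

Lemma sintB f g a l : scont f a l -> scont g a l ->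
  sint (fun x => f x - g x) a l = sint f a l - sint g a l.
Proof. by move=> cf cg; rewrite /sint RintegralB //; exact: scont_integrable. Qed.

Lemma sint_cst (c : R) a l : 0 <= l -> sint (fun _ => c) a l = c * l.
Proof.
move=> l0; rewrite /sint Rintegral_cst //=.
rewrite lebesgue_measure_itv /= lte_fin.
case: ltP => [_|al]; first by rewrite -EFinB /= addrAC subrr add0r.
by have -> : l = 0 by lra.
Qed.

Lemma sint_le f g a l : scont f a l -> scont g a l ->
  (forall x, a <= x <= a + l -> f x <= g x) -> sint f a l <= sint g a l.
Proof.
move=> cf cg fg; apply: le_Rintegral; [exact: measurable_itv|exact: scont_integrable..|].
by move=> x; rewrite /= in_itv /=; exact: fg.
Qed.

Lemma scont_cst (c : R) a l : scont (fun _ => c) a l.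
Proof. by move=> x _; exact: cst_continuous. Qed.

Lemma sint_bound f a l (c e : R) : 0 <= l -> scont f a l ->
  (forall x, a <= x <= a + l -> `|f x - c| <= e) -> `|sint f a l - c * l| <= e * l.
Proof.
move=> l0 cf fe.
have cc k : scont (fun=> k) a l by exact: scont_cst.
have h1 : (c - e) * l <= sint f a l.
  rewrite -(sint_cst (c - e) a l0); apply: sint_le => // x /fe.
  by rewrite ler_norml => /andP[]; lra.
have h2 : sint f a l <= (c + e) * l.
  rewrite -(sint_cst (c + e) a l0); apply: sint_le => // x /fe.
  by rewrite ler_norml => /andP[]; lra.
by rewrite ler_norml; apply/andP; split; lra.
Qed.

Lemma sint_split f a l m : 0 <= l -> 0 <= m -> scont f a (l + m) ->
  sint f a (l + m) = sint f a l + sint f (a + l) m.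
Proof.
move=> l0 m0 cf; have If := scont_integrable cf.
rewrite /sint -addrA -(@Rintegral_itv_obnd_cbnd _ (a + l) _ f); last first.
  apply: integrableS If => //; apply: subset_itvr; rewrite bnd_simp.
  by rewrite lerDl.
rewrite -(@Rintegral_itvB _ f (BLeft a)) //= ?bnd_simp ?lerDl //; last first.
  by rewrite addrA lerDl.
by rewrite [RHS]addrC subrK.
Qed.

End SegmentIntegral.

(** * Boundary integrals over rectangles *)

Section Goursat.
Variable R : realType.
Local Notation C := (Cplx R).
Implicit Types (a b l m s t x y e : R).

Lemma continuousRP (f : R -> R) x :
  (forall e, 0 < e -> exists2 d, 0 < d &
     forall h, `|h| < d -> `|f (x + h) - f x| <= e) -> {for x, continuous f}.
Proof.
move=> H; apply/cvgrPdist_le => /= e e0; have [d d0 dH] := H e e0.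
apply/nbhs_ballP; exists d => //= y; rewrite /ball /= => xy.
have -> : y = x + (y - x) by rewrite addrC subrK.
by rewrite distrC; apply: dH; rewrite distrC.
Qed.

Variable g : R -> R -> C.

(** Complex differentiability of [g] as a function of [s + i t]. *)
Definition rdiff s t := exists d : C, forall e, 0 < e -> exists2 r, 0 < r &
  forall x y, `|x| < r -> `|y| < r ->
  cabs (g (s + x) (t + y) - g s t - d * mkC x y) <= e * (`|x| + `|y|).

Definition rdiff_on a b l m :=
  forall s t, a <= s <= a + l -> b <= t <= b + m -> rdiff s t.

Lemma cabs_mkC x y : cabs (mkC x y) <= `|x| + `|y|.
Proof. exact: cabs_le. Qed.

Lemma rdiff_continuous s t : rdiff s t -> forall e, 0 < e ->
  exists2 r, 0 < r & forall x y, `|x| < r -> `|y| < r ->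
  cabs (g (s + x) (t + y) - g s t) <= e.
Proof.
move=> [d H] e e0; have [r r0 rH] := H 1 ltr01.
have D0 : 0 < 2 * (1 + cabs d) by have := cabs_ge0 d; lra.
exists (Num.min r (e / (2 * (1 + cabs d)))).
  by rewrite lt_min r0 divr_gt0.
move=> x y; rewrite !lt_min !ltr_pdivlMr // => /andP[xr xe] /andP[yr ye].
have h1 := rH _ _ xr yr.
have h2 := cabsD (g (s + x) (t + y) - g s t - d * mkC x y) (d * mkC x y).
rewrite subrK cabsM in h2.
have h3 : cabs d * cabs (mkC x y) <= cabs d * (`|x| + `|y|).
  by rewrite ler_wpM2l ?cabs_ge0 // cabs_mkC.
nra.
Qed.

Lemma rdiff_cont_re s t : rdiff s t -> {for t, continuous (fun t => cre (g s t))}.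
Proof.
move=> H; apply: continuousRP => e e0; have [r r0 rH] := rdiff_continuous H e0.
exists r => // h hr; have := rH 0 h; rewrite normr0 addr0 => /(_ r0 hr).
by apply: le_trans; rewrite -creN -creD cre_le.
Qed.

Lemma rdiff_cont_im s t : rdiff s t -> {for s, continuous (fun s => cim (g s t))}.
Proof.
move=> H; apply: continuousRP => e e0; have [r r0 rH] := rdiff_continuous H e0.
exists r => // h hr; have := rH h 0; rewrite normr0 addr0 => /(_ hr r0).
by apply: le_trans; rewrite -cimN -cimD cim_le.
Qed.

(** Real part of [-i] times the integral of [g] along the boundary of a
    rectangle, with opposite sides paired. *)
Definition circ a b l m : R :=
  sint (fun t => cre (g (a + l) t) - cre (g a t)) b m -
  sint (fun s => cim (g s (b + m)) - cim (g s b)) a l.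

Lemma scont_re a b l m s : rdiff_on a b l m -> a <= s <= a + l ->
  scont (fun t => cre (g s t)) b m.
Proof. by move=> H sa t tb; apply: rdiff_cont_re; exact: H. Qed.

Lemma scont_im a b l m t : rdiff_on a b l m -> b <= t <= b + m ->
  scont (fun s => cim (g s t)) a l.
Proof. by move=> H sa s tb; apply: rdiff_cont_im; exact: H. Qed.

Lemma rdiff_sub a b l m a' b' l' m' : rdiff_on a b l m ->
  a <= a' -> a' + l' <= a + l -> b <= b' -> b' + m' <= b + m ->
  rdiff_on a' b' l' m'.
Proof. by move=> H h1 h2 h3 h4 s t hs ht; apply: H; lra. Qed.

Lemma circ_splitl a b l1 l2 m : 0 <= l1 -> 0 <= l2 -> 0 <= m ->
  rdiff_on a b (l1 + l2) m ->
  circ a b (l1 + l2) m = circ a b l1 m + circ (a + l1) b l2 m.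
Proof.
move=> l10 l20 m0 H; rewrite /circ sint_split //; last first.
  by apply: scontB; apply: (scont_im H); lra.
rewrite addrA !sintB; try (by apply: (scont_re H); lra); try (by apply: (scont_im H); lra);
  try (by move=> x xa; apply: (scont_im H (t := b)); lra);
  try (by move=> x xa; apply: (scont_im H (t := b + m)); lra).
lra.
Qed.

Lemma circ_splitm a b l m1 m2 : 0 <= l -> 0 <= m1 -> 0 <= m2 ->
  rdiff_on a b l (m1 + m2) ->
  circ a b l (m1 + m2) = circ a b l m1 + circ a (b + m1) l m2.
Proof.
move=> l0 m10 m20 H; rewrite /circ sint_split //; last first.
  by apply: scontB; apply: (scont_re H); lra.
rewrite addrA !sintB; try (by apply: (scont_im H); lra); try (by apply: (scont_re H); lra);
  try (by move=> x xa; apply: (scont_re H (s := a)); lra);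
  try (by move=> x xa; apply: (scont_re H (s := a + l)); lra).
lra.
Qed.

(** For an affine [g] the two integrals cancel. *)
Lemma circ_bound a b l m (c d : C) s0 t0 e : 0 <= l -> 0 <= m ->
  rdiff_on a b l m ->
  (forall s t, a <= s <= a + l -> b <= t <= b + m ->
     cabs (g s t - (c + d * mkC (s - s0) (t - t0))) <= e) ->
  `|circ a b l m| <= 2 * e * (l + m).
Proof.
move=> l0 m0 H He.
have re_err s t : a <= s <= a + l -> b <= t <= b + m ->
    `|cre (g s t) - (cre c + (cre d * (s - s0) - cim d * (t - t0)))| <= e.
  move=> hs ht; apply: le_trans (He s t hs ht).
  by have := cre_le (g s t - (c + d * mkC (s - s0) (t - t0))); rewrite creD creN creD creM.
have im_err s t : a <= s <= a + l -> b <= t <= b + m ->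
    `|cim (g s t) - (cim c + (cre d * (t - t0) + cim d * (s - s0)))| <= e.
  move=> hs ht; apply: le_trans (He s t hs ht).
  by have := cim_le (g s t - (c + d * mkC (s - s0) (t - t0))); rewrite cimD cimN cimD cimM.
have h1 : `|sint (fun t => cre (g (a + l) t) - cre (g a t)) b m - (cre d * l) * m|
    <= (2 * e) * m.
  apply: sint_bound => //; first by apply: scontB; apply: (scont_re H); lra.
  move=> t ht; have al : a <= a + l <= a + l by lra.
  have aa : a <= a <= a + l by lra.
  have := re_err _ _ al ht; have := re_err _ _ aa ht.
  by rewrite !ler_norml => /andP[? ?] /andP[? ?]; apply/andP; split; lra.
have h2 : `|sint (fun s => cim (g s (b + m)) - cim (g s b)) a l - (cre d * m) * l|
    <= (2 * e) * l.
  apply: sint_bound => //; first by apply: scontB; apply: (scont_im H); lra.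
  move=> s hs; have al : b <= b + m <= b + m by lra.
  have aa : b <= b <= b + m by lra.
  have := im_err _ _ hs al; have := im_err _ _ hs aa.
  by rewrite !ler_norml => /andP[? ?] /andP[? ?]; apply/andP; split; lra.
rewrite /circ; move: h1 h2; rewrite !ler_norml => /andP[? ?] /andP[? ?].
by apply/andP; split; lra.
Qed.

End Goursat.

(** * Goursat's theorem *)

Section GoursatTheorem.
Variable R : realType.
Local Notation C := (Cplx R).
Implicit Types (a b l m s t x y e : R).

Lemma half_pow_small l e : 0 <= l -> 0 < e -> exists k : nat, l / 2 ^+ k < e.
Proof.
move=> l0 e0; exists (Num.bound (l / e)).
have p2 : 0 < (2 : R) ^+ Num.bound (l / e) by rewrite exprn_gt0.
rewrite ltr_pdivrMr // mulrC -ltr_pdivrMr //.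
apply: lt_le_trans (archi_boundP _) _; first by rewrite divr_ge0 // ltW.
by rewrite -natrX ler_nat ltnW // ltn_expl.
Qed.

Lemma nested_segments (a l : nat -> R) : (forall k, 0 <= l k) ->
  (forall k, a k <= a k.+1) -> (forall k, a k.+1 + l k.+1 <= a k + l k) ->
  exists c, forall k, a k <= c <= a k + l k.
Proof.
move=> l0 up dn.
have up' j k : (j <= k)%N -> a j <= a k.
  elim: k => [|k IH]; first by rewrite leqn0 => /eqP->.
  by rewrite leq_eqVlt => /orP[/eqP->//|/IH h]; exact: le_trans h (up k).
have dn' j k : (j <= k)%N -> a k + l k <= a j + l j.
  elim: k => [|k IH]; first by rewrite leqn0 => /eqP->.
  by rewrite leq_eqVlt => /orP[/eqP->//|/IH]; exact: le_trans.
have ub k : ubound (range a) (a k + l k).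
  move=> _ [j _ <-]; have [jk|/ltnW kj] := leqP j k.
    by have := up' _ _ jk; have := l0 k; lra.
  by have := dn' _ _ kj; have := l0 j; lra.
exists (sup (range a)) => k; apply/andP; split.
  by apply: ub_le_sup; [exists (a 0%N + l 0%N); exact: ub|exists k].
by apply: ge_sup; [exists (a 0%N); exists 0%N|exact: ub].
Qed.

Variable g : R -> R -> C.

Lemma circ_quarter a b l m : 0 <= l -> 0 <= m -> rdiff_on g a b (l + l) (m + m) ->
  exists a' b', [/\ a <= a', a' <= a + l, b <= b', b' <= b + m &
    `|circ g a b (l + l) (m + m)| <= 4 * `|circ g a' b' l m| ].
Proof.
move=> l0 m0 H.
have ll : 0 <= l + l by lra.
have mm : 0 <= m + m by lra.
rewrite circ_splitl // !circ_splitm //; try (by apply: (rdiff_sub H); lra).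
set c1 := circ g a b l m; set c2 := circ g a _ l m.
set c3 := circ g _ b l m; set c4 := circ g (a + l) (b + m) l m.
have T : `|c1 + c2 + (c3 + c4)| <= `|c1| + `|c2| + (`|c3| + `|c4|).
  by rewrite (le_trans (ler_normD _ _)) // lerD // ler_normD.
have [h1|h1] := leP `|c1 + c2 + (c3 + c4)| (4 * `|c1|).
  by exists a, b; split=> //; lra.
have [h2|h2] := leP `|c1 + c2 + (c3 + c4)| (4 * `|c2|).
  by exists a, (b + m); split=> //; lra.
have [h3|h3] := leP `|c1 + c2 + (c3 + c4)| (4 * `|c3|).
  by exists (a + l), b; split=> //; lra.
by exists (a + l), (b + m); split=> //; rewrite -/c4; lra.
Qed.

(** If the boundary integral did not vanish, repeated quartering would give
    nested rectangles on which it decays no faster than their area; at the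
    common point the differential of [g] makes it decay faster. *)
Theorem goursat a b l m : 0 <= l -> 0 <= m -> rdiff_on g a b l m ->
  circ g a b l m = 0.
Proof.
move=> l0 m0 H; apply/eqP; rewrite -normr_le0; apply/ler_addgt0Pl => e e0.
rewrite addr0.
pose L k : R := l / 2 ^+ k; pose M k : R := m / 2 ^+ k.
have L0 k : 0 <= L k by rewrite divr_ge0 // exprn_ge0.
have M0 k : 0 <= M k by rewrite divr_ge0 // exprn_ge0.
have LS k : L k = L k.+1 + L k.+1 by rewrite /L exprS; field; rewrite expf_neq0.
have MS k : M k = M k.+1 + M k.+1 by rewrite /M exprS; field; rewrite expf_neq0.
pose inv (x : nat * (R * R)) := [/\ rdiff_on g x.2.1 x.2.2 (L x.1) (M x.1),
   a <= x.2.1, x.2.1 + L x.1 <= a + l, b <= x.2.2 & x.2.2 + M x.1 <= b + m].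
pose rel (x y : nat * (R * R)) := inv x ->
  [/\ y.1 = x.1.+1, x.2.1 <= y.2.1 <= x.2.1 + L y.1,
   x.2.2 <= y.2.2 <= x.2.2 + M y.1 &
   `|circ g x.2.1 x.2.2 (L x.1) (M x.1)| <= 4 * `|circ g y.2.1 y.2.2 (L y.1) (M y.1)| ].
have step (x : nat * (R * R)) : {y | rel x y}.
  apply: cid; case: x => [k [u v]].
  have [iv|niv] := pselect (inv (k, (u, v))); last by exists (0%N, (0, 0)) => /niv.
  have [/= Hk ua ub' va vb] := iv.
  rewrite LS MS in Hk.
  have [u' [v' [h1 h2 h3 h4 h5]]] := circ_quarter (L0 k.+1) (M0 k.+1) Hk.
  exists (k.+1, (u', v')) => _ /=.
  by rewrite (LS k) (MS k); split=> //; apply/andP.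
have [f [f0 fS]] := dependent_choice step (0%N, (a, b)).
have L00 : L 0%N = l by rewrite /L expr0 divr1.
have M00 : M 0%N = m by rewrite /M expr0 divr1.
have Hf k : inv (f k) /\ (f k).1 = k.
  elim: k => [|k [IH E]].
    by rewrite f0; split=> //; split; rewrite /= ?L00 ?M00.
  have [E1 /andP[u1 u2] /andP[v1 v2] _] := fS k IH; rewrite E in E1.
  split; last by rewrite E1.
  case: IH; rewrite E => IH1 IH2 IH3 IH4 IH5; rewrite E1 in u2 v2.
  have := LS k; have := MS k => LSk MSk.
  by split; rewrite ?E1; first (apply: (rdiff_sub IH1); lra); lra.
have fE k : (f k).1 = k by have [] := Hf k.
pose A k := (f k).2.1; pose B k := (f k).2.2.
have fSk k : [/\ A k <= A k.+1 <= A k + L k.+1, B k <= B k.+1 <= B k + M k.+1 &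
   `|circ g (A k) (B k) (L k) (M k)| <= 4 * `|circ g (A k.+1) (B k.+1) (L k.+1) (M k.+1)| ].
  by have [_] := fS k (proj1 (Hf k)); rewrite !fE.
have Hk k : rdiff_on g (A k) (B k) (L k) (M k).
  by have [] := proj1 (Hf k); rewrite fE.
have [s0 s0P] : exists c, forall k, A k <= c <= A k + L k.
  apply: nested_segments => // k; have [/andP[h1 h2] _ _] := fSk k => //.
  by have := LS k; lra.
have [t0 t0P] : exists c, forall k, B k <= c <= B k + M k.
  apply: nested_segments => // k; have [_ /andP[h1 h2] _] := fSk k => //.
  by have := MS k; lra.
have grow k : `|circ g a b l m| <= 4 ^+ k * `|circ g (A k) (B k) (L k) (M k)|.
  elim: k => [|k IH]; first by rewrite mul1r /A /B f0 L00 M00.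
  have [_ _ h] := fSk k; apply: le_trans IH _.
  by rewrite exprSr -mulrA ler_wpM2l // exprn_ge0.
pose N := l + m + 1; have N0 : 0 < N by rewrite /N; lra.
pose e' := e / (2 * N ^+ 2); have e'0 : 0 < e'.
  by rewrite /e' divr_gt0 // mulr_gt0 // exprn_gt0.
have s0t0 : rdiff g s0 t0.
  by apply: (Hk 0%N); [exact: s0P|exact: t0P].
have [d /(_ e' e'0) [r r0 rH]] := s0t0.
have N0' := ltW N0.
have [k kr] := half_pow_small N0' r0.
have p2 : 0 < (2 : R) ^+ k by rewrite exprn_gt0.
have Lr : L k < r by apply: le_lt_trans kr; rewrite /L ler_pM2r ?invr_gt0 // /N; lra.
have Mr : M k < r by apply: le_lt_trans kr; rewrite /M ler_pM2r ?invr_gt0 // /N; lra.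
have bd : `|circ g (A k) (B k) (L k) (M k)| <= 2 * (e' * (L k + M k)) * (L k + M k).
  apply: (@circ_bound _ g _ _ _ _ (g s0 t0) d s0 t0) => // s t hs ht.
  have hs0 := s0P k; have ht0 := t0P k.
  have hs1 : `|s - s0| <= L k by rewrite ler_norml; apply/andP; split; lra.
  have ht1 : `|t - t0| <= M k by rewrite ler_norml; apply/andP; split; lra.
  have := rH _ _ (le_lt_trans hs1 Lr) (le_lt_trans ht1 Mr).
  rewrite (addrC s0) (addrC t0) !subrK opprD addrA => /le_trans; apply.
  by rewrite ler_wpM2l // ?lerD // ltW.
apply: le_trans (grow k) _.
apply: le_trans (ler_wpM2l _ bd) _; first by rewrite exprn_ge0.
have -> : 4 ^+ k * (2 * (e' * (L k + M k)) * (L k + M k)) = 2 * e' * (l + m) ^+ 2.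
  have -> : (4 : R) = 2 ^+ 2 by ring.
  rewrite /L /M -exprM mulnC exprM; field.
  by rewrite gt_eqF.
rewrite /e'; have -> : 2 * (e / (2 * N ^+ 2)) * (l + m) ^+ 2 = e * ((l + m) / N) ^+ 2.
  by field; rewrite gt_eqF.
rewrite ger_pMr // expr_le1 ?divr_ge0 ?addr_ge0 ?(ltW N0) //.
by rewrite ler_pdivrMr // mul1r /N; lra.
Qed.

End GoursatTheorem.

(** * Circles: values at the centre *)

Section MeanValue.
Variable R : realType.
Local Notation C := (Cplx R).
Implicit Types (s t x y e : R).

Lemma is_derive_eps (f : R -> R) x (d : R) : is_derive x 1 f d ->
  forall e, 0 < e -> exists2 r, 0 < r &
  forall h, `|h| < r -> `|f (x + h) - f x - d * h| <= e * `|h|.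
Proof.
move=> [df dE] e e0.
have /cvgrPdist_le /(_ e e0) : (fun h : R => h^-1 *: ((f \o shift x) (h *: 1) - f x)) @ 0^' --> d.
  by rewrite -dE; exact: df.
move=> /nbhs_ballP [r /= r0 rH]; exists r => // h hr.
have [->|h0] := eqVneq h 0; first by rewrite addr0 subrr mulr0 subr0 normr0 mulr0.
have /(_ _ h0) := rH h.
rewrite /ball /= sub0r normrN => /(_ hr).
rewrite /shift /= /GRing.scale /= mulr1 (addrC h) => H.
have -> : f (x + h) - f x - d * h = - (d - h^-1 * (f (x + h) - f x)) * h by field.
by rewrite normrM normrN ler_wpM2r.
Qed.

Definition cexp s t : C := RtoC (expR s) * mkC (cos t) (sin t).

Lemma cexpD s t x y : cexp (s + x) (t + y) = cexp s t * cexp x y.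
Proof.
rewrite /cexp expRD rmorphM mulrACA; congr (_ * _).
by apply: eqC; rewrite ?creM ?cimM /= ?cosD ?sinD; ring.
Qed.

Lemma cabs_cexp s t : cabs (cexp s t) = expR s.
Proof.
rewrite /cexp cabsM cabs_RtoC ger0_norm ?expR_ge0 //.
have -> : cabs (mkC (cos t) (sin t)) = 1; last by rewrite mulr1.
by apply/eqP; rewrite -sqrp_eq1 ?cabs_ge0 // cabs_sqr cos2Dsin2.
Qed.

Lemma cexp2pi s : cexp s (pi *+ 2) = cexp s 0.
Proof. by rewrite /cexp cos2pi sin2pi cos0 sin0. Qed.

Lemma cexp_eps e : 0 < e -> exists2 r, 0 < r & forall x y, `|x| < r -> `|y| < r ->
  cabs (cexp x y - 1 - mkC x y) <= e * (`|x| + `|y|).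
Proof.
move=> e0; pose e1 := Num.min (e / 4) (1 / 4).
have e10 : 0 < e1 by rewrite lt_min; apply/andP; split; lra.
have e1e : e1 <= e / 4 by rewrite ge_min lexx.
have e1h : e1 <= 1 / 4 by rewrite ge_min lexx orbT.
have [r1 r10 H1] := is_derive_eps (is_derive_expR (0 : R)) e10.
have [r2 r20 H2] := is_derive_eps (is_derive_cos (0 : R)) e10.
have [r3 r30 H3] := is_derive_eps (is_derive_sin (0 : R)) e10.
have r0 : 0 < Num.min (Num.min r1 e1) (Num.min r2 r3).
  by rewrite lt_min; apply/andP; split; rewrite lt_min; apply/andP; split.
exists (Num.min (Num.min r1 e1) (Num.min r2 r3)) => // x y.
rewrite !lt_min => /andP[/andP[x1 x4] _] /andP[/andP[_ y4] /andP[y2 y3]].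
have := H1 x x1; have := H2 y y2; have := H3 y y3.
rewrite !add0r expR0 sin0 cos0 oppr0 mul0r !mul1r ?subr0 ?addr0.
set E := expR x; set c := cos y; set s := sin y => h3 h2 h1.
apply: le_trans (cabs_le _) _.
rewrite !(creD, cimD, creN, cimN) /cexp creM cimM creR cimR /= -/E -/c -/s.
have x0 := normr_ge0 x; have y0 := normr_ge0 y.
have hE : `|E - 1| <= 2 * `|x|.
  have := ler_normD (E - 1 - x) x; rewrite subrK => /le_trans; apply.
  by apply: le_trans (lerD h1 (lexx _)) _; nra.
have hE2 : `|E| <= 2.
  have := ler_normD (E - 1) 1; rewrite subrK normr1 => /le_trans; apply.
  by apply: le_trans (lerD hE (lexx _)) _; lra.
have t1 : `|E * c - 0 * s - 1 - x| <= e1 * `|x| + 2 * (e1 * `|y|).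
  have -> : E * c - 0 * s - 1 - x = (E - 1 - x) + E * (c - 1) by ring.
  apply: le_trans (ler_normD _ _) _; apply: lerD => //.
  by rewrite normrM ler_pM.
have t2 : `|E * s + 0 * c - 0 - y| <= 2 * (e1 * `|y|) + 2 * `|x| * e1.
  have -> : E * s + 0 * c - 0 - y = E * (s - y) + (E - 1) * y by ring.
  apply: le_trans (ler_normD _ _) _; apply: lerD.
    by rewrite normrM ler_pM.
  by rewrite normrM; apply: ler_pM => //; rewrite ltW // lt_min.
apply: le_trans (lerD t1 t2) _.
nra.
Qed.

(** In logarithmic polar coordinates circles become vertical segments and the
    period [2 pi] makes the horizontal sides of a rectangle cancel. *)
Lemma polar_rdiff (G : C -> C) (p : C) s t : cdiff G (p + cexp s t) ->
  rdiff (fun s t => G (p + cexp s t)) s t.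
Proof.
move=> [d dG]; set E := cexp s t.
have K : cderiv (fun w => G (p + E * w)) 1 (d * E).
  apply: (cderiv_comp (f := fun w => p + E * w)); last by rewrite mulr1.
  have := cderivD (cderiv_cst p 1) (cderivM (cderiv_cst E 1) (cderiv_id 1)).
  by rewrite mul0r !add0r mulr1.
exists (d * E) => e e0.
pose D := cabs (d * E); have D0 : 0 <= D by exact: cabs_ge0.
pose e1 := Num.min 1 (e / (2 * (D + 1))).
have e10 : 0 < e1 by rewrite lt_min ltr01 divr_gt0 // mulr_gt0 //; lra.
have e1D : e1 * D <= e / 2.
  have : e1 <= e / (2 * (D + 1)) by rewrite ge_min lexx orbT.
  rewrite ler_pdivlMr ?mulr_gt0 //; last lra.
  nra.
have e1l : e1 <= 1 by rewrite ge_min lexx.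
have [r1 r10 H1] := cexp_eps e10.
have e40 : 0 < e / 4 by lra.
have /cderivP /(_ _ e40) /nbhsC [r2 r20 H2] := K.
exists (Num.min r1 (r2 / 4)); first by rewrite lt_min r10 divr_gt0.
move=> x y; rewrite !lt_min => /andP[x1 x2] /andP[y1 y2].
have h1 := H1 x y x1 y1.
have x0 := normr_ge0 x; have y0 := normr_ge0 y.
have w1 : cabs (cexp x y - 1) <= 2 * (`|x| + `|y|).
  have := cabsD (cexp x y - 1 - mkC x y) (mkC x y); rewrite subrK => /le_trans; apply.
  apply: le_trans (lerD h1 (cabs_mkC _ _)) _; nra.
have /H2 h2 : cabs (cexp x y - 1) < r2 by apply: le_lt_trans w1 _; lra.
rewrite mulr1 in h2.
rewrite cexpD -/E.
have -> : G (p + E * cexp x y) - G (p + E) - d * E * mkC x y =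
  (G (p + E * cexp x y) - G (p + E) - d * E * (cexp x y - 1)) +
  d * E * (cexp x y - 1 - mkC x y) by ring.
apply: le_trans (cabsD _ _) _; rewrite [cabs (d * E * _)]cabsM -/D.
have h3 : D * cabs (cexp x y - 1 - mkC x y) <= D * (e1 * (`|x| + `|y|)).
  by rewrite ler_wpM2l.
have h4 : e / 4 * cabs (cexp x y - 1) <= e / 4 * (2 * (`|x| + `|y|)).
  by rewrite ler_wpM2l //; lra.
have h5 : e1 * D * (`|x| + `|y|) <= e / 2 * (`|x| + `|y|).
  by rewrite ler_wpM2r // addr_ge0.
lra.
Qed.

(** The mean of [cre G] over a circle of centre [p] does not depend on the
    radius (Goursat's theorem on a rectangle of height [2 pi]), and for small
    radii it is close to [cre (G p)].  Stated as a comparison, the conclusion is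
    stable under uniform limits of [G]. *)
Theorem center_le (G : C -> C) (p : C) (rho m : R) : 0 < rho ->
  (forall x : C, cabs (x - p) <= rho -> cdiff G x) ->
  (forall x : C, cabs (x - p) = rho -> cre (G x) <= m) -> cre (G p) <= m.
Proof.
move=> rho0 dG Gm; rewrite leNgt; apply/negP => mG.
pose e := (cre (G p) - m) / 2; have e0 : 0 < e by rewrite /e; lra.
have /cdiff_continuous /continuousCP /(_ _ e0) /nbhsC [r r0 rH] : cdiff G p.
  by apply: dG; rewrite subrr cabs0 ltW.
pose b := ln rho; pose a := Num.min b (ln (r / 2)).
have ab : a <= b by rewrite ge_min lexx.
have ar : expR a < r.
  apply: (@le_lt_trans _ _ (expR (ln (r / 2)))).
    by rewrite ler_expR ge_min lexx orbT.
  by rewrite lnK ?posrE //; lra.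
pose g s t := G (p + cexp s t).
have pi2 : 0 <= (pi : R) *+ 2 by rewrite mulrn_wge0 // pi_ge0.
have ba : 0 <= b - a by rewrite subr_ge0.
have H : rdiff_on g a 0 (b - a) (pi *+ 2).
  move=> s t hs ht; apply: polar_rdiff; apply: dG.
  rewrite addrC addKr cabs_cexp -[leRHS](lnK (x := rho)) ?posrE //.
  by rewrite ler_expR -/b; lra.
have := goursat ba pi2 H; rewrite /circ.
have -> : (fun s => cim (g s (0 + pi *+ 2)) - cim (g s 0)) = (fun _ => 0 : R).
  by apply/funext => s; rewrite add0r /g cexp2pi subrr.
rewrite sint_cst // mul0r subr0 => I0.
have : sint (fun t => cre (g (a + (b - a)) t) - cre (g a t)) 0 (pi *+ 2) <= - e * (pi *+ 2).
  rewrite -(sint_cst _ 0) //; apply: sint_le; first 2 last.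
  - move=> t ht.
    have h1 : cre (g (a + (b - a)) t) <= m.
      apply: Gm; rewrite (addrC p) addrK cabs_cexp addrC subrK lnK ?posrE //.
    have h2 : cabs (g a t - G p) < e.
      by apply: rH; rewrite (addrC p) addrK cabs_cexp.
    have := le_lt_trans (cre_le _) h2; rewrite creD creN ltr_norml => /andP[h3 _].
    by rewrite /e in h3 *; lra.
  - by apply: scontB; apply: (scont_re H); lra.
  - exact: scont_cst.
rewrite I0 leNgt => /negP; apply.
by rewrite mulNr oppr_lt0 mulr_gt0 // mulrn_wgt0 // pi_gt0.
Qed.

End MeanValue.

(** * The maximum modulus principle *)

Lemma real_continuousP (R : realType) (T : topologicalType) (f : T -> R) (p : T) :
  (forall e : R, 0 < e -> \forall x \near p, `|f x - f p| < e) -> {for p, continuous f}.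
Proof.
by move=> H; apply/cvgrPdist_lt => e e0; apply: filterS (H e e0) => x; rewrite distrC.
Qed.

Section MaximumModulus.
Variable R : realType.
Local Notation C := (Cplx R).
Implicit Types (F G g h q : C -> C) (p x : C) (e : R).

(** Being, near [p], a uniform limit of holomorphic functions.  Such limits are
    again holomorphic, but the maximum principle holds for them directly, and
    this form is visibly stable under sums and products; the Jacobian
    determinant along a curve is obtained in this form. *)
Definition lholo F p := exists2 U : set C, nbhs p U &
  (exists B : R, forall x, U x -> cabs (F x) <= B) /\
  (forall e, 0 < e -> exists G, forall x, U x -> cdiff G x /\ cabs (F x - G x) <= e).

Lemma cdiff_lholo g p : (\forall x \near p, cdiff g x) -> lholo g p.
Proof.
move=> dg; have cg := cdiff_continuous (nbhs_singleton dg).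
exists [set x | cdiff g x /\ cabs (g x - g p) < 1].
  by apply: filterI => //; exact: (proj1 (continuousCP _ _) cg 1 ltr01).
split; last by move=> e e0; exists g => x [dx _]; rewrite subrr cabs0 ltW.
exists (cabs (g p) + 1) => x [_ h].
by have := cabsD (g x - g p) (g p); rewrite subrK; lra.
Qed.

Lemma lholo_continuous F p : lholo F p -> {for p, continuous F}.
Proof.
move=> [U Up [_ H]]; apply/continuousCP => e e0.
have e40 : 0 < e / 4 by lra.
have [G GH] := H _ e40.
have [dGp Gp] := GH _ (nbhs_singleton Up).
have := proj1 (continuousCP _ _) (cdiff_continuous dGp) _ e40.
apply: filterS2 Up => x /GH [_ h1] h2.
rewrite (_ : F x - F p = (F x - G x) + (G x - G p) - (F p - G p)); last by ring.
have h3 := cabsB (F x - G x + (G x - G p)) (F p - G p).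
have h4 := cabsD (F x - G x) (G x - G p); lra.
Qed.

Lemma lholoD F G p : lholo F p -> lholo G p -> lholo (fun x => F x + G x) p.
Proof.
move=> [U Up [[B UB] UH]] [V Vp [[B' VB] VH]]; exists (U `&` V); first exact: filterI.
split=> [|e e0].
  exists (B + B') => x [/UB ? /VB ?]; apply: le_trans (cabsD _ _) _; lra.
have e20 : 0 < e / 2 by lra.
have [F' F'H] := UH _ e20; have [G' G'H] := VH _ e20.
exists (fun x => F' x + G' x) => x [/F'H [d1 h1] /G'H [d2 h2]]; split.
  exact: cdiffD.
rewrite opprD addrACA; apply: le_trans (cabsD _ _) _; lra.
Qed.

Lemma lholoM F G p : lholo F p -> lholo G p -> lholo (fun x => F x * G x) p.
Proof.
move=> [U Up [[B UB] UH]] [V Vp [[B' VB] VH]]; exists (U `&` V); first exact: filterI.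
have B0 : 0 <= B := le_trans (cabs_ge0 _) (UB _ (nbhs_singleton Up)).
have B'0 : 0 <= B' := le_trans (cabs_ge0 _) (VB _ (nbhs_singleton Vp)).
split=> [|e e0].
  by exists (B * B') => x [/UB ? /VB ?]; rewrite cabsM ler_pM ?cabs_ge0.
pose d := Num.min 1 (e / (B + B' + 1)).
have d0 : 0 < d by rewrite lt_min ltr01 divr_gt0 //; lra.
have d1 : d <= 1 by rewrite ge_min lexx.
have de : d * (B + B' + 1) <= e.
  by rewrite -ler_pdivlMr ?ge_min ?lexx ?orbT //; lra.
have [F' F'H] := UH _ d0; have [G' G'H] := VH _ d0.
exists (fun x => F' x * G' x) => x [Ux Vx].
have [df hf] := F'H _ Ux; have [dg hg] := G'H _ Vx.
split; first exact: cdiffM.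
have -> : F x * G x - F' x * G' x = F x * (G x - G' x) + (F x - F' x) * G' x by ring.
have g1 : cabs (G' x) <= B' + d.
  rewrite (_ : G' x = G x - (G x - G' x)); last by ring.
  by apply: le_trans (cabsB _ _) _; apply: lerD => //; exact: VB.
apply: le_trans (cabsD _ _) _; rewrite !cabsM.
have h1 : cabs (F x) * cabs (G x - G' x) <= B * d.
  by apply: ler_pM; rewrite ?cabs_ge0 //; exact: UB.
have h2 : cabs (F x - F' x) * cabs (G' x) <= d * (B' + d).
  by apply: ler_pM; rewrite ?cabs_ge0.
nra.
Qed.

Lemma lholo_cst (a : C) p : lholo (fun _ => a) p.
Proof. by apply: cdiff_lholo; apply: nbhsW => x; exact: cdiff_cst. Qed.

Lemma lholoX F p k : lholo F p -> lholo (fun x => F x ^+ k) p.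
Proof.
move=> H; elim: k => [|k IH]; first exact: lholo_cst.
by under eq_fun do rewrite exprS; exact: lholoM.
Qed.

Lemma cabs_continuous p : {for p, continuous (@cabs R : C -> R)}.
Proof.
apply: real_continuousP => e e0; apply/nbhsC; exists e => // x xp.
exact: le_lt_trans (cabs_dist _ _) _.
Qed.

Definition cdisc : set C := [set z | cabs z <= 1].

Lemma cdisc_compact : compact cdisc.
Proof.
pose I := `[(-1 : R), 1]%classic.
have cI : compact (I `*` I) by apply: compact_setX; exact: segment_compact.
pose f (u : R * R) : C := mkC u.1 u.2.
have cf : continuous f.
  move=> [a b] P /nbhsC [d d0 dP].
  apply/nbhs_ballP; exists (d / 2) => /=; first by rewrite divr_gt0.
  move=> [a' b'] [/= ha hb]; apply: dP.
  have -> : f (a', b') - f (a, b) = mkC (a' - a) (b' - b) by [].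
  apply: le_lt_trans (cabs_mkC _ _) _.
  by rewrite /ball /= distrC in ha; rewrite /ball /= distrC in hb; lra.
apply: (@subclosed_compact _ _ (f @` (I `*` I))).
- have -> : cdisc = (@cabs R : C -> R) @^-1` [set r | r <= 1] by [].
  apply: closed_comp; last exact: closed_le.
  by move=> x _; exact: cabs_continuous.
- by apply: continuous_compact => //; exact: continuous_subspaceT.
- move=> z zD; exists (cre z, cim z); last by case: z zD.
  have := cre_le z; have := cim_le z; rewrite /cdisc /= in zD.
  by split; rewrite /I /= in_itv /= -ler_norml; lra.
Qed.

Definition within_disc (f : C -> R) := forall p, cabs p <= 1 -> forall e, 0 < e ->
  \forall x \near p, cabs x <= 1 -> `|f x - f p| <= e.

Lemma disc_max (f : C -> R) : within_disc f ->
  exists2 c, cabs c <= 1 & forall x, cabs x <= 1 -> f x <= f c.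
Proof.
move=> cf.
have D0 : cdisc !=set0 by exists 0; rewrite /cdisc /mkset cabs0 ler01.
have [|c cD cmax] := compact_EVT_max D0 cdisc_compact (f := f).
  apply/subspace_continuousP => p pD; apply/cvgrPdist_le => e e0.
  have e20 : 0 < e / 2 by lra.
  apply: filterS (cf p pD _ e20) => x H /H; rewrite distrC; lra.
exists c; first by rewrite inE in cD.
by move=> x xD; apply: cmax; rewrite inE.
Qed.

Lemma cabs_sqrD p x : cabs x ^+ 2 =
  cabs p ^+ 2 + cabs (x - p) ^+ 2 + 2 * cre (cconj p * (x - p)).
Proof. rewrite !cabs_sqr !creM !cre_conj !cim_conj !creD !cimD !creN !cimN; ring. Qed.

(** Adding [e |z|^2] makes the modulus strictly subharmonic wherever [F] is
    holomorphic, so that it has no interior maximum off the zeros of [F]. *)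
Theorem max_modulus F (M : R) : 0 <= M -> within_disc (fun x => cabs (F x)) ->
  (forall p, cabs p < 1 -> F p != 0 -> lholo F p) ->
  (forall p, cabs p = 1 -> cabs (F p) <= M) ->
  forall p, cabs p <= 1 -> cabs (F p) <= M.
Proof.
move=> M0 cF hF bF p0 p0D; apply/ler_addgt0Pr => e e0.
have ce : within_disc (fun x => cabs (F x) + e * cabs x ^+ 2).
  move=> p pD d d0.
  have d20 : 0 < d / 2 by lra.
  have h1 := cF p pD _ d20.
  have d3 : 0 < d / 2 / (2 * e) by rewrite divr_gt0 //; lra.
  have h2 : \forall x \near p, cabs (x - p) < d / 2 / (2 * e) by apply/nbhsC; exists (d / 2 / (2 * e)).
  apply: filterS2 h1 h2 => x h1 h2 xD.
  rewrite (_ : _ - _ = (cabs (F x) - cabs (F p)) + e * (cabs x ^+ 2 - cabs p ^+ 2)); last by ring.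
  apply: le_trans (ler_normD _ _) _.
  have : `|e * (cabs x ^+ 2 - cabs p ^+ 2)| <= d / 2.
    rewrite normrM (gtr0_norm e0) subr_sqr normrM.
    rewrite ltr_pdivlMr in h2; last lra.
    have h3 := cabs_dist x p; have xp := cabs_ge0 x; have pp := cabs_ge0 p.
    have h4 : `|cabs x + cabs p| <= 2 by rewrite ger0_norm; lra.
    have h5 : `|cabs x - cabs p| * `|cabs x + cabs p| <= cabs (x - p) * 2.
      by rewrite ler_pM.
    have := ler_wpM2l (ltW e0) h5; lra.
  have := h1 xD; lra.
have [c cD cmax] := disc_max ce.
suff : cabs (F c) + e * cabs c ^+ 2 <= M + e.
  move=> h; have := cmax _ p0D; have := sqr_ge0 (cabs p0); nra.
have c1 : cabs c ^+ 2 <= 1 by rewrite expr_le1 // cabs_ge0.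
have ec1 : e * cabs c ^+ 2 <= e by rewrite ger_pMr.
have [cE|cn1] := eqVneq (cabs c) 1; first by have := bF _ cE; lra.
have [->|Fc0] := eqVneq (F c) 0; first by rewrite cabs0; lra.
have {cn1} cl1 : cabs c < 1 by rewrite lt_neqAle cn1.
exfalso.
have [U /nbhsC [r r0 rU] [_ UH]] := hF _ cl1 Fc0.
(* A circle around the interior maximum [c], inside the disc and inside [U]. *)
pose rho := Num.min (r / 2) (1 - cabs c).
have rho0 : 0 < rho by rewrite lt_min; apply/andP; split; lra.
have rhor : rho < r.
  by apply: (@le_lt_trans _ _ (r / 2)); [rewrite ge_min lexx|lra].
have rhoc : rho <= 1 - cabs c by rewrite ge_min lexx orbT.
pose eta := e * rho ^+ 2 / 4.
have er0 : 0 < e * rho ^+ 2 by rewrite mulr_gt0 // exprn_gt0.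
have eta0 : 0 < eta by rewrite /eta; lra.
have [G GH] := UH _ eta0.
have [u u1 uF] := rotation (F c).
have inU x : cabs (x - c) <= rho -> U x by move=> xc; apply: rU; lra.
(* The linear term turns [e |x|^2] into [e |c|^2 + e rho^2] on the circle. *)
have := @center_le R (fun x => u * G x + RtoC (2 * e) * cconj c * (x - c)) c rho
  (cabs (F c) - e * rho ^+ 2 + eta) rho0.
have -> : u * G c + RtoC (2 * e) * cconj c * (c - c) = u * F c - u * (F c - G c) by ring.
have h0 : cabs (u * (F c - G c)) <= eta.
  rewrite cabsM u1 mul1r; apply: (proj2 (GH c _)); apply: inU.
  by rewrite subrr cabs0 ltW.
have h0' := le_trans (ler_norm _) (le_trans (cre_le _) h0).
rewrite creD creN uF creR => H.
suff : cabs (F c) - cre (u * (F c - G c)) <= cabs (F c) - e * rho ^+ 2 + eta.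
  by rewrite /eta in h0' *; lra.
apply: H => x xc.
  apply: cdiffD; apply: cdiffM.
  - exact: cdiff_cst.
  - by have [] := GH x (inU x xc).
  - exact: cdiff_cst.
  - by apply: cdiffB; [exact: cdiff_id|exact: cdiff_cst].
have xU : U x by apply: inU; rewrite xc.
have xD : cabs x <= 1.
  by have := cabsD (x - c) c; rewrite subrK; lra.
have h1 := cmax x xD.
have h2 := cabs_sqrD c x; rewrite xc in h2.
have h3 : cre (u * G x) <= cabs (F x) + eta.
  apply: le_trans (ler_norm _) _; apply: le_trans (cre_le _) _.
  rewrite cabsM u1 mul1r (_ : G x = F x - (F x - G x)); last by ring.
  apply: le_trans (cabsB _ _) _; rewrite lerD2l; exact: (proj2 (GH x xU)).
have E : cre (RtoC (2 * e) * cconj c * (x - c)) = 2 * e * cre (cconj c * (x - c)).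
  by rewrite -mulrA creM creR cimR mul0r subr0.
rewrite creD E.
have := f_equal (fun t => e * t) h2 => /= h4.
lra.
Qed.

End MaximumModulus.

(** * Maximum principle and Schwarz-Pick lemma with an exceptional set *)

Section SchwarzPick.
Variable R : realType.
Local Notation C := (Cplx R).
Implicit Types (F G g h q : C -> C) (p x b k w : C) (e : R).

Lemma geometric_small (t e : R) : 0 <= t < 1 -> 0 < e -> exists N : nat, t ^+ N < e.
Proof.
move=> /andP[t0 t1] e0.
have : (fun n => t ^+ n) @ \oo --> (0 : R) by apply: cvg_expr; rewrite ger0_norm.
move=> /cvgrPdist_lt /(_ e e0) [N _ /(_ N (leqnn N))] /= H; exists N.
by move: H; rewrite sub0r normrN ger0_norm // exprn_ge0.
Qed.

Lemma within_disc_cont F : (forall p, cabs p <= 1 -> {for p, continuous F} \/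
   (F p = 0 /\ forall e, 0 < e -> \forall x \near p, cabs x <= 1 -> cabs (F x) <= e)) ->
  within_disc (fun x => cabs (F x)).
Proof.
move=> H p pD e e0; have [cF|[F0 cF]] := H p pD.
  move/continuousCP : cF => /(_ e e0); apply: filterS => x h _.
  by apply: le_trans (cabs_dist _ _) _; exact: ltW.
apply: filterS (cF e e0) => x h /h; rewrite F0 cabs0 subr0.
by rewrite ger0_norm ?cabs_ge0.
Qed.

(** The exceptional set [{h = 0}] is invisible: [q ^+ N * h] extends by [0] to
    a function for which the maximum principle holds, and [N] is arbitrary. *)
Theorem max_modulus_exceptional q h (M B : R) : 0 <= M ->
  (forall p, cabs p <= 1 -> h p = 0 -> forall e, 0 < e ->
     \forall x \near p, cabs x <= 1 -> cabs (h x) <= e) ->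
  (forall p, cabs p <= 1 -> h p != 0 -> lholo h p /\ lholo q p) ->
  (forall p, cabs p <= 1 -> h p != 0 -> cabs (q p) <= B) ->
  (forall p, cabs p = 1 -> h p != 0 -> cabs (q p) <= M) ->
  forall p, cabs p <= 1 -> h p != 0 -> cabs (q p) <= M.
Proof.
move=> M0 h0 hl qB qM p pD hp.
have [z zD zmax] : exists2 z, cabs z <= 1 & forall x, cabs x <= 1 -> cabs (h x) <= cabs (h z).
  apply: disc_max; apply: within_disc_cont => x xD.
  have [hx|hx] := eqVneq (h x) 0; last by left; apply: lholo_continuous; apply hl.
  by right; split=> // e e0; exact: h0.
set H := cabs (h z) in zmax.
have H0 : 0 < H by apply: lt_le_trans (zmax p pD); rewrite cabs_gt0.
have B0 : 0 <= B := le_trans (cabs_ge0 _) (qB _ pD hp).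
have key N : cabs (q p) ^+ N * cabs (h p) <= M ^+ N * H.
  rewrite -cabsX -cabsM.
  apply: (max_modulus (F := fun x => q x ^+ N * h x)) => //.
  - by rewrite mulr_ge0 ?exprn_ge0 // ltW.
  - apply: within_disc_cont => x xD.
    have [hx|hx] := eqVneq (h x) 0.
      right; rewrite hx mulr0; split=> // e e0.
      have d0 : 0 < e / (B ^+ N + 1) by rewrite divr_gt0 // ltr_wpDl // exprn_ge0.
      apply: filterS (h0 x xD hx _ d0) => y H1 yD.
      have [->|hy] := eqVneq (h y) 0; first by rewrite mulr0 cabs0 ltW.
      have h1 := H1 yD; rewrite ler_pdivlMr in h1; last by rewrite ltr_wpDl // exprn_ge0.
      rewrite cabsM cabsX; apply: le_trans h1; rewrite mulrC ler_wpM2l ?cabs_ge0 //.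
      by apply: le_trans (_ : B ^+ N <= _); [apply: lerXn2r; rewrite ?nnegrE ?cabs_ge0 //; exact: qB|rewrite lerDl].
    by left; apply: lholo_continuous; apply: lholoM; [apply: lholoX|]; apply hl.
  - move=> x /ltW xD; have [->|hx] := eqVneq (h x) 0; first by rewrite mulr0 eqxx.
    by move=> _; apply: lholoM; [apply: lholoX|]; apply hl.
  - move=> x x1; have xD : cabs x <= 1 by rewrite x1.
    have [->|hx] := eqVneq (h x) 0.
      by rewrite mulr0 cabs0 mulr_ge0 ?exprn_ge0 // ltW.
    rewrite cabsM cabsX ler_pM ?exprn_ge0 ?cabs_ge0 //; last exact: zmax.
    by apply: lerXn2r; rewrite ?nnegrE ?cabs_ge0 //; exact: qM.
rewrite leNgt; apply/negP => Mq.
have q0 : 0 < cabs (q p) by exact: le_lt_trans Mq.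
have hp0 : 0 < cabs (h p) by rewrite cabs_gt0.
have t01 : 0 <= M / cabs (q p) < 1.
  by rewrite divr_ge0 ?cabs_ge0 //= ltr_pdivrMr // mul1r.
have [N] := geometric_small t01 (divr_gt0 hp0 H0).
rewrite ltNge => /negP; apply.
rewrite ler_pdivrMr // expr_div_n mulrAC ler_pdivlMr ?exprn_gt0 //.
by rewrite mulrC.
Qed.

Lemma mobius_identity k w : cabs (1 - cconj k * w) ^+ 2 - cabs (w - k) ^+ 2 =
  (1 - cabs k ^+ 2) * (1 - cabs w ^+ 2).
Proof.
rewrite !cabs_sqr !(creD, cimD, creN, cimN, creM, cimM, cre_conj, cim_conj).
have -> : cre (1 : C) = 1 by []. have -> : cim (1 : C) = 0 by []. ring.
Qed.

Lemma mobius_le k w : cabs k <= 1 -> cabs w <= 1 ->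
  cabs (w - k) <= cabs (1 - cconj k * w).
Proof.
move=> k1 g1; rewrite -(@ler_pXn2r _ 2) ?nnegrE ?cabs_ge0 //.
rewrite -subr_ge0 mobius_identity mulr_ge0 // subr_ge0 expr_le1 ?cabs_ge0 //.
Qed.

Lemma mobius_eq k w : cabs w = 1 -> cabs (1 - cconj k * w) = cabs (w - k).
Proof.
move=> g1; apply/eqP; rewrite -(@eqrXn2 _ 2) ?cabs_ge0 //.
by rewrite -subr_eq0 mobius_identity g1 expr1n subrr mulr0.
Qed.

Lemma mobius_den k w : cabs w <= 1 -> 1 - cabs k <= cabs (1 - cconj k * w).
Proof.
move=> g1; have := cabsD (1 - cconj k * w) (cconj k * w); rewrite subrK cabs1.
rewrite cabsM cabs_conj; have := cabs_ge0 k; have := cabs_ge0 w; nra.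
Qed.

(** The maximum principle applied to the quotient of the disc automorphism
    sending [k] to [0], evaluated at [g], by the one sending [b] to [0].  The
    point [b] joins the exceptional set, so [g] need not be differentiable
    there and [k] plays the role of its value. *)
Theorem schwarz_pick g h b k (L : R) : cabs b < 1 -> cabs k < 1 ->
  (\forall x \near b, h x != 0 -> cabs (g x - k) <= L * cabs (x - b)) ->
  (forall p, cabs p <= 1 -> h p = 0 -> forall e, 0 < e ->
     \forall x \near p, cabs x <= 1 -> cabs (h x) <= e) ->
  (forall p, cabs p <= 1 -> h p != 0 -> lholo h p) ->
  (forall p, cabs p <= 1 -> h p != 0 -> p != b -> \forall x \near p, cdiff g x) ->
  (forall p, cabs p <= 1 -> h p != 0 -> cabs (g p) <= 1) ->
  forall p, cabs p <= 1 -> h p != 0 ->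
  cabs (g p - k) * cabs (1 - cconj b * p) <= cabs (p - b) * cabs (1 - cconj k * g p).
Proof.
move=> b1 k1 gb h0 hl gd g1 p pD hp.
have [pb|pb] := eqVneq p b.
  have := nbhs_singleton gb; rewrite -pb => /(_ hp).
  rewrite subrr cabs0 mulr0 mul0r => gk.
  have /eqP -> : cabs (g p - k) == 0 by rewrite eq_le gk cabs_ge0.
  by rewrite mul0r.
have den x : cabs x <= 1 -> h x != 0 -> 0 < cabs (1 - cconj k * g x).
  by move=> xD hx; have := mobius_den k (g1 _ xD hx); lra.
have denb x : cabs x <= 1 -> 0 < cabs (1 - cconj b * x).
  by move=> xD; have := mobius_den b xD; lra.
pose q x := ((g x - k) / (1 - cconj k * g x)) * ((1 - cconj b * x) / (x - b)).
have qE x : cabs (q x) = (cabs (g x - k) / cabs (1 - cconj k * g x)) *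
    (cabs (1 - cconj b * x) / cabs (x - b)).
  by rewrite /q !cabsM !cabsV.
have [r r0 rH] : exists2 r : R, 0 < r & forall x, cabs (x - b) < r -> h x != 0 ->
    cabs (g x - k) <= L * cabs (x - b) by exact/nbhsC.
have ratio x : cabs x <= 1 -> h x != 0 -> cabs (g x - k) / cabs (1 - cconj k * g x) <= 1.
  move=> xD hx; rewrite ler_pdivrMr ?den // mul1r mobius_le ?g1 //; exact: ltW.
have numb x : cabs x <= 1 -> cabs (1 - cconj b * x) <= 2.
  move=> xD; apply: le_trans (cabsB _ _) _; rewrite cabs1 cabsM cabs_conj.
  have := cabs_ge0 b; have := cabs_ge0 x; nra.
suff : cabs (q p) <= 1.
  rewrite qE mulrACA -invfM ler_pdivrMr ?mul1r; last first.
    by rewrite mulr_gt0 ?den // cabs_gt0 subr_eq0.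
  by rewrite (mulrC (cabs (p - b))).
apply: (@max_modulus_exceptional q (fun x => (x - b) * h x) 1
  (Num.max (`|L| / (1 - cabs k) * 2) (2 / r))) => //.
- move=> x xD /eqP; rewrite mulf_eq0 subr_eq0 => xb0 e e0.
  have [hx0|hx0] := eqVneq (h x) 0.
    have e20 : 0 < e / 2 by lra.
    apply: filterS (h0 x xD hx0 _ e20) => y H yD; rewrite cabsM.
    have h1 := H yD; have h2 := cabsB y b; have := cabs_ge0 (h y).
    have := cabs_ge0 (y - b); nra.
  have {xb0} xb : x = b by apply/eqP; move: xb0; rewrite (negbTE hx0) orbF.
  rewrite xb in hx0 *; have [U Ub [[B UB] _]] := hl b (ltW b1) hx0.
  have B0 : 0 <= B := le_trans (cabs_ge0 _) (UB _ (nbhs_singleton Ub)).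
  have d0 : 0 < e / (B + 1) by rewrite divr_gt0 //; lra.
  have Hd : \forall y \near b, cabs (y - b) < e / (B + 1).
    by apply/nbhsC; exists (e / (B + 1)).
  apply: filterS2 Ub Hd => y /UB h1 h2 _; rewrite cabsM.
  rewrite ltr_pdivlMr in h2; last lra.
  have := cabs_ge0 (h y); have := cabs_ge0 (y - b); nra.
- move=> x xD; rewrite mulf_eq0 negb_or subr_eq0 => /andP[xb hx]; split.
    apply: lholoM; last exact: hl.
    apply: cdiff_lholo; apply: nbhsW => y.
    by apply: cdiffB; [exact: cdiff_id|exact: cdiff_cst].
  apply: cdiff_lholo.
  have dgx := gd x xD hx xb.
  have cgx := cdiff_continuous (nbhs_singleton dgx).
  have dx := den x xD hx.
  have k0 : 0 <= cabs k by exact: cabs_ge0.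
  have Hd : \forall y \near x, cabs (g y - g x) < cabs (1 - cconj k * g x).
    exact: (proj1 (continuousCP _ _) cgx).
  have Hb : \forall y \near x, cabs (y - x) < cabs (x - b).
    by apply/nbhsC; exists (cabs (x - b)); rewrite ?cabs_gt0 ?subr_eq0.
  apply: filterS3 dgx Hd Hb => y dy hy hyb.
  have y1 : 1 - cconj k * g y != 0.
    rewrite -cabs_gt0.
    have -> : 1 - cconj k * g y = (1 - cconj k * g x) - cconj k * (g y - g x) by ring.
    have := cabsD (1 - cconj k * g x - cconj k * (g y - g x)) (cconj k * (g y - g x)).
    rewrite subrK cabsM cabs_conj; have := cabs_ge0 (g y - g x); nra.
  have y2 : y - b != 0.
    apply: contraTneq hyb => /eqP; rewrite subr_eq0 => /eqP ->.
    by rewrite cabsBC ltxx.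
  have cc a : cdiff (fun _ : C => a) y by exact: cdiff_cst.
  have ci : cdiff (fun x : C => x) y by exact: cdiff_id.
  apply: cdiffM; apply: cdiffM.
  + exact: cdiffB.
  + by apply: cdiffV => //; apply: cdiffB => //; exact: cdiffM.
  + by apply: cdiffB => //; exact: cdiffM.
  + by apply: cdiffV => //; exact: cdiffB.
- move=> x xD; rewrite mulf_eq0 negb_or subr_eq0 => /andP[xb hx].
  have xb0 : 0 < cabs (x - b) by rewrite cabs_gt0 subr_eq0.
  have [xr|xr] := ltP (cabs (x - b)) r.
    rewrite le_max; apply/orP; left.
    have k10 : 0 < 1 - cabs k by lra.
    have h1 := rH x xr hx.
    have dx := den x xD hx.
    rewrite qE.
    rewrite (_ : cabs (g x - k) / _ * _ = (cabs (g x - k) / cabs (x - b)) *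
      (cabs (1 - cconj b * x) / cabs (1 - cconj k * g x))); last first.
      by field; rewrite !gt_eqF.
    rewrite (_ : `|L| / _ * _ = `|L| * (2 / (1 - cabs k))); last by field; rewrite gt_eqF.
    apply: ler_pM; rewrite ?divr_ge0 ?cabs_ge0 //.
      rewrite ler_pdivrMr //; apply: le_trans h1 _.
      by rewrite ler_wpM2r ?cabs_ge0 // ler_norm.
    apply: ler_pM; rewrite ?invr_ge0 ?cabs_ge0 ?numb //.
    by rewrite lef_pV2 ?posrE // mobius_den // g1.
  rewrite le_max; apply/orP; right; rewrite qE -[leRHS]mul1r.
  apply: ler_pM; rewrite ?divr_ge0 ?cabs_ge0 ?ratio //.
  apply: ler_pM; rewrite ?invr_ge0 ?cabs_ge0 ?numb //.
  by rewrite lef_pV2 ?posrE.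
- move=> x x1; rewrite mulf_eq0 negb_or subr_eq0 => /andP[xb hx].
  have xD : cabs x <= 1 by rewrite x1.
  rewrite qE (mobius_eq b x1) divff ?mulr1 ?ratio //.
  by rewrite cabs_eq0 subr_eq0.
- by rewrite mulf_eq0 negb_or subr_eq0 pb.
Qed.

End SchwarzPick.

(** * Cauchy estimates *)

Section CauchyEstimates.
Variable R : realType.
Local Notation C := (Cplx R).
Implicit Types (f g h : C -> C) (p x c d k b : C) (r M e : R).

Lemma cabs_nat (n : nat) : cabs (n%:R : C) = n%:R.
Proof. by rewrite -(rmorph_nat (@RtoC R)) cabs_RtoC normr_nat. Qed.

Lemma cderiv_slope g c d : cderiv g c d ->
  \forall x \near c, cabs (g x - g c) <= (cabs d + 1) * cabs (x - c).
Proof.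
move=> /cderivP /(_ 1 ltr01); apply: filterS => x H.
have := cabsD (g x - g c - d * (x - c)) (d * (x - c)); rewrite subrK cabsM.
lra.
Qed.

Lemma near_cabs_lt c r : 0 < r -> \forall x \near c, cabs (x - c) < r.
Proof. by move=> r0; apply/nbhsC; exists r. Qed.

Lemma near_in_disc c p r : cabs (p - c) < r -> \forall x \near p, cabs (x - c) < r.
Proof.
move=> pr; have d0 : 0 < r - cabs (p - c) by lra.
apply: filterS (near_cabs_lt p d0) => x h.
have := cabsD (x - p) (p - c); rewrite addrA subrK; lra.
Qed.

(** Schwarz's lemma for [(g - g c) / 2M], on the disc of half radius. *)
Lemma schwarz_lipschitz g c r M : 0 < r -> 0 <= M ->
  (forall x, cabs (x - c) < r -> cdiff g x /\ cabs (g x) <= M) ->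
  forall x, cabs (x - c) <= r / 2 -> cabs (g x - g c) <= 4 * M / r * cabs (x - c).
Proof.
move=> r0 M0 H x xr; apply/ler_addgt0Pr => e e0.
have rC : RtoC (r / 2) != 0 by rewrite RtoC_eq0; apply: lt0r_neq0; lra.
have crC : cabs (RtoC (r / 2)) = r / 2 by rewrite cabs_RtoC gtr0_norm //; lra.
pose M' := M + e / 4; have M'0 : 0 < M' by rewrite /M'; lra.
pose a y : C := c + RtoC (r / 2) * y.
have acE y : a y - c = RtoC (r / 2) * y by rewrite /a addrAC subrr add0r.
have ar y : cabs (a y - c) = r / 2 * cabs y by rewrite acE cabsM crC.
pose G y : C := (g (a y) - g c) * RtoC (2 * M')^-1.
have cM : cabs (RtoC (2 * M')^-1) = (2 * M')^-1.
  by rewrite cabs_RtoC ger0_norm // invr_ge0; lra.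
have cc : cabs (c - c) < r by rewrite subrr cabs0.
have dG y : cabs y <= 1 -> cdiff G y.
  move=> y1; apply: cdiffM; last exact: cdiff_cst.
  apply: cdiffB; last exact: cdiff_cst.
  apply: cdiff_comp; first exact: cdiff_affine.
  by apply H; rewrite ar; have := cabs_ge0 y; nra.
have a0 : a 0 = c by rewrite /a mulr0 addr0.
have G0 : G 0 = 0 by rewrite /G a0 subrr mul0r.
have [d dG0] : cdiff G 0 by apply: dG; rewrite cabs0.
have slope := cderiv_slope dG0.
have := @schwarz_pick R G (fun=> 1) 0 0 (cabs d + 1).
rewrite cabs0 ltr01 => /(_ isT isT) SP.
have {}SP : forall p, cabs p <= 1 -> cabs (G p) <= cabs p.
  move=> p p1; have := SP _ _ _ _ _ p p1 (oner_neq0 _).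
  rewrite cconj0 !mul0r !subr0 cabs1 !mulr1; apply.
  - by apply: filterS slope => y hy _; move: hy; rewrite G0 !subr0.
  - by move=> q _ /eqP; rewrite oner_eq0.
  - by move=> q _ _; exact: lholo_cst.
  - move=> q q1 _ _.
    have : \forall y \near q, cabs (a y - c) < r.
      have := near_cabs_lt q ltr01; apply: filterS => y hy; rewrite ar.
      have := cabsD (y - q) q; rewrite subrK; nra.
    apply: filterS => y hy; apply: cdiffM; last exact: cdiff_cst.
    apply: cdiffB; last exact: cdiff_cst.
    by apply: cdiff_comp; [exact: cdiff_affine|apply H].
  - move=> q q1 _; rewrite /G cabsM cM ler_pdivrMr ?mul1r; last lra.
    have h1 : cabs (g (a q)) <= M by apply H; rewrite ar; have := cabs_ge0 q; nra.
    have h2 : cabs (g c) <= M by apply H.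
    by apply: le_trans (cabsB _ _) _; rewrite /M'; lra.
pose y := (x - c) / RtoC (r / 2).
have ay : a y = x by rewrite /a /y mulrC divfK // addrC subrK.
have yE : cabs y = cabs (x - c) / (r / 2) by rewrite /y cabsM cabsV crC.
have y1 : cabs y <= 1 by rewrite yE ler_pdivrMr ?mul1r //; lra.
have := SP y y1; rewrite /G ay cabsM cM yE ler_pdivrMr; last lra.
move=> /le_trans; apply.
have E : cabs (x - c) / (r / 2) * (2 * M') =
  4 * M / r * cabs (x - c) + (cabs (x - c) / r) * e.
  by rewrite /M'; field; rewrite gt_eqF.
rewrite E lerD2l; rewrite ger_pMl // ler_pdivrMr // mul1r; lra.
Qed.

Definition slope g (h z : C) : C := (g (z + h) - g z) / h.

(** Difference quotients are holomorphic and bounded uniformly in the step, so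
    they are Lipschitz uniformly in the step; halving the step repeatedly then
    compares them with the derivative. *)
Lemma second_order g c d r M : 0 < r -> 0 <= M ->
  (forall x, cabs (x - c) < r -> cdiff g x /\ cabs (g x) <= M) ->
  cderiv g c d ->
  forall h : C, cabs h <= r / 8 ->
  cabs (g (c + h) - g c - d * h) <= 64 * M / r ^+ 2 * cabs h ^+ 2.
Proof.
move=> r0 M0 H dg.
pose K := 128 * M / r ^+ 2.
have K0 : 0 <= K by rewrite divr_ge0 ?exprn_ge0 //; lra.
have lip (h z : C) : h != 0 -> cabs h <= r / 8 -> cabs (z - c) <= r / 8 ->
    cabs (slope g h z - slope g h c) <= K * cabs (z - c).
  move=> h0 hr zr.
  have := @schwarz_lipschitz (slope g h) c (r / 4) (8 * M / r) _ _ _ z _.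
  have -> : 4 * (8 * M / r) / (r / 4) = K by rewrite /K; field; rewrite gt_eqF.
  apply; [lra|by rewrite divr_ge0 // ?(ltW r0) //; lra| |by lra].
  move=> x xr; split.
    apply: cdiffM; last exact: cdiff_cst.
    have cf : cdiff (fun y => y + h) x by apply: cdiffD; [exact: cdiff_id|exact: cdiff_cst].
    apply: cdiffB; last by apply H; lra.
    apply: (cdiff_comp cf); apply H.
    by have := cabsD (x - c) h; rewrite (addrAC x (- c) h); lra.
  rewrite /slope cabsM cabsV ler_pdivrMr ?cabs_gt0 //.
  have := @schwarz_lipschitz g x (r / 2) M _ M0 _ (x + h) _.
  rewrite (addrC x) addrK.
  have -> : 4 * M / (r / 2) = 8 * M / r by field; rewrite gt_eqF.
  apply; [lra| |lra].
  move=> y yx; apply: H; have := cabsD (y - x) (x - c); rewrite addrA subrK; lra.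
have halve (h : C) : h != 0 -> cabs h <= r / 8 ->
    cabs (slope g h c - slope g (h / 2) c) <= K / 4 * cabs h.
  move=> h0 hr; have h20 : h / 2 != 0 by rewrite mulf_neq0 // invr_eq0 pnatr_eq0.
  have c2 : cabs (h / 2) = cabs h / 2.
    by rewrite cabsM cabsV cabs_nat.
  have -> : slope g h c - slope g (h / 2) c =
      (slope g (h / 2) (c + h / 2) - slope g (h / 2) c) / 2.
    have E : h = h / 2 + h / 2 by field.
    rewrite /slope {1}E addrA; field.
    by rewrite h0 /=.
  rewrite cabsM cabsV cabs_nat.
  have hge := cabs_ge0 h.
  have h1 : cabs (h / 2) <= r / 8 by rewrite c2; lra.
  have E2 : c + h / 2 - c = h / 2 by rewrite addrAC subrr add0r.
  have h2 : cabs (c + h / 2 - c) <= r / 8 by rewrite E2.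
  have := lip (h / 2) (c + h / 2) h20 h1 h2; rewrite E2 c2; lra.
have two n : cabs ((2 : C) ^+ n) = 2 ^+ n.
  by rewrite cabsX cabs_nat.
have c2 (h : C) n : cabs (h / 2 ^+ n) = cabs h * 2^-1 ^+ n.
  by rewrite cabsM cabsV two exprVn.
have half01 n : 0 <= (2^-1 : R) ^+ n <= 1.
  by rewrite exprn_ge0 //= exprn_ile1 // invf_le1 // ler1n.
have p2 n : (2 : C) ^+ n != 0 by rewrite expf_neq0 // pnatr_eq0.
have tele (h : C) n : h != 0 -> cabs h <= r / 8 ->
    cabs (slope g h c - slope g (h / 2 ^+ n) c) <= K / 2 * cabs h * (1 - 2^-1 ^+ n).
  move=> h0 hr; have hge := cabs_ge0 h.
  elim: n => [|n IH]; first by rewrite !expr0 divr1 subrr cabs0 subrr mulr0.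
  have /andP[q0 q1] := half01 n.
  have hn0 : h / 2 ^+ n != 0 by rewrite mulf_neq0 // invr_eq0.
  have hn : cabs (h / 2 ^+ n) <= r / 8.
    by rewrite c2; apply: le_trans hr; rewrite ler_piMr.
  have := halve _ hn0 hn; rewrite c2.
  have -> : h / 2 ^+ n / 2 = h / 2 ^+ n.+1.
    by rewrite exprSr invfM mulrA.
  move=> h1; have := cabsD (slope g h c - slope g (h / 2 ^+ n) c)
    (slope g (h / 2 ^+ n) c - slope g (h / 2 ^+ n.+1) c).
  have e : (2^-1 : R) ^+ n.+1 = 2^-1 ^+ n / 2 by rewrite exprSr.
  rewrite addrA subrK e; lra.
move=> h hr; have [->|h0] := eqVneq h 0.
  by rewrite addr0 subrr mulr0 subr0 cabs0 expr0n /= mulr0.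
have hge : 0 < cabs h by rewrite cabs_gt0.
have hd : cabs (slope g h c - d) <= K / 2 * cabs h.
  apply/ler_addgt0Pr => e e0.
  have /cderivP /(_ e e0) /nbhsC [s s0 sH] := dg.
  have [|N NH] := @geometric_small R 2^-1 (s / cabs h) _ (divr_gt0 s0 hge).
    by rewrite invr_ge0 ler0n /= invf_lt1 // ltr1n.
  rewrite ltr_pdivlMr // mulrC -c2 in NH.
  have hN0 : h / 2 ^+ N != 0 by rewrite mulf_neq0 // invr_eq0.
  have h1 := sH (c + h / 2 ^+ N).
  have Ec : c + h / 2 ^+ N - c = h / 2 ^+ N by rewrite addrAC subrr add0r.
  rewrite Ec in h1; have {}h1 := h1 NH.
  have h2 : cabs (slope g (h / 2 ^+ N) c - d) <= e.
    rewrite (_ : slope _ _ _ - d = (g (c + h / 2 ^+ N) - g c - d * (h / 2 ^+ N)) / (h / 2 ^+ N)).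
      by rewrite cabsM cabsV ler_pdivrMr ?cabs_gt0.
    by rewrite [RHS]mulrBl mulfK.
  have /andP[q0 q1] := half01 N.
  have h3 := tele h N h0 hr.
  have h4 : K / 2 * cabs h * (1 - 2^-1 ^+ N) <= K / 2 * cabs h.
    have K20 : 0 <= K / 2 * cabs h by apply: mulr_ge0; [lra|exact: ltW].
    by rewrite ler_piMr //; lra.
  have := cabsD (slope g h c - slope g (h / 2 ^+ N) c) (slope g (h / 2 ^+ N) c - d).
  rewrite addrA subrK; lra.
have -> : g (c + h) - g c - d * h = (slope g h c - d) * h.
  by rewrite /slope mulrBl divfK.
rewrite cabsM expr2 mulrA ler_wpM2r ?cabs_ge0 //.
by apply: le_trans hd _; rewrite le_eqVlt; apply/orP; left; apply/eqP; rewrite /K; field; rewrite gt_eqF.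
Qed.

End CauchyEstimates.

(** * Consequences of the Schwarz-Pick lemma *)

Section SchwarzCorollaries.
Variable R : realType.
Local Notation C := (Cplx R).
Implicit Types (f g h q : C -> C) (p x b k d : C) (M e : R).

Lemma punctured_ge0 (f : C -> R) b : {for b, continuous f} ->
  (\forall p \near b, p != b -> 0 <= f p) -> 0 <= f b.
Proof.
move=> cf H; rewrite leNgt; apply/negP => fb.
have fb0 : 0 < - f b by lra.
have near_fb : \forall p \near b, `|f p - f b| < - f b.
  have N : nbhs (f b) [set y | `|y - f b| < - f b].
    by apply/nbhs_ballP; exists (- f b) => //= y; rewrite /ball /= distrC.
  exact: (cf _ N).
have [r r0 rH] := proj1 (nbhsC _ _) (filterI near_fb H).
have E : b + RtoC (r / 2) - b = RtoC (r / 2) by rewrite addrAC subrr add0r.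
have cr : cabs (RtoC (r / 2)) = r / 2 by rewrite cabs_RtoC gtr0_norm //; lra.
have [|h1 h2] := rH (b + RtoC (r / 2)); first by rewrite E cr; lra.
have : 0 <= f (b + RtoC (r / 2)).
  apply: h2; rewrite -subr_eq0 E -cabs_gt0 cr; lra.
by move: h1; rewrite ltr_norml => /andP[]; lra.
Qed.

(** Infinitesimal form of the Schwarz-Pick inequality, as a limit of the
    two-point form at [b]. *)
Theorem schwarz_pick_deriv g b d M : 0 <= M -> cabs b < 1 ->
  (forall p, cabs p <= 1 -> \forall x \near p, cdiff g x) ->
  (forall p, cabs p <= 1 -> cabs (g p) <= M) ->
  cderiv g b d -> cabs d * (1 - cabs b ^+ 2) <= M.
Proof.
move=> M0 b1 dg gM gd; apply/ler_addgt0Pr => e e0.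
set M' := M + e; have M'0 : 0 < M' by rewrite /M'; lra.
pose G x := RtoC M'^-1 * g x.
have cM : cabs (RtoC M'^-1) = M'^-1 by rewrite cabs_RtoC gtr0_norm // invr_gt0.
have cG p : cabs (G p) = cabs (g p) / M' by rewrite /G cabsM cM mulrC.
have Gd : cderiv G b (RtoC M'^-1 * d).
  have := cderivM (cderiv_cst (RtoC M'^-1) b) gd.
  by rewrite mul0r add0r.
have k1 : cabs (G b) < 1.
  by rewrite cG ltr_pdivrMr // mul1r /M'; have := gM b (ltW b1); lra.
have SP : forall p, cabs p <= 1 ->
    cabs (G p - G b) * cabs (1 - cconj b * p) <= cabs (p - b) * cabs (1 - cconj (G b) * G p).
  move=> p p1; apply: (@schwarz_pick R G (fun=> 1) b (G b) (cabs (RtoC M'^-1 * d) + 1)) => //.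
  - by apply: filterS (cderiv_slope Gd) => x H _.
  - by move=> q _ /eqP; rewrite oner_eq0.
  - by move=> q _ _; exact: lholo_cst.
  - move=> q q1 _ _; apply: filterS (dg q q1) => x; apply: cdiffM; exact: cdiff_cst.
  - by move=> q q1 _; rewrite cG ler_pdivrMr // mul1r /M'; have := gM q q1; lra.
have [psi [cpsi psib psiE]] := Gd.
have cont_aff (a b' : C) (f : C -> C) : {for b, continuous f} ->
    {for b, continuous (fun p => a - b' * f p)}.
  move=> cf; apply/continuousCP => t t0.
  have d0 : 0 < t / (cabs b' + 1) by rewrite divr_gt0 //; have := cabs_ge0 b'; lra.
  have := proj1 (continuousCP _ _) cf _ d0; apply: filterS => x.
  rewrite ltr_pdivlMr; last by have := cabs_ge0 b'; lra.
  have -> : a - b' * f x - (a - b' * f b) = b' * (f b - f x) by ring.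
  rewrite cabsM (cabsBC (f b)); have := cabs_ge0 (f x - f b); lra.
pose F p := cabs (1 - cconj (G b) * G p) - cabs (psi p * (1 - cconj b * p)).
have cF : {for b, continuous F}.
  apply: continuousB.
    apply: continuous_comp; last exact: cabs_continuous.
    by apply: cont_aff; exact: cderiv_continuous Gd.
  apply: continuous_comp; last exact: cabs_continuous.
  have cid : {for b, continuous (fun p => 1 - cconj b * p)}.
    by apply: (cont_aff 1 (cconj b) id); exact: cvg_id.
  exact: continuousM cpsi cid.
have F0 : 0 <= F b.
  apply: punctured_ge0 cF _.
  have nb : \forall x \near b, cabs (x - 0) < 1.
    by apply: near_in_disc; rewrite subr0.
  apply: filterS2 psiE nb => p pE; rewrite subr0 => /ltW /SP.
  have -> : G p - G b = psi p * (p - b) by rewrite pE addrAC subrr add0r.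
  rewrite cabsM -mulrA mulrCA => H pb.
  by rewrite subr_ge0 cabsM -(@ler_pM2l _ (cabs (p - b))) // cabs_gt0 subr_eq0.
move: F0; rewrite /F psib cabsM !mul_conj subr_ge0 cabsM cM.
have R1 t : 1 - RtoC t = RtoC (1 - t) by rewrite rmorphB rmorph1.
rewrite !R1 !cabs_RtoC.
have bb : 0 <= 1 - cabs b ^+ 2.
  by rewrite subr_ge0 expr_le1 // ?cabs_ge0 // ltW.
have kk : 0 <= 1 - cabs (G b) ^+ 2.
  by rewrite subr_ge0 expr_le1 // ?cabs_ge0 // ltW.
rewrite !ger0_norm // => H.
have : M'^-1 * cabs d * (1 - cabs b ^+ 2) <= 1.
  by apply: le_trans H _; rewrite gerBl sqr_ge0.
by rewrite -mulrA mulrC ler_pdivrMr // mul1r.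
Qed.

(** Solves the pseudo-hyperbolic inequality for [x], using
    (1 - k x)^2 - (x - k)^2 = (1 - k^2)(1 - x^2). *)
Lemma pick_real (k x t : R) : 0 <= k -> k < 1 -> 0 <= x -> x <= 1 -> 0 <= t -> t <= 1 ->
  (1 - t ^+ 2) * (1 - k * x) ^+ 2 <= (1 - k ^+ 2) * (1 - x ^+ 2) ->
  x * (1 + k * t) <= k + t.
Proof.
move=> k0 k1 x0 x1 t0 t1 H.
have kx : 0 <= 1 - k * x by nra.
have H2 : (x - k) ^+ 2 <= (t * (1 - k * x)) ^+ 2.
  have E : (1 - k * x) ^+ 2 - (x - k) ^+ 2 = (1 - k ^+ 2) * (1 - x ^+ 2) by ring.
  rewrite exprMn; lra.
have : x - k <= t * (1 - k * x).
  have [h|h] := leP (x - k) 0; first by apply: le_trans h _; rewrite mulr_ge0.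
  by rewrite -(@ler_pXn2r _ 2) ?nnegrE ?mulr_ge0 // ltW.
lra.
Qed.

(** Schwarz-Pick at the origin for [q x / x], whose value at [0] is the
    derivative [k] of [q]. *)
Theorem schwarz_derivative_exceptional q h k (a : R) :
  (forall p, cabs p <= 1 -> h p = 0 -> forall e, 0 < e ->
     \forall x \near p, cabs x <= 1 -> cabs (h x) <= e) ->
  (forall p, cabs p <= 1 -> h p != 0 -> lholo h p) ->
  (forall p, cabs p <= 1 -> h p != 0 -> \forall x \near p, cdiff q x) ->
  (forall p, cabs p <= 1 -> h p != 0 -> cabs (q p) <= 1) ->
  h 0 != 0 -> q 0 = 0 -> cderiv q 0 k -> cabs k <= a -> a < 1 ->
  forall p, cabs p <= 1 -> h p != 0 ->
  cabs (q p) * (1 + a * cabs p) <= cabs p * (a + cabs p).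
Proof.
move=> h0 hl qd q1 h00 q00 qk ka a1 p p1 hp.
have k0 := cabs_ge0 k.
have p0 := cabs_ge0 p.
have z1 : cabs (0 : C) <= 1 by rewrite cabs0.
have zl1 : cabs (0 : C) < 1 by rewrite cabs0.
have S1 x : cabs x <= 1 -> h x != 0 -> cabs (q x) <= cabs x.
  move=> xD hx.
  have := @schwarz_pick R q h 0 0 (cabs k + 1) zl1 zl1 _ h0 hl _ q1 x xD hx.
  rewrite cconj0 !mul0r !subr0 cabs1 !mulr1; apply.
    by apply: filterS (cderiv_slope qk) => y; rewrite q00 !subr0.
  by move=> y yD hy _; exact: qd.
pose kap x := if x == 0 then k else q x / x.
have kE x : x != 0 -> kap x = q x / x by rewrite /kap => /negbTE ->.
have k1 : cabs k < 1 by lra.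
have kap1 x : cabs x <= 1 -> h x != 0 -> cabs (kap x) <= 1.
  move=> xD hx; rewrite /kap; case: eqVneq => [_|x0]; first by lra.
  by rewrite cabsM cabsV ler_pdivrMr ?mul1r ?S1 // cabs_gt0.
have [r r0 rH] : exists2 r : R, 0 < r & forall x, cabs (x - 0) < r -> cdiff q x /\ cabs (q x) <= 1.
  have hn0 : \forall x \near (0 : C), h x != 0.
    have := lholo_continuous (hl 0 z1 h00) => /continuousCP.
    move=> /(_ (cabs (h 0))); rewrite cabs_gt0 => /(_ h00).
    apply: filterS => x; apply: contraTneq => ->.
    by rewrite sub0r cabsN ltxx.
  have n1 : \forall x \near (0 : C), cabs (x - 0) < 1 by apply: near_cabs_lt.
  have [r r0 rH] := proj1 (nbhsC _ _) (filterI (filterI hn0 n1) (qd 0 z1 h00)).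
  exists r => // x /rH [[hx]]; rewrite subr0 => /ltW xD dx.
  by split=> //; exact: q1.
have so := second_order r0 ler01 rH qk.
have := @schwarz_pick R kap h 0 k (64 * 1 / r ^+ 2) zl1 k1 _ h0 hl _ kap1 p p1 hp.
rewrite cconj0 mul0r !subr0 cabs1 !mulr1 => SP.
have {}SP : cabs (kap p - k) <= cabs p * cabs (1 - cconj k * kap p).
  apply: SP.
    have r80 : 0 < r / 8 by lra.
    apply: filterS (near_cabs_lt 0 r80) => x; rewrite subr0 => /ltW xr _.
    have [->|x0] := eqVneq x 0.
      by rewrite /kap eqxx subrr cabs0 mulr0.
    rewrite kE // -(@ler_pM2r _ (cabs x)) ?cabs_gt0 // -cabsM mulrBl divfK //.
    by have := so x xr; rewrite add0r q00 !subr0 mulr1 expr2 mulrA.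
  move=> x xD hx x0.
  have xx : \forall y \near x, cabs (y - x) < cabs x.
    by apply: near_cabs_lt; rewrite cabs_gt0.
  have {}xx : \forall y \near x, y != 0.
    apply: filterS xx => y; apply: contraTneq => ->.
    by rewrite sub0r cabsN ltxx.
  apply: filterS2 (near_join xx) (qd x xD hx) => y yy dy.
  apply: (@cdiff_ext _ (fun z => q z / z)).
    by apply: filterS yy => z z0; rewrite kE.
  by apply: cdiffM => //; apply: cdiffV; [exact: cdiff_id|exact: nbhs_singleton yy].
set X := cabs (kap p).
have X1 : X <= 1 by exact: kap1.
have X0 : 0 <= X by exact: cabs_ge0.
have qX : cabs (q p) = X * cabs p.
  rewrite /X /kap; case: eqVneq => [->|pn0]; first by rewrite q00 cabs0 mulr0.
  by rewrite -cabsM divfK.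
have id := mobius_identity k (kap p); rewrite -/X in id.
have sq : cabs (kap p - k) ^+ 2 <= cabs p ^+ 2 * cabs (1 - cconj k * kap p) ^+ 2.
  by rewrite -exprMn; apply: lerXn2r; rewrite ?nnegrE ?mulr_ge0 ?cabs_ge0.
have low : 1 - cabs k * X <= cabs (1 - cconj k * kap p).
  have := cabsD (1 - cconj k * kap p) (cconj k * kap p); rewrite subrK cabs1.
  by rewrite cabsM cabs_conj -/X; lra.
have low2 : (1 - cabs k * X) ^+ 2 <= cabs (1 - cconj k * kap p) ^+ 2.
  by apply: lerXn2r; rewrite ?nnegrE ?cabs_ge0 //; nra.
have t2 : 0 <= 1 - cabs p ^+ 2 by rewrite subr_ge0 expr_le1.
have h1 := ler_wpM2l t2 low2.
have h2 : X * (1 + cabs k * cabs p) <= cabs k + cabs p by apply: pick_real => //; lra.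
rewrite qX.
have h3 : X * (1 + a * cabs p) <= a + cabs p.
  have kp : 0 <= cabs k * cabs p by rewrite mulr_ge0.
  rewrite -(@ler_pM2r _ (1 + cabs k * cabs p)); last by lra.
  have h4 : X * (1 + cabs k * cabs p) * (1 + a * cabs p) <= (cabs k + cabs p) * (1 + a * cabs p).
    by rewrite ler_wpM2r //; nra.
  have h5 : 0 <= (a - cabs k) * (1 - cabs p ^+ 2) by rewrite mulr_ge0 // subr_ge0.
  lra.
by rewrite mulrAC mulrC ler_wpM2l.
Qed.

End SchwarzCorollaries.

(** * Euclidean norm and compact balls *)

Section EuclideanNorm.
Variables (R : realType) (n : nat).
Local Notation C := (Cplx R).
Local Notation V := 'cV[C]_n.
Implicit Types (u v w x y z : V) (a : C).

Lemma enormE z : enorm z ^+ 2 = \sum_i cabs (z i 0) ^+ 2.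
Proof. by rewrite sqr_sqrtr // sumr_ge0 // => i _; exact: sqr_ge0. Qed.

Lemma enorm_ge0 z : 0 <= enorm z.
Proof. exact: sqrtr_ge0. Qed.

Lemma enorm_coord z i : cabs (z i 0) <= enorm z.
Proof.
rewrite -(@ler_pXn2r _ 2) ?nnegrE ?cabs_ge0 ?enorm_ge0 // enormE.
by rewrite (bigD1 i) //= lerDl sumr_ge0 // => j _; exact: sqr_ge0.
Qed.

Lemma enorm_eq0 z : enorm z = 0 -> z = 0.
Proof.
move=> z0; apply/matrixP => i j; rewrite !mxE (ord1 j).
by apply/eqP; rewrite -cabs_eq0 eq_le cabs_ge0 andbT -z0 enorm_coord.
Qed.

Lemma enormZ a z : enorm (a *: z) = cabs a * enorm z.
Proof.
apply/eqP; rewrite -(@eqrXn2 _ 2) ?enorm_ge0 ?mulr_ge0 ?cabs_ge0 ?enorm_ge0 //.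
rewrite exprMn !enormE mulr_sumr; apply/eqP; apply: eq_bigr => i _.
by rewrite mxE cabsM exprMn.
Qed.

Lemma enorm0 : enorm (0 : V) = 0.
Proof. by rewrite -(scale0r (0 : V)) enormZ cabs0 mul0r. Qed.

Lemma enorm_gt0 z : (0 < enorm z) = (z != 0).
Proof.
rewrite lt_neqAle enorm_ge0 andbT eq_sym; congr (~~ _).
by apply/eqP/eqP => [/enorm_eq0 //|->]; rewrite enorm0.
Qed.

Lemma enormN z : enorm (- z) = enorm z.
Proof. by rewrite -scaleN1r enormZ cabsN cabs1 mul1r. Qed.

Lemma enormBC x y : enorm (x - y) = enorm (y - x).
Proof. by rewrite -enormN opprB. Qed.

Definition dot w z : C := \sum_i cconj (w i 0) * z i 0.

Lemma dotD w x y : dot w (x + y) = dot w x + dot w y.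
Proof. by rewrite -big_split; apply: eq_bigr => i _; rewrite mxE mulrDr. Qed.

Lemma dotZ w a x : dot w (a *: x) = a * dot w x.
Proof. by rewrite mulr_sumr; apply: eq_bigr => i _; rewrite mxE mulrCA. Qed.

Lemma dotZl w a x : dot (a *: w) x = cconj a * dot w x.
Proof.
rewrite mulr_sumr; apply: eq_bigr => i _; rewrite mxE mulrA; congr (_ * _).
by rewrite /cconj; exact: (rmorphM (@conjc R)).
Qed.

Lemma dotB w x y : dot w (x - y) = dot w x - dot w y.
Proof. by rewrite dotD -scaleN1r dotZ mulN1r. Qed.

Lemma dot_self z : dot z z = RtoC (enorm z ^+ 2).
Proof. by rewrite enormE rmorph_sum; apply: eq_bigr => i _; rewrite mul_conj. Qed.

Lemma norming_vector z : exists2 w, enorm w <= 1 & dot w z = RtoC (enorm z).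
Proof.
have [->|z0] := eqVneq z 0.
  exists 0; rewrite enorm0 // rmorph0 /dot big1 // => i _.
  by rewrite mxE mulr0.
have zn : 0 < enorm z by rewrite enorm_gt0.
exists (RtoC (enorm z)^-1 *: z).
  by rewrite enormZ cabs_RtoC gtr0_norm ?invr_gt0 // mulVf // gt_eqF.
rewrite dotZl cconj_RtoC.
by rewrite dot_self -rmorphM expr2 mulrA mulVf ?mul1r // gt_eqF.
Qed.

Lemma cre_sum (I : finType) (f : I -> C) : cre (\sum_i f i) = \sum_i cre (f i).
Proof. by elim/big_ind2: _ => // a b c d <- <-; rewrite creD. Qed.

Lemma enorm_sqrD x y : enorm (x + y) ^+ 2 =
  enorm x ^+ 2 + enorm y ^+ 2 + 2 * cre (dot x y).
Proof.
rewrite !enormE cre_sum mulr_sumr -!big_split; apply: eq_bigr => i _ /=.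
rewrite mxE !cabs_sqr !creM !cre_conj !cim_conj !creD !cimD; ring.
Qed.

Lemma cauchy_schwarz w z : cabs (dot w z) <= enorm w * enorm z.
Proof.
have [->|w0] := eqVneq w 0.
  rewrite enorm0 mul0r /dot big1 ?cabs0 // => i _.
  by rewrite mxE cconj0 mul0r.
have W : 0 < enorm w by rewrite enorm_gt0.
have [u u1 uE] := rotation (dot w z).
have h : 0 <= enorm (u *: z + RtoC (- (cabs (dot w z) / enorm w ^+ 2)) *: w) ^+ 2.
  exact: sqr_ge0.
rewrite addrC enorm_sqrD !enormZ u1 mul1r cabs_RtoC exprMn real_normK ?num_real // in h.
have E : cre (dot (RtoC (- (cabs (dot w z) / enorm w ^+ 2)) *: w) (u *: z)) =
    - (cabs (dot w z) / enorm w ^+ 2) * cabs (dot w z).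
  rewrite dotZ dotZl cconj_RtoC.
  by rewrite mulrCA uE -rmorphM creR.
rewrite E in h.
rewrite -(@ler_pXn2r _ 2) ?nnegrE ?cabs_ge0 ?mulr_ge0 ?enorm_ge0 // exprMn.
have E2 : (- (cabs (dot w z) / enorm w ^+ 2)) ^+ 2 * enorm w ^+ 2 + enorm z ^+ 2 +
   2 * (- (cabs (dot w z) / enorm w ^+ 2) * cabs (dot w z)) =
   enorm z ^+ 2 - cabs (dot w z) ^+ 2 / enorm w ^+ 2.
  by field; rewrite gt_eqF.
by rewrite E2 subr_ge0 ler_pdivrMr ?exprn_gt0 // mulrC in h.
Qed.

Lemma enormD x y : enorm (x + y) <= enorm x + enorm y.
Proof.
rewrite -(@ler_pXn2r _ 2) ?nnegrE ?addr_ge0 ?enorm_ge0 //.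
rewrite enorm_sqrD sqrrD.
have := le_trans (ler_norm _) (le_trans (cre_le (dot x y)) (cauchy_schwarz x y)).
lra.
Qed.

Lemma enormB x y : enorm (x - y) <= enorm x + enorm y.
Proof. by rewrite -(enormN y); exact: enormD. Qed.

Lemma enorm_dist x y : `|enorm x - enorm y| <= enorm (x - y).
Proof.
rewrite ler_norml; apply/andP; split.
  have := enormD (y - x) x; rewrite subrK enormBC; lra.
have := enormD (x - y) y; rewrite subrK; lra.
Qed.

Lemma enorm_sum z : enorm z <= \sum_i cabs (z i 0).
Proof.
rewrite -(@ler_pXn2r _ 2) ?nnegrE ?enorm_ge0 ?sumr_ge0 // => [|i _]; last exact: cabs_ge0.
rewrite enormE.
suff H (s : seq 'I_n) : 0 <= \sum_(i <- s) cabs (z i 0) /\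
    \sum_(i <- s) cabs (z i 0) ^+ 2 <= (\sum_(i <- s) cabs (z i 0)) ^+ 2.
  by case: (H (index_enum 'I_n)).
elim: s => [|i s [IH0 IH]]; first by rewrite !big_nil expr0n.
rewrite !big_cons; have := cabs_ge0 (z i 0) => zi; split; first by rewrite addr_ge0.
rewrite sqrrD; have := mulr_ge0 zi IH0; rewrite mulr2n; lra.
Qed.

Lemma nbhsV z (P : set V) :
  nbhs z P <-> exists2 d : R, 0 < d & forall x, enorm (x - z) < d -> P x.
Proof.
split.
- move=> /nbhs_ballP [[e ei] /= ]; rewrite ltcE /= => /andP[/eqP -> e0] eP.
  exists e => // x xz; apply: eP; split; first by rewrite ltcE /= eqxx.
  move=> i j; rewrite -ball_normE /ball_ /= cabsE ltcE /= eqxx /=.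
  have := enorm_coord (z - x) i; rewrite enormBC in xz; rewrite (ord1 j) !mxE; lra.
- move=> [d d0 dP]; apply/nbhs_ballP; exists (RtoC (d / (n%:R + 1))).
    by rewrite /= ltcE /= eqxx divr_gt0 // ltr_wpDl.
  move=> x [_ xz]; apply: dP; rewrite enormBC.
  apply: le_lt_trans (enorm_sum _) _.
  apply: (@le_lt_trans _ _ (\sum_(i < n) (d / (n%:R + 1)))).
    apply: ler_sum => i _; have := xz i 0.
    by rewrite -ball_normE /ball_ /= cabsE ltcE /= eqxx /= !mxE => /ltW.
  rewrite sumr_const card_ord -[ltLHS]mulr_natr mulrAC ltr_pdivrMr ?ltr_wpDl //.
  by rewrite ltr_pM2l // ltrDl.
Qed.

(** The ball is closed in the affine image of a product of unit discs. *)
Lemma eball_compact (z0 : V) (r : R) : compact [set z | enorm (z - z0) <= r].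
Proof.
have [r0|r0] := ltP r 0.
  rewrite (_ : mkset _ = set0); first exact: compact0.
  rewrite -subset0 => z /= /le_lt_trans /(_ r0).
  by rewrite ltNge enorm_ge0.
pose f (v : 'rV[C]_n) : V := RtoC r *: v^T + z0.
have cf : continuous f.
  move=> v; have K (P : set V) : nbhs (f v) P -> nbhs v (f @^-1` P).
    move=> /nbhsV [d d0 dP].
    pose e := d / ((n%:R + 1) * (r + 1)).
    have e0 : 0 < e by rewrite divr_gt0 // mulr_gt0 // ?ltr_wpDl //; lra.
    apply/nbhs_ballP; exists (RtoC e); first by rewrite /= ltcE /= eqxx.
    move=> x [_ xv]; apply: dP; rewrite /f opprD addrACA subrr addr0 -scalerBr enormZ.
    rewrite cabs_RtoC ger0_norm //.
    have h : enorm (x^T - v^T) <= n%:R * e.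
      apply: le_trans (enorm_sum _) _.
      apply: (@le_trans _ _ (\sum_(i < n) e)).
        apply: ler_sum => i _; have := xv 0 i.
        by rewrite -ball_normE /ball_ /= cabsE ltcE /= eqxx /= !mxE cabsBC => /ltW.
      by rewrite sumr_const card_ord mulr_natl.
    apply: le_lt_trans (ler_wpM2l r0 h) _.
    have n0 : 0 <= n%:R :> R by rewrite ler0n.
    have -> : d = (n%:R + 1) * (r + 1) * e.
      by rewrite /e; field; apply/andP; split; lra.
    rewrite mulrA ltr_pM2r //; nra.
  exact: K.
have cK := @rV_compact C n (fun=> @cdisc R) (fun=> @cdisc_compact R).
refine (@subclosed_compact V _ (f @` [set v : 'rV[C]_n | forall i, @cdisc R (v ord0 i)]) _ _ _).
- have -> : [set z | enorm (z - z0) <= r] = (fun z => enorm (z - z0)) @^-1` [set t | t <= r] by [].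
  apply: closed_comp; last exact: closed_le.
  move=> x _; apply: real_continuousP => e e0; apply/nbhsV; exists e => // y yx.
  apply: le_lt_trans (enorm_dist _ _) _.
  by rewrite opprD addrACA subrr addr0.
- by apply: continuous_compact => //; exact: continuous_subspaceT.
- move=> z /= zr; have [r00|rn0] := eqVneq r 0.
    exists 0; first by move=> i; rewrite /cdisc /mkset mxE cabs0.
    rewrite /f trmx0 scaler0 add0r; apply/eqP; rewrite eq_sym -subr_eq0.
    by apply/eqP/enorm_eq0/eqP; rewrite eq_le enorm_ge0 -r00 zr.
  have rp : 0 < r by rewrite lt_neqAle eq_sym rn0.
  exists (RtoC r^-1 *: (z - z0)^T).
    move=> i; rewrite /cdisc /mkset mxE cabsM cabs_RtoC gtr0_norm ?invr_gt0 //.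
    rewrite mulrC ler_pdivrMr // mul1r mxE.
    exact: le_trans (enorm_coord _ _) zr.
  by rewrite /f linearZ /= trmxK scalerA -rmorphM mulfV // rmorph1 scale1r subrK.
Qed.

End EuclideanNorm.

(** * Differentials and complex curves *)

Section Differentials.
Variables (R : realType) (n : nat).
Local Notation C := (Cplx R).
Local Notation V := 'cV[C]_n.
Implicit Types (u v w x y z : V) (a t s : C) (e : R) (M N : 'M[C]_n)
  (F : V -> V) (c : C -> V).

Definition dmx F z M := forall e, 0 < e ->
  \forall x \near z, enorm (F x - F z - M *m (x - z)) <= e * enorm (x - z).

Definition pderiv c t w := forall e, 0 < e ->
  \forall s \near t, enorm (c s - c t - (s - t) *: w) <= e * cabs (s - t).

Definition pdiff c t := exists w, pderiv c t w.

Definition pcont c t := forall e, 0 < e -> \forall s \near t, enorm (c s - c t) < e.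

Definition entry_sum M : R := \sum_i \sum_j cabs (M i j).

Lemma entry_sum_ge0 M : 0 <= entry_sum M.
Proof. by apply: sumr_ge0 => i _; apply: sumr_ge0 => j _; exact: cabs_ge0. Qed.

Lemma cabs_sum (I : finType) (f : I -> C) : cabs (\sum_i f i) <= \sum_i cabs (f i).
Proof.
elim/big_ind2: _ => [|a r b s ar bs|//]; first by rewrite cabs0.
exact: le_trans (cabsD _ _) (lerD ar bs).
Qed.

Lemma enorm_mulmx M w : enorm (M *m w) <= entry_sum M * enorm w.
Proof.
apply: le_trans (enorm_sum _) _; rewrite mulr_suml; apply: ler_sum => i _.
rewrite mxE; apply: le_trans (cabs_sum _) _; rewrite mulr_suml.
by apply: ler_sum => j _; rewrite cabsM ler_wpM2l ?cabs_ge0 ?enorm_coord.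
Qed.

Lemma near_enorm_lt z e : 0 < e -> \forall x \near z, enorm (x - z) < e.
Proof. by move=> e0; apply/nbhsV; exists e. Qed.

Lemma dmx_lipschitz F z M : dmx F z M ->
  \forall x \near z, enorm (F x - F z) <= (entry_sum M + 1) * enorm (x - z).
Proof.
move=> /(_ 1 ltr01); apply: filterS => x H.
have := enormD (F x - F z - M *m (x - z)) (M *m (x - z)); rewrite subrK.
have := enorm_mulmx M (x - z); lra.
Qed.

Lemma dmx_continuous F z M : dmx F z M ->
  forall e, 0 < e -> \forall x \near z, enorm (F x - F z) < e.
Proof.
move=> /dmx_lipschitz H e e0; have M0 := entry_sum_ge0 M.
have d0 : 0 < e / (entry_sum M + 1) by rewrite divr_gt0 //; lra.
apply: filterS2 H (near_enorm_lt z d0) => x h1; rewrite ltr_pdivlMr; last lra.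
lra.
Qed.

Lemma pderiv_lipschitz c t w : pderiv c t w ->
  \forall s \near t, enorm (c s - c t) <= (enorm w + 1) * cabs (s - t).
Proof.
move=> /(_ 1 ltr01); apply: filterS => s H.
have := enormD (c s - c t - (s - t) *: w) ((s - t) *: w); rewrite subrK enormZ.
lra.
Qed.

Lemma pderiv_continuous c t w : pderiv c t w -> pcont c t.
Proof.
move=> /pderiv_lipschitz H e e0; have w0 := enorm_ge0 w.
have d0 : 0 < e / (enorm w + 1) by rewrite divr_gt0 //; lra.
apply: filterS2 H (near_cabs_lt t d0) => s h1; rewrite ltr_pdivlMr; last lra.
lra.
Qed.

Lemma pcont_near c t (P : set V) : pcont c t -> nbhs (c t) P -> \forall s \near t, P (c s).
Proof. by move=> H /nbhsV [d d0 dP]; apply: filterS (H d d0) => s; exact: dP. Qed.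

Lemma dmx_path F c t M w : dmx F (c t) M -> pderiv c t w ->
  pderiv (fun s => F (c s)) t (M *m w).
Proof.
move=> dF dc e e0; have M0 := entry_sum_ge0 M; have w0 := enorm_ge0 w.
pose e1 := e / (2 * (enorm w + 1)).
have e10 : 0 < e1 by rewrite /e1 divr_gt0 // mulr_gt0 //; lra.
pose e2 := e / (2 * (entry_sum M + 1)).
have e20 : 0 < e2 by rewrite /e2 divr_gt0 // mulr_gt0 //; lra.
have E1 : e1 * (enorm w + 1) = e / 2 by rewrite /e1; field; apply/negP => /eqP; lra.
have E2 : e2 * (entry_sum M + 1) = e / 2 by rewrite /e2; field; apply/negP => /eqP; lra.
have h1 := pcont_near (pderiv_continuous dc) (dF _ e10).
apply: filterS3 h1 (dc _ e20) (pderiv_lipschitz dc) => s H1 H2 H3.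
rewrite (_ : _ - _ - _ = (F (c s) - F (c t) - M *m (c s - c t)) +
   M *m (c s - c t - (s - t) *: w)); last first.
  by rewrite (mulmxBr M (c s - c t)) -scalemxAr addrA subrK.
apply: le_trans (enormD _ _) _.
have h2 := enorm_mulmx M (c s - c t - (s - t) *: w).
have h3 := ler_wpM2l M0 H2; have h4 := ler_wpM2l (ltW e10) H3.
have st := cabs_ge0 (s - t).
have h5 : e2 * (entry_sum M + 1) * cabs (s - t) = e / 2 * cabs (s - t) by rewrite E2.
have h6 : e1 * (enorm w + 1) * cabs (s - t) = e / 2 * cabs (s - t) by rewrite E1.
have h7 := mulr_ge0 (ltW e20) st.
lra.
Qed.

Lemma pderiv_linear (L : V -> C) (K : R) c t w :
  (forall x y, L (x - y) = L x - L y) -> (forall a x, L (a *: x) = a * L x) ->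
  (forall x, cabs (L x) <= K * enorm x) ->
  pderiv c t w -> cderiv (fun s => L (c s)) t (L w).
Proof.
move=> LB LZ LK dc; apply/cderivP => e e0.
have K0 : 0 < `|K| + 1 by have := normr_ge0 K; lra.
have d0 : 0 < e / (`|K| + 1) by rewrite divr_gt0.
apply: filterS (dc _ d0) => s H.
rewrite -LB mulrC -LZ -LB; apply: le_trans (LK _) _.
have h1 : K <= `|K| + 1 by have := ler_norm K; lra.
apply: le_trans (ler_wpM2r (enorm_ge0 _) h1) _.
by rewrite -ler_pdivlMl // mulrA [_^-1 * e]mulrC.
Qed.

Lemma pderiv_coord c t w i : pderiv c t w -> cderiv (fun s => c s i 0) t (w i 0).
Proof.
apply: (@pderiv_linear (fun x => x i 0) 1).
- by move=> x y; rewrite !mxE.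
- by move=> a x; rewrite mxE.
- by move=> x; rewrite mul1r enorm_coord.
Qed.

Lemma pderiv_dot u c t w : pderiv c t w -> cderiv (fun s => dot u (c s)) t (dot u w).
Proof.
apply: (@pderiv_linear (dot u) (enorm u)); [exact: dotB|exact: dotZ|exact: cauchy_schwarz].
Qed.

Lemma pderiv_line z v t : pderiv (fun s => z + s *: v) t v.
Proof.
move=> e e0; apply: nbhsW => s.
rewrite opprD addrACA subrr add0r -scalerBl subrr enorm0.
by rewrite mulr_ge0 ?cabs_ge0 // ltW.
Qed.

Lemma pderiv_addr c t w v : pderiv c t w -> pderiv (fun s => c s + v) t w.
Proof.
move=> H e e0; apply: filterS (H e e0) => s.
by rewrite opprD [c s + v + _]addrACA subrr addr0.
Qed.

(** A continuous lift [c] of a differentiable curve through [F] is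
    differentiable where the differential of [F] is invertible. *)
Lemma inverse_path F c (psi : C -> V) t M w :
  dmx F (c t) M -> M \in unitmx -> pderiv psi t w -> pcont c t ->
  (\forall s \near t, F (c s) = psi s) -> pderiv c t (invmx M *m w).
Proof.
move=> dF Mu dpsi cc Fc e e0; set N := invmx M; set v := N *m w.
have nu0 := entry_sum_ge0 N; have v0 := enorm_ge0 v.
pose eta := Num.min (1 / (2 * (entry_sum N + 1))) (e / ((entry_sum N + 1) * (2 * enorm v + 2))).
have eta0 : 0 < eta.
  by rewrite lt_min !divr_gt0 // ?mulr_gt0 //; lra.
have eta1 : entry_sum N * eta <= 1 / 2.
  have : eta <= 1 / (2 * (entry_sum N + 1)) by rewrite ge_min lexx.
  rewrite ler_pdivlMr; last by lra.
  nra.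
have eta2 : (entry_sum N * eta) * (2 * enorm v + 2) <= e.
  have : eta <= e / ((entry_sum N + 1) * (2 * enorm v + 2)) by rewrite ge_min lexx orbT.
  rewrite ler_pdivlMr; last by rewrite mulr_gt0; lra.
  nra.
have h1 := pcont_near cc (dF _ eta0).
have /= H4 := nbhs_singleton Fc.
apply: filterS3 h1 (dpsi _ eta0) Fc => s H1 H2 H3; rewrite H3 H4 in H1.
set x := c s - c t in H1 *; set err1 := psi s - psi t - M *m x in H1.
set err2 := psi s - psi t - (s - t) *: w in H2.
have xE : x - (s - t) *: v = N *m (err2 - err1).
  have -> : err2 - err1 = M *m x - (s - t) *: w.
    by rewrite /err1 /err2 opprB [LHS]addrC addrA subrK.
  rewrite mulmxBr mulmxA mulVmx // mul1mx.
  by rewrite -scalemxAr.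
have h2 : enorm (x - (s - t) *: v) <= entry_sum N * eta * (cabs (s - t) + enorm x).
  rewrite xE; apply: le_trans (enorm_mulmx _ _) _; rewrite -mulrA ler_wpM2l //.
  apply: le_trans (enormB _ _) _; lra.
have h3 := enormD (x - (s - t) *: v) ((s - t) *: v); rewrite subrK enormZ in h3.
have st := cabs_ge0 (s - t); have x0 := enorm_ge0 x.
have h4 : enorm x <= (2 * enorm v + 1) * cabs (s - t) by nra.
apply: le_trans h2 _.
apply: (@le_trans _ _ (entry_sum N * eta * ((2 * enorm v + 2) * cabs (s - t)))).
  by apply: ler_wpM2l; [rewrite mulr_ge0 // ltW|lra].
by rewrite mulrA ler_wpM2r.
Qed.

End Differentials.

(** * The Jacobian determinant *)

(** Used both for continuity and for approximability by holomorphic functions. *)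
Lemma det_closed (T : Type) (K : comRingType) (P : (T -> K) -> Prop) n (A : T -> 'M[K]_n) :
  (forall a, P (fun _ => a)) ->
  (forall f g, P f -> P g -> P (fun x => f x + g x)) ->
  (forall f g, P f -> P g -> P (fun x => f x * g x)) ->
  (forall i j, P (fun x => A x i j)) -> P (fun x => \det (A x)).
Proof.
move=> Pc PD PM PA; rewrite /determinant.
elim: (index_enum _) => [|s r IH]; first by under eq_fun do rewrite big_nil.
under eq_fun do rewrite big_cons; apply: (PD) => //; apply: (PM) => //.
elim: (index_enum _) => [|i r' IH']; first by under eq_fun do rewrite big_nil.
by under eq_fun do rewrite big_cons; apply: (PM).
Qed.

Lemma det_continuous (T : topologicalType) (K : numFieldType) n (A : T -> 'M[K]_n) (z : T) :
  (forall i j, {for z, continuous (fun x => A x i j)}) ->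
  {for z, continuous (fun x => \det (A x))}.
Proof.
apply: (@det_closed T K (fun f : T -> K => {for z, continuous f})).
- by move=> a; exact: cst_continuous.
- by move=> f g cf cg; exact: continuousD.
- by move=> f g cf cg; exact: continuousM.
Qed.

Section Jacobian.
Variables (R : realType) (n : nat).
Local Notation C := (Cplx R).
Local Notation V := 'cV[C]_n.
Implicit Types (u v w x y z : V) (a t s : C) (e : R) (c : C -> V).

Lemma eball_near z : eball z -> \forall x \near z, eball x.
Proof.
move=> zb; have d0 : 0 < 1 - enorm z by rewrite subr_gt0.
apply: filterS (near_enorm_lt z d0) => x h; rewrite /eball /=.
have := enormD (x - z) z; rewrite subrK; lra.
Qed.

Definition bvec (j : 'I_n) : V := delta_mx j 0.

Lemma enorm_delta (j : 'I_n) : enorm (bvec j) = 1.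
Proof.
apply/eqP; rewrite -(@eqrXn2 _ 2) ?enorm_ge0 ?ler01 // enormE (bigD1 j) //=.
rewrite big1 => [|i ij]; last by rewrite /bvec mxE (negbTE ij) cabs0 expr0n.
by rewrite /bvec mxE !eqxx cabs1 addr0.
Qed.

Variables (F : V -> V) (DF : V -> 'M[C]_n).
Hypothesis HF : forall z, eball z -> dmx F z (DF z).

Definition partial_slope (a : C) i j z : C :=
  (F (z + a *: bvec j) i 0 - F z i 0) / a.

(** Partial derivatives are locally uniform limits of difference quotients, by
    the second order estimate on complex lines.  This is what makes them
    continuous, and approximable by holomorphic functions along curves. *)
Lemma partial_approx z0 : eball z0 -> exists rho K : R, [/\ 0 < rho, 0 <= K &
  forall z, enorm (z - z0) < rho -> eball z /\
  forall a i j, a != 0 -> cabs a < rho ->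
    eball (z + a *: bvec j) /\
    cabs (partial_slope a i j z - DF z i j) <= K * cabs a].
Proof.
move=> z0b.
have [r r0 rH] := proj1 (nbhsV _ _)
  (filterI (eball_near z0b) (dmx_continuous (HF z0b) ltr01)).
have rH1 x : enorm (x - z0) < r -> eball x by move=> /rH [].
have rH2 x : enorm (x - z0) < r -> enorm (F x - F z0) < 1 by move=> /rH [].
pose B := enorm (F z0) + 1; have B0 : 0 <= B by have := enorm_ge0 (F z0); rewrite /B; lra.
have r20 : 0 < r / 2 by lra.
exists (r / 16), (64 * B / (r / 2) ^+ 2); split; first lra.
  by rewrite divr_ge0 ?exprn_ge0 //; lra.
move=> z zr; split; first by apply: rH1; lra.
move=> a i j a0 ar.
have inb s : cabs (s - 0) < r / 2 -> enorm (z + s *: bvec j - z0) < r.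
  rewrite subr0 => sr; rewrite addrAC; apply: le_lt_trans (enormD _ _) _.
  rewrite enormZ enorm_delta; lra.
split; first by apply: rH1; apply: inb; rewrite subr0; lra.
pose g (s : C) : C := F (z + s *: bvec j) i 0.
have gd s : cabs (s - 0) < r / 2 ->
    cderiv g s ((DF (z + s *: bvec j) *m bvec j) i 0).
  move=> sr; have dF : dmx F (z + s *: bvec j) (DF (z + s *: bvec j)).
    by apply: HF; apply: rH1; exact: inb.
  have P := @dmx_path _ _ F (fun s => z + s *: bvec j) s _ _ dF (pderiv_line z _ s).
  exact: (@pderiv_coord _ _ _ _ _ i P).
have gd0 : cderiv g 0 (DF z i j).
  have -> : DF z i j = (DF (z + 0 *: bvec j) *m bvec j) i 0.
    by rewrite scale0r addr0 /bvec -colE mxE.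
  by apply: gd; rewrite subrr cabs0.
have gb s : cabs (s - 0) < r / 2 -> cdiff g s /\ cabs (g s) <= B.
  move=> sr; split; first by eexists; exact: gd.
  have h := rH2 _ (inb s sr).
  apply: le_trans (enorm_coord _ _) _.
  have := enormD (F (z + s *: bvec j) - F z0) (F z0); rewrite subrK /B; lra.
have ar8 : cabs a <= r / 2 / 8 by lra.
have := second_order r20 B0 gb gd0 ar8; rewrite add0r => SO.
rewrite -(@ler_pM2r _ (cabs a)) ?cabs_gt0 // -cabsM mulrBl /partial_slope divfK //.
by move: SO; rewrite /g scale0r addr0 (expr2 (cabs a)) mulrA.
Qed.

Lemma DF_continuous z0 i j : eball z0 -> {for z0, continuous (fun z => DF z i j)}.
Proof.
move=> z0b; apply/continuousCP => e e0.
have [rho [K [rho0 K0 H]]] := partial_approx z0b.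
pose d := Num.min (rho / 2) (e / (8 * (K + 1))).
have d0 : 0 < d by rewrite lt_min !divr_gt0 // mulr_gt0 //; lra.
have d1 : d < rho by apply: (@le_lt_trans _ _ (rho / 2)); [rewrite ge_min lexx|lra].
have d2 : K * d <= e / 8.
  have : d <= e / (8 * (K + 1)) by rewrite ge_min lexx orbT.
  rewrite ler_pdivlMr; last lra.
  nra.
pose a : C := RtoC d.
have ca : cabs a = d by rewrite cabs_RtoC gtr0_norm.
have a0 : a != 0 by rewrite -cabs_gt0 ca.
have z0r : enorm (z0 - z0) < rho by rewrite subrr enorm0.
have [_ /(_ a i j a0)] := H z0 z0r; rewrite ca => /(_ d1) [z0a h0].
have ed0 : 0 < e * d / 8 by rewrite divr_gt0 // mulr_gt0.
have h1 := dmx_continuous (HF z0b) ed0.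
have h2 : \forall z \near z0, enorm (F (z + a *: bvec j) - F (z0 + a *: bvec j)) < e * d / 8.
  have [r r0 rH] := proj1 (nbhsV _ _) (dmx_continuous (HF z0a) ed0).
  apply: filterS (near_enorm_lt z0 r0) => z zr; apply: rH.
  by rewrite opprD addrACA subrr addr0.
apply: filterS3 h1 h2 (near_enorm_lt z0 rho0) => z H1 H2 zr.
have [_ /(_ a i j a0)] := H z zr; rewrite ca => /(_ d1) [_ hz].
have h3 : cabs (partial_slope a i j z - partial_slope a i j z0) <= e / 4.
  rewrite /partial_slope -mulrBl cabsM cabsV ca ler_pdivrMr //.
  have -> : F (z + a *: bvec j) i 0 - F z i 0 -
     (F (z0 + a *: bvec j) i 0 - F z0 i 0) =
     (F (z + a *: bvec j) - F (z0 + a *: bvec j)) i 0 - (F z - F z0) i 0.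
    by rewrite !mxE; ring.
  apply: le_trans (cabsB _ _) _.
  have := enorm_coord (F (z + a *: bvec j) - F (z0 + a *: bvec j)) i.
  have := enorm_coord (F z - F z0) i; lra.
have -> : DF z i j - DF z0 i j = (partial_slope a i j z - partial_slope a i j z0) -
  (partial_slope a i j z - DF z i j) + (partial_slope a i j z0 - DF z0 i j) by ring.
apply: le_lt_trans (cabsD _ _) _.
have := cabsB (partial_slope a i j z - partial_slope a i j z0) (partial_slope a i j z - DF z i j).
lra.
Qed.

Lemma DF_path_lholo c t i j : eball (c t) -> (\forall s \near t, pdiff c s) ->
  lholo (fun s => DF (c s) i j) t.
Proof.
move=> ctb dc; have [rho [K [rho0 K0 H]]] := partial_approx ctb.
have [w cw] := nbhs_singleton dc.
have cc := pderiv_continuous cw.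
have := proj1 (continuousCP _ _) (@DF_continuous (c t) i j ctb) 1 ltr01.
move=> /(pcont_near cc) h1.
have h2 := cc rho rho0.
exists [set s | pdiff c s /\ enorm (c s - c t) < rho /\
    cabs (DF (c s) i j - DF (c t) i j) < 1].
  by apply: filterI => //; exact: filterI.
split=> [|e e0].
  exists (cabs (DF (c t) i j) + 1) => s [_ [_ h]].
  have := cabsD (DF (c s) i j - DF (c t) i j) (DF (c t) i j); rewrite subrK; lra.
pose d := Num.min (rho / 2) (e / (K + 1)).
have d0 : 0 < d by rewrite lt_min !divr_gt0 //; lra.
have d1 : d < rho by apply: (@le_lt_trans _ _ (rho / 2)); [rewrite ge_min lexx|lra].
have d2 : K * d <= e.
  have : d <= e / (K + 1) by rewrite ge_min lexx orbT.
  rewrite ler_pdivlMr; last lra.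
  nra.
pose a : C := RtoC d.
have ca : cabs a = d by rewrite cabs_RtoC gtr0_norm.
have a0 : a != 0 by rewrite -cabs_gt0 ca.
exists (fun s => partial_slope a i j (c s)) => s [[v sv] [sr _]].
have [csb /(_ a i j a0)] := H _ sr; rewrite ca => /(_ d1) [csa h].
split; last by rewrite cabsBC; exact: le_trans h d2.
apply: cdiffM; last exact: cdiff_cst.
apply: cdiffB.
  have := @dmx_path _ _ F (fun s => c s + a *: bvec j) s _ _ (HF csa) (pderiv_addr _ sv).
  by move=> /(@pderiv_coord _ _ _ _ _ i); eexists; eassumption.
have := dmx_path (HF csb) sv.
by move=> /(@pderiv_coord _ _ _ _ _ i); eexists; eassumption.
Qed.

Definition jac z : C := \det (DF z).

Lemma jac_continuous z : eball z -> {for z, continuous jac}.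
Proof. by move=> zb; apply: det_continuous => i j; exact: DF_continuous. Qed.

Lemma jac_path_lholo c t : eball (c t) -> (\forall s \near t, pdiff c s) ->
  lholo (fun s => jac (c s)) t.
Proof.
move=> ctb dc; apply: (@det_closed C C (fun f : C -> C => lholo f t)).
- by move=> a; exact: lholo_cst.
- by move=> f g; exact: lholoD.
- by move=> f g; exact: lholoM.
- by move=> i j; exact: DF_path_lholo.
Qed.

Lemma jac_near z e : eball z -> 0 < e -> \forall x \near z, cabs (jac x - jac z) < e.
Proof. by move=> zb e0; exact: (proj1 (continuousCP _ _) (jac_continuous zb) e e0). Qed.

End Jacobian.

(** * Local inversion of injective holomorphic maps *)

(** A weak form of Rado's theorem.  Near [b] every point is exceptional, so the
    constant [1] passes there for a function with value [k = 0] at [b]; at a point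
    with [h p != 0] it would violate the Schwarz-Pick inequality. *)
Lemma rado (R : realType) (h : Cplx R -> Cplx R) (b : Cplx R) : cabs b < 1 ->
  (\forall x \near b, h x = 0) ->
  (forall p, cabs p <= 1 -> h p = 0 -> forall e : R, 0 < e ->
     \forall x \near p, cabs x <= 1 -> cabs (h x) <= e) ->
  (forall p, cabs p <= 1 -> h p != 0 -> lholo h p) ->
  forall p, cabs p < 1 -> h p = 0.
Proof.
move=> b1 hb h0 hl p p1; apply/eqP; apply: contraT => hp.
have z1 : cabs (0 : Cplx R) < 1 by rewrite cabs0.
have c1 : cabs (1 : Cplx R) <= 1 by rewrite cabs1.
have := @schwarz_pick R (fun=> 1) h b 0 0 b1 z1 _ h0 hl _ (fun _ _ _ => c1) p (ltW p1) hp.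
rewrite cconj0 !mul0r !subr0 cabs1 mul1r mulr1 => H.
have {}H : cabs (1 - cconj b * p) <= cabs (p - b).
  apply: H; first by apply: filterS hb => x ->; rewrite eqxx.
  by move=> q _ _ _; apply: nbhsW => x; exact: cdiff_cst.
have h2 : cabs (1 - cconj b * p) ^+ 2 <= cabs (p - b) ^+ 2.
  by apply: lerXn2r; rewrite ?nnegrE ?cabs_ge0.
have := mobius_identity b p.
have : 0 < (1 - cabs b ^+ 2) * (1 - cabs p ^+ 2).
  by rewrite mulr_gt0 // subr_gt0 exprn_ilt1 ?cabs_ge0.
lra.
Qed.

Section Openness.
Variables (R : realType) (n : nat).
Local Notation C := (Cplx R).
Local Notation V := 'cV[C]_n.
Implicit Types (u v w x y z : V) (a t s : C) (e : R) (c : C -> V).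

Definition cball z0 (r : R) : set V := [set z | enorm (z - z0) <= r].

Lemma cball_compact z0 r : compact (cball z0 r).
Proof. exact: eball_compact. Qed.

Lemma cball_center z0 r : 0 <= r -> cball z0 r z0.
Proof. by move=> r0; rewrite /cball /mkset subrr enorm0. Qed.

Lemma cball_eball z0 r : r < 1 - enorm z0 -> cball z0 r `<=` @eball R n.
Proof.
move=> r1 z; rewrite /cball /eball /mkset => h.
have := enormD (z - z0) z0; rewrite subrK; lra.
Qed.

Lemma compact_min (f : V -> R) (K : set V) : compact K -> K !=set0 ->
  (forall z, K z -> {for z, continuous f}) ->
  exists2 z, K z & forall x, K x -> f z <= f x.
Proof.
move=> cK K0 cf; have [|z zK zmin] := compact_EVT_min K0 cK (f := f).
  by apply: continuous_in_subspaceT => z; rewrite inE; exact: cf.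
exists z; first by rewrite inE in zK.
by move=> x xK; apply: zmin; rewrite inE.
Qed.

Variables (F : V -> V) (DF : V -> 'M[C]_n).
Hypothesis HF : forall z, eball z -> dmx F z (DF z).
Hypothesis Finj : forall x y, eball x -> eball y -> F x = F y -> x = y.
Hypothesis J0 : jac DF 0 != 0.
Local Notation J := (jac DF).

Lemma eball0 : eball (0 : V).
Proof. by rewrite /eball /mkset enorm0. Qed.

Lemma F_dist_continuous w z : eball z -> {for z, continuous (fun x => enorm (F x - w))}.
Proof.
move=> zb; apply: real_continuousP => e e0.
apply: filterS (dmx_continuous (HF zb) e0) => x h.
apply: le_lt_trans (enorm_dist _ _) _.
by rewrite opprB addrA subrK.
Qed.

(** The Jacobian determinant does not vanish at the origin, so by [rado] on the
    line through the origin it vanishes on no open set. *)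
Lemma jac_dense z0 e : eball z0 -> 0 < e ->
  exists z, [/\ eball z, enorm (z - z0) < e & J z != 0].
Proof.
move=> z0b e0; apply: contrapT => H.
have Hz z : eball z -> enorm (z - z0) < e -> J z = 0.
  by move=> zb ze; apply/eqP; apply: contraT => Jz; exfalso; apply: H; exists z.
have z00 : z0 != 0.
  apply/eqP => E; move: J0; rewrite -E Hz ?eqxx // subrr enorm0 //.
set r := enorm z0; have r0 : 0 < r by rewrite enorm_gt0.
have r1 : r < 1 by [].
pose rho := (1 + r) / 2; have rho1 : rho < 1 by rewrite /rho; lra.
have rrho : r < rho by rewrite /rho; lra.
have rho0 : 0 < rho by lra.
pose c s : V := 0 + s *: (RtoC (rho / r) *: z0).
have cn s : enorm (c s) = cabs s * rho.
  have rr : 0 < rho / r by rewrite divr_gt0.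
  by rewrite /c add0r !enormZ cabs_RtoC gtr0_norm // -/r divfK ?gt_eqF.
have cb : forall s, cabs s <= 1 -> eball (c s).
  by move=> s s1; rewrite /eball /mkset cn; have := cabs_ge0 s; nra.
have cc s : pcont c s := pderiv_continuous (pderiv_line 0 _ s).
have Jc e' s : cabs s <= 1 -> 0 < e' -> \forall x \near s, cabs (J (c x) - J (c s)) < e'.
  move=> s1 e'0; exact: (pcont_near (cc s) (jac_near HF (cb s s1) e'0)).
pose b : C := RtoC (r / rho).
have cb' : c b = z0.
  rewrite /c /b add0r scalerA -rmorphM mulrA divfK ?gt_eqF // divff ?gt_eqF //.
  by rewrite rmorph1 scale1r.
have b1 : cabs b < 1.
  have rr : 0 < r / rho by rewrite divr_gt0.
  by rewrite cabs_RtoC gtr0_norm // ltr_pdivrMr // mul1r.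
have := @rado R (fun s => J (c s)) b b1 _ _ _ 0.
rewrite cabs0 ltr01 /c scale0r addr0 => /(_ _ _ _ isT) H0.
move: J0; rewrite H0 ?eqxx //.
- have h1 := cc b; rewrite /pcont cb' in h1.
  have h2 := pcont_near (cc b); rewrite cb' in h2.
  by apply: filterS2 (h1 e e0) (h2 _ (eball_near z0b)) => s ? ?; apply: Hz.
- move=> p p1 hp e' e'0; apply: filterS (Jc e' p p1 e'0) => x h _.
  by move: h; rewrite /c hp subr0 => /ltW.
- move=> p p1 _; apply: (jac_path_lholo HF (c := c)); first exact: cb.
  by apply: nbhsW => s; eexists; exact: pderiv_line.
Qed.

(** A continuous injection of a compact set has a continuous inverse. *)
Lemma injective_modulus (K : set V) z1 e : compact K -> K `<=` @eball R n ->
  K z1 -> 0 < e -> exists2 d : R, 0 < d &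
  forall z, K z -> enorm (F z - F z1) < d -> enorm (z - z1) < e.
Proof.
move=> cK Kb Kz1 e0.
pose A := K `&` [set z | e <= enorm (z - z1)].
have cA : compact A.
  apply: compact_closedI => //.
  have -> : [set z | e <= enorm (z - z1)] = (fun z => enorm (z - z1)) @^-1` [set t | e <= t] by [].
  apply: closed_comp; last exact: closed_ge.
  move=> x _; apply: real_continuousP => d d0; apply: filterS (near_enorm_lt x d0) => y yx.
  by apply: le_lt_trans (enorm_dist _ _) _; rewrite opprD addrACA subrr addr0.
have [A0|/set0P/negP/negPn/eqP A0] := pselect (A !=set0); last first.
  exists 1 => // z Kz _; rewrite ltNge; apply/negP => h.
  by have : A z by []; rewrite A0.
have [|z [Kz ez] zmin] := compact_min (f := fun x => enorm (F x - F z1)) cA A0.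
  by move=> z [/Kb zb _]; exact: F_dist_continuous.
exists (enorm (F z - F z1)).
  rewrite enorm_gt0 subr_eq0; apply/eqP => /(Finj (Kb _ Kz) (Kb _ Kz1)) E.
  by move: ez; rewrite /= E subrr enorm0 leNgt e0.
move=> x Kx; rewrite !ltNge; apply: contra => h; exact: zmin.
Qed.

(** Where the differential is invertible the point of a small ball whose image
    is nearest to [w] is mapped to [w]. *)
Lemma locally_onto z1 e : eball z1 -> J z1 != 0 -> 0 < e -> exists2 d : R, 0 < d &
  forall w, enorm (w - F z1) < d -> exists z, [/\ enorm (z - z1) < e, eball z & F z = w].
Proof.
move=> z1b Jz1 e0.
have Jz1' : 0 < cabs (J z1) by rewrite cabs_gt0.
have [r r0 rH] := proj1 (nbhsV _ _) (filterI (eball_near z1b) (jac_near HF z1b Jz1')).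
pose e1 := Num.min (e / 2) (r / 2).
have e10 : 0 < e1 by rewrite lt_min; apply/andP; split; lra.
have e1e : e1 < e by apply: (@le_lt_trans _ _ (e / 2)); [rewrite ge_min lexx|lra].
have e1r : e1 < r by apply: (@le_lt_trans _ _ (r / 2)); [rewrite ge_min lexx orbT|lra].
have Kb : cball z1 e1 `<=` @eball R n.
  by move=> z; rewrite /cball /mkset => h; have [] := rH z (le_lt_trans h e1r).
have Kj z : cball z1 e1 z -> J z != 0.
  rewrite /cball /mkset => h; have [_ /= h2] := rH z (le_lt_trans h e1r).
  by apply: contraTneq h2 => ->; rewrite sub0r cabsN ltxx.
have Kz1 : cball z1 e1 z1 by apply: cball_center; exact: ltW.
have cK := @cball_compact z1 e1.
have [d d0 dH] := injective_modulus cK Kb Kz1 e10.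
exists (d / 2) => [|w wd]; first by lra.
have [||z zK zmin] := compact_min (f := fun x => enorm (F x - w)) cK.
- by exists z1.
- by move=> x /Kb xb; exact: F_dist_continuous.
have zd : enorm (F z - F z1) < d.
  have h1 := zmin z1 Kz1; rewrite enormBC in wd.
  have := enormD (F z - w) (w - F z1); rewrite addrA subrK [enorm (w - _)]enormBC; lra.
have zb := Kb _ zK.
have ze1 := dH z zK zd.
exists z; split=> //; first by exact: lt_trans ze1 e1e.
apply/eqP; apply: contraT => Fzw.
pose y := w - F z.
have y0 : 0 < enorm y by rewrite enorm_gt0 subr_eq0 eq_sym.
have Mu : DF z \in unitmx by rewrite unitmxE unitfE; exact: Kj.
pose v := invmx (DF z) *m y; have v0 := enorm_ge0 v.
have Mv : DF z *m v = y by rewrite mulmxA mulmxV // mul1mx.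
pose eta := enorm y / (2 * (enorm v + 1)).
have eta0 : 0 < eta by rewrite divr_gt0 // mulr_gt0 //; lra.
have etav : eta * enorm v <= enorm y / 2.
  have : eta * (enorm v + 1) = enorm y / 2.
    by rewrite /eta; field; apply/negP => /eqP; lra.
  nra.
have [q q0 qH] := proj1 (nbhsV _ _) (HF zb eta0).
pose m := Num.min (q / 2) (e1 - enorm (z - z1)).
have m0 : 0 < m by rewrite lt_min; apply/andP; split; lra.
pose tau := Num.min 1 (m / (enorm v + 1)).
have tau0 : 0 < tau by rewrite lt_min ltr01 divr_gt0 //; lra.
have tau1 : tau <= 1 by rewrite ge_min lexx.
have tauv : tau * enorm v <= m.
  have : tau <= m / (enorm v + 1) by rewrite ge_min lexx orbT.
  rewrite ler_pdivlMr; last lra.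
  nra.
have mq : m < q by apply: (@le_lt_trans _ _ (q / 2)); [rewrite ge_min lexx|lra].
have me : m <= e1 - enorm (z - z1) by rewrite ge_min lexx orbT.
pose x := z + RtoC tau *: v.
have xz : x - z = RtoC tau *: v by rewrite /x addrAC subrr add0r.
have xzn : enorm (x - z) = tau * enorm v.
  by rewrite xz enormZ cabs_RtoC gtr0_norm.
have xK : cball z1 e1 x.
  rewrite /cball /mkset; have := enormD (x - z) (z - z1); rewrite addrA subrK xzn; lra.
have h1 := qH x; rewrite xzn xz -scalemxAr Mv in h1.
have {}h1 := h1 (le_lt_trans tauv mq).
have h2 := zmin x xK.
have E : F x - w = (F x - F z - RtoC tau *: y) + (RtoC (tau - 1) *: y).
  rewrite rmorphB rmorph1 scalerBl scale1r addrA subrK /y.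
  by rewrite opprB addrA subrK.
have h3 : enorm (F x - w) <= eta * (tau * enorm v) + (1 - tau) * enorm y.
  rewrite E; apply: le_trans (enormD _ _) _.
  have -> : (1 - tau) * enorm y = enorm (RtoC (tau - 1) *: y).
    by rewrite enormZ cabs_RtoC distrC ger0_norm // subr_ge0.
  by rewrite lerD2r.
rewrite enormBC -/y in h2.
have h4 : tau * (eta * enorm v) <= tau * (enorm y / 2) by rewrite ler_wpM2l // ltW.
have h5 := mulr_gt0 tau0 y0.
lra.
Qed.

(** The lift of a holomorphic curve through [F] is holomorphic off the zeros of
    the Jacobian determinant.  With the exceptional-set Schwarz-Pick lemma this
    replaces the theorem that an injective holomorphic map has a nonvanishing
    Jacobian determinant. *)
Lemma path_lift (psi c : C -> V) t : eball (c t) -> J (c t) != 0 ->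
  (\forall s \near t, [/\ F (c s) = psi s, pdiff psi s & pcont c s]) ->
  (\forall s \near t, pdiff c s) /\ lholo (fun s => J (c s)) t.
Proof.
move=> ctb Jct H.
suff dc : \forall s \near t, pdiff c s by split=> //; exact: (jac_path_lholo HF ctb dc).
have [_ _ cc] := nbhs_singleton H.
have Jct' : 0 < cabs (J (c t)) by rewrite cabs_gt0.
have h1 := pcont_near cc (eball_near ctb).
have h2 := pcont_near cc (jac_near HF ctb Jct').
apply: filterS3 (near_join H) h1 h2 => s Hs sb sj.
have [_ [w dpsi] cs] := nbhs_singleton Hs.
exists (invmx (DF (c s)) *m w).
apply: (inverse_path (HF sb) _ dpsi cs); last by apply: filterS Hs => q [].
rewrite unitmxE unitfE; apply: contraTneq sj => E; rewrite /J E.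
by rewrite sub0r cabsN ltxx.
Qed.

End Openness.

(** * Injective holomorphic maps are open *)

Lemma lholo_ext (R : realType) (F G : Cplx R -> Cplx R) (p : Cplx R) :
  (\forall x \near p, F x = G x) -> lholo F p -> lholo G p.
Proof.
move=> FG [U Up [[B UB] UH]].
exists (U `&` [set x | F x = G x]); first exact: filterI.
split; first by exists B => x [/UB h E]; rewrite -E.
move=> e e0; have [H HH] := UH e e0; exists H => x [Ux E].
by rewrite -E; exact: HH.
Qed.

Section OpenMapping.
Variables (R : realType) (n : nat).
Local Notation C := (Cplx R).
Local Notation V := 'cV[C]_n.
Implicit Types (u v w x y z : V) (a t s : C) (e : R) (c : C -> V).
Variables (F : V -> V) (DF : V -> 'M[C]_n).
Hypothesis HF : forall z, eball z -> dmx F z (DF z).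
Hypothesis Finj : forall x y, eball x -> eball y -> F x = F y -> x = y.
Hypothesis J0 : jac DF 0 != 0.
Local Notation J := (jac DF).

(** If points [w2] near [F z0] were missed, the function equal to the Jacobian
    determinant of [F] at the preimage, and to [0] outside the image of a small
    closed ball, would contradict Rado's theorem on a complex line through
    [w2]. *)
Theorem open_mapping z0 e : eball z0 -> 0 < e -> exists2 d : R, 0 < d &
  forall w, enorm (w - F z0) < d -> exists z, [/\ enorm (z - z0) < e, eball z & F z = w].
Proof.
move=> z0b e0.
have z01 : 0 < 1 - enorm z0 by rewrite subr_gt0.
pose e1 := Num.min (e / 2) ((1 - enorm z0) / 2).
have e10 : 0 < e1 by rewrite lt_min; apply/andP; split; lra.
have e1e : e1 < e by apply: (@le_lt_trans _ _ (e / 2)); [rewrite ge_min lexx|lra].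
have e1r : e1 < 1 - enorm z0.
  by apply: (@le_lt_trans _ _ ((1 - enorm z0) / 2)); [rewrite ge_min lexx orbT|lra].
pose K := cball z0 e1; have Kb : K `<=` @eball R n by exact: cball_eball.
have cK : compact K by exact: cball_compact.
have Kz0 : K z0 by apply: cball_center; exact: ltW.
have [d0 d00 d0H] := injective_modulus HF Finj cK Kb Kz0 e10.
exists (d0 / 8) => [|w2 w2d]; first lra.
apply: contrapT => now2.
have noK z : K z -> F z != w2.
  move=> Kz; apply/eqP => E; apply: now2; exists z; split=> //; last exact: Kb.
  by apply: lt_trans e1e; apply: d0H => //; rewrite E; lra.
have d80 : 0 < d0 / 8 by lra.
have [r r0 rH] := proj1 (nbhsV _ _) (dmx_continuous (HF z0b) d80).
have re1 : 0 < Num.min r e1 by rewrite lt_min r0.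
have [z1 [z1b z1d Jz1]] := jac_dense HF J0 z0b re1.
move: z1d; rewrite lt_min => /andP[z1r z1e].
have w1d := rH z1 z1r.
have Kz1 : K z1 by rewrite /K /cball /mkset ltW.
pose v := RtoC 2 *: (F z1 - w2).
pose psi s := w2 + s *: v.
have vn : enorm v <= d0 / 2.
  rewrite /v enormZ cabs_RtoC ger0_norm //.
  have := enormD (F z1 - F z0) (F z0 - w2); rewrite addrA subrK [enorm (F z0 - w2)]enormBC; lra.
have psin s : cabs s < 3 / 2 -> enorm (psi s - F z0) < d0.
  move=> s1; rewrite /psi addrAC.
  apply: le_lt_trans (enormD _ _) _; rewrite enormZ.
  have := cabs_ge0 s; have := enorm_ge0 v; nra.
have dpsi s : pdiff psi s by eexists; exact: pderiv_line.
have cpsi s : pcont psi s by have [w] := dpsi s; exact: pderiv_continuous.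
pose inK s := exists z, K z /\ F z = psi s.
pose c s := xget 0 [set z | K z /\ F z = psi s].
have cP s : inK s -> K (c s) /\ F (c s) = psi s by exact: xgetPex.
have notin s : ~ inK s -> \forall x \near s, ~ inK x.
  move=> ns.
  have [||z Kz zmin] := compact_min (f := fun x => enorm (F x - psi s)) cK.
  - by exists z0.
  - by move=> x /Kb xb; exact: (@F_dist_continuous _ _ _ _ HF _ _ xb).
  have m0 : 0 < enorm (F z - psi s).
    by rewrite enorm_gt0 subr_eq0; apply/eqP => E; apply: ns; exists z.
  apply: filterS (cpsi s _ m0) => x xd [y [Ky Fy]].
  by have := zmin y Ky; rewrite Fy leNgt xd.
have ccont s : (\forall x \near s, inK x) -> pcont c s.
  move=> Hs e' e'0; have [Kc Fc] := cP _ (nbhs_singleton Hs).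
  have [d dpos dH] := injective_modulus HF Finj cK Kb Kc e'0.
  apply: filterS2 Hs (cpsi s d dpos) => x /cP [Kx Fx] xd.
  by apply: dH => //; rewrite Fx Fc.
pose h s := if `[< inK s >] then J (c s) else 0.
have hT s : inK s -> h s = J (c s) by rewrite /h => /asboolT ->.
have hF s : ~ inK s -> h s = 0 by rewrite /h => /asboolF ->.
have z1' : cabs (0 : C) < 1 by rewrite cabs0.
have not0 : ~ inK 0.
  move=> [z [Kz]]; rewrite /psi scale0r addr0 => E.
  by have := noK z Kz; rewrite E eqxx.
have half1 : cabs (RtoC 2^-1 : C) < 1.
  by rewrite cabs_RtoC gtr0_norm ?invr_gt0 // invf_lt1 // ltr1n.
have psi12 : psi (RtoC 2^-1) = F z1.
  by rewrite /psi /v scalerA -rmorphM mulVf // rmorph1 scale1r addrC subrK.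
have in12 : inK (RtoC 2^-1) by exists z1.
have h12 : h (RtoC 2^-1) = J z1.
  have [Kc Fc] := cP _ in12.
  have c12 : c (RtoC 2^-1) = z1.
    exact: (Finj (Kb _ Kc) z1b (etrans Fc psi12)).
  by rewrite (hT _ in12) c12.
suff h0 : forall p, cabs p < 1 -> h p = 0.
  by move: Jz1; rewrite -h12 (h0 _ half1) eqxx.
apply: (@rado R h 0 z1').
- by apply: filterS (notin _ not0) => s; exact: hF.
- move=> p p1 hp e' e'0.
  have [ip|nip] := pselect (inK p); last first.
    by apply: filterS (notin _ nip) => s /hF -> _; rewrite cabs0 ltW.
  have [Kp Fp] := cP _ ip; rewrite (hT _ ip) in hp.
  have [q q0 qH] := proj1 (nbhsV _ _) (jac_near HF (Kb _ Kp) e'0).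
  have [d dpos dH] := injective_modulus HF Finj cK Kb Kp q0.
  apply: filterS (cpsi p d dpos) => x xd _.
  have [ix|nix] := pselect (inK x); last by rewrite (hF _ nix) cabs0 ltW.
  have [Kx Fx] := cP _ ix; rewrite (hT _ ix).
  have xd' : enorm (F (c x) - F (c p)) < d by rewrite Fx Fp.
  by have := qH _ (dH _ Kx xd'); rewrite hp subr0; exact: ltW.
- move=> p p1 hp.
  have ip : inK p by apply: contrapT => /hF E'; rewrite E' eqxx in hp.
  have [Kp Fp] := cP _ ip; rewrite (hT _ ip) in hp.
  have pd : enorm (c p - z0) < e1.
    by apply: (d0H _ Kp); rewrite Fp; apply: psin; lra.
  have g0 : 0 < e1 - enorm (c p - z0) by lra.
  have [d dpos dH] := locally_onto HF Finj (Kb _ Kp) hp g0.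
  have near_in : \forall s \near p, inK s.
    apply: filterS (cpsi p d dpos) => x; rewrite -Fp => /dH [y [yd yb Fy]].
    exists y; split; last exact: Fy.
    rewrite /K /cball /mkset.
    have := enormD (y - c p) (c p - z0); rewrite addrA subrK; lra.
  have near_c := near_join near_in.
  have [|_ L] := @path_lift R n F DF HF psi c p (Kb _ Kp) hp.
    apply: filterS near_c => s Hs.
    split; [|exact: dpsi|exact: (ccont _ Hs)].
    exact: (proj2 (cP _ (nbhs_singleton Hs))).
  by apply: lholo_ext L; apply: filterS near_in => s /hT ->.
Qed.

End OpenMapping.

(** * One transition step of a chain *)

Section Transition.
Variables (R : realType) (n : nat).
Local Notation C := (Cplx R).
Local Notation V := 'cV[C]_n.
Implicit Types (u v w x y z : V) (s t : C) (e : R) (c : C -> V).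

Lemma quadratic_limit (a X Y : R) : 0 <= a -> a <= 1 -> 0 <= X -> X < 1 -> 0 <= Y ->
  (forall p, X < p -> p < 1 -> Y * (1 + a * p) <= p * (a + p)) ->
  Y * (1 + a * X) <= X * (a + X).
Proof.
move=> a0 a1 X0 X1 Y0 H; apply/ler_addgt0Pr => e e0.
pose p := Num.min (X + e / 3) ((1 + X) / 2).
have p1 : X < p by rewrite lt_min; apply/andP; split; lra.
have p2 : p <= (1 + X) / 2 by rewrite ge_min lexx orbT.
have p3 : p <= X + e / 3 by rewrite ge_min lexx.
have pl1 : p < 1 by lra.
have := H p p1 pl1.
have h1 : Y * (1 + a * X) <= Y * (1 + a * p) by rewrite ler_wpM2l // lerD2l ler_wpM2l // ltW.
have h2 : (p - X) * (a + p + X) <= e / 3 * 3.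
  by apply: ler_pM; lra.
lra.
Qed.

Lemma quadratic_perturb (a X Y : R) : 0 <= a -> a <= 1 -> 0 <= X -> X <= 1 ->
  (forall d, 0 < d -> exists X' Y', [/\ `|X' - X| <= d, `|Y' - Y| <= d,
     0 <= X' <= 1, 0 <= Y' <= 1 & Y' * (1 + a * X') <= X' * (a + X')]) ->
  Y * (1 + a * X) <= X * (a + X).
Proof.
move=> a0 a1 X0 X1 H; apply/ler_addgt0Pr => e e0.
pose d := Num.min 1 (e / 8).
have d0 : 0 < d by rewrite lt_min ltr01; lra.
have d1 : d <= 1 by rewrite ge_min lexx.
have d2 : d <= e / 8 by rewrite ge_min lexx orbT.
have [X' [Y' [hX hY /andP[X'0 X'1] /andP[Y'0 Y'1] h]]] := H d d0.
move: hX hY; rewrite !ler_norml => /andP[x1 x2] /andP[y1 y2].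
have aX : 0 <= 1 + a * X by nra.
have h1 : Y * (1 + a * X) <= (Y' + d) * (1 + a * X) by rewrite ler_wpM2r //; lra.
have h2 : (Y' + d) * (1 + a * X) <= (Y' + d) * (1 + a * (X' + d)).
  by rewrite ler_wpM2l ?lerD2l ?ler_wpM2l //; lra.
have h3 : X' * (a + X') <= (X + d) * (a + (X + d)).
  by apply: ler_pM; lra.
have aX' : a * X' <= 1 by rewrite mulr_ile1.
have aY' : a * Y' <= 1 by rewrite mulr_ile1.
have h4 : d * (1 + a * X') <= d * 2 by rewrite ler_wpM2l //; lra.
have h5 : (a * Y') * d <= 1 * d by rewrite ler_wpM2r //; lra.
have h6 : a * d * d <= d by rewrite ler_piMl ?mulr_ile1 // ltW.
have h7 : d * (a + 2 * X + d) <= d * 4 by rewrite ler_wpM2l //; lra.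
lra.
Qed.

Variables (F G : V -> V) (DF DG : V -> 'M[C]_n) (A B : R).
Hypothesis HF : forall z, eball z -> dmx F z (DF z).
Hypothesis HG : forall z, eball z -> dmx G z (DG z).
Hypothesis Finj : forall x y, eball x -> eball y -> F x = F y -> x = y.
Hypothesis Ginj : forall x y, eball x -> eball y -> G x = G y -> x = y.
Hypothesis GF : forall x, eball x -> exists2 y, eball y & F y = G x.
Hypotheses (F0 : F 0 = 0) (G0 : G 0 = 0).
Hypotheses (DF0 : DF 0 = (RtoC A)%:M) (DG0 : DG 0 = (RtoC B)%:M).
Hypotheses (A_gt0 : 0 < A) (B_gt0 : 0 < B).

Lemma jac_scalar_neq0 (H : V -> 'M[C]_n) (b : R) : H 0 = (RtoC b)%:M -> 0 < b ->
  jac H 0 != 0.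
Proof.
move=> H0 b0; rewrite /jac H0 det_scalar expf_neq0 // RtoC_eq0.
by apply: lt0r_neq0.
Qed.

(** Schwarz's lemma for the transition map [F^-1 o G] on the complex line
    through [x]: tested against a vector norming [y] it becomes a function of one
    variable, bounded by [1], with derivative at most [B / A] at the origin.  The
    line is parametrized so that [x] has coordinate [p]; the unit disc of
    coordinates then stays inside the ball of radius [enorm x / p]. *)
Lemma transition_regular x y (p : R) : B < A -> eball y -> x != 0 -> y != 0 ->
  enorm x < p -> p < 1 -> F y = G x -> jac DF y != 0 ->
  enorm y * (1 + B / A * p) <= p * (B / A + p).
Proof.
move=> BA yb x0 y0 xp p1 Fy Jy.
have JF0 := jac_scalar_neq0 DF0 A_gt0.
have xn : 0 < enorm x by rewrite enorm_gt0.
have yn : 0 < enorm y by rewrite enorm_gt0.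
have p0 : 0 < p by lra.
have a0 : 0 < B / A by rewrite divr_gt0.
have a1 : B / A < 1 by rewrite ltr_pdivrMr // mul1r.
pose v := RtoC p^-1 *: x.
have vn : enorm v = enorm x / p.
  by rewrite /v enormZ cabs_RtoC gtr0_norm ?invr_gt0 // mulrC.
have v0 : 0 < enorm v by rewrite vn divr_gt0.
have v1 : enorm v < 1 by rewrite vn ltr_pdivrMr // mul1r.
pose l s : V := 0 + s *: v.
have ln s : enorm (l s) = cabs s * enorm v by rewrite /l add0r enormZ.
pose psi s := G (l s).
pose D s := cabs s * enorm v < 1.
have lb s : D s -> eball (l s) by rewrite /D -ln.
have D1 s : cabs s <= 1 -> D s by move=> s1; rewrite /D; have := cabs_ge0 s; nra.
have nearD s : cabs s <= 1 -> \forall t \near s, D t.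
  move=> s1; have g0 : 0 < 1 - enorm v by lra.
  apply: filterS (near_cabs_lt s g0) => t ts; rewrite /D.
  have := cabsD (t - s) s; rewrite subrK; have := cabs_ge0 t; nra.
have dpsi s : D s -> pderiv psi s (DG (l s) *m v).
  move=> Ds; exact: (@dmx_path _ _ G l s _ _ (HG (lb s Ds)) (pderiv_line 0 v s)).
pose c s := xget 0 [set z | eball z /\ F z = psi s].
have cP s : D s -> eball (c s) /\ F (c s) = psi s.
  by move=> Ds; have [z zb Fz] := GF (lb s Ds); apply: (@xgetPex _ _ [set z | eball z /\ F z = psi s]); exists z.
have c_cont s : D s -> (\forall t \near s, D t) -> pcont c s.
  move=> Ds nD e e0; have [cb Fc] := cP s Ds.
  have [d d0 dH] := open_mapping HF Finj JF0 cb e0.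
  apply: filterS2 nD (pderiv_continuous (dpsi s Ds) d0) => t Dt td.
  have [tb Ft] := cP t Dt.
  have td' : enorm (psi t - F (c s)) < d by rewrite Fc.
  have [z [zc zb Fz]] := dH _ td'.
  by rewrite (Finj tb zb (etrans Ft (esym Fz))).
have near_cc s : cabs s <= 1 ->
    \forall t \near s, [/\ F (c t) = psi t, pdiff psi t & pcont c t].
  move=> s1; have nD := nearD s s1.
  apply: filterS (near_join nD) => t nDt; have Dt := nbhs_singleton nDt.
  split; [exact: (proj2 (cP t Dt))|by eexists; exact: dpsi|exact: c_cont].
have c_pcont s : cabs s <= 1 -> pcont c s.
  by move=> s1; have [] := nbhs_singleton (near_cc s s1).
have cE s z : D s -> eball z -> F z = psi s -> c s = z.
  by move=> Ds zb Fz; have [cb Fc] := cP s Ds; exact: (Finj cb zb (etrans Fc (esym Fz))).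
have cp : c (RtoC p) = y.
  apply: cE => //; first by apply: D1; rewrite cabs_RtoC gtr0_norm // ltW.
  by rewrite Fy /psi /l /v add0r scalerA -rmorphM mulfV ?gt_eqF // rmorph1 scale1r.
have z1 : cabs (0 : C) <= 1 by rewrite cabs0.
have c0 : c 0 = 0.
  apply: (cE _ _ (D1 _ z1)); first exact: eball0.
  by rewrite F0 /psi /l scale0r addr0 G0.
pose h s := jac DF (c s).
have [w wn wy] := norming_vector y.
pose q s : C := dot w (c s).
have lift s : cabs s <= 1 -> h s != 0 -> (\forall t \near s, pdiff c t) /\ lholo h s.
  move=> s1 hs; have [cb _] := cP s (D1 s s1).
  exact: (@path_lift R n F DF HF psi c s cb hs (near_cc s s1)).
pose k : C := dot w (invmx (DF 0) *m (DG (l 0) *m v)).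
have l0 : l 0 = 0 by rewrite /l scale0r addr0.
have kE : k = RtoC (B / A) * dot w v.
  rewrite /k l0 DF0 DG0 invmx_scalar !mul_scalar_mx scalerA dotZ.
  by rewrite -fmorphV -rmorphM [A^-1 * B]mulrC.
have ka : cabs k <= B / A.
  rewrite kE cabsM cabs_RtoC gtr0_norm // ger_pMr //.
  apply: le_trans (cauchy_schwarz _ _) _.
  by rewrite mulr_ile1 ?enorm_ge0 // ltW.
have h0 : h 0 != 0 by rewrite /h c0.
have pc : cabs (RtoC p) = p by rewrite cabs_RtoC gtr0_norm.
have := @schwarz_derivative_exceptional R q h k (B / A) _ _ _ _ h0 _ _ ka a1 (RtoC p).
rewrite pc => S.
have {}S : cabs (q (RtoC p)) * (1 + B / A * p) <= p * (B / A + p).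
  apply: S; last by rewrite /h cp.
  - move=> s s1 hs e e0; have [cb _] := cP s (D1 s s1).
    apply: filterS (pcont_near (c_pcont s s1) (jac_near HF cb e0)) => t.
    by rewrite -/(h s) hs subr0 => /ltW ht _.
  - by move=> s s1 hs; have [] := lift s s1 hs.
  - move=> s s1 hs; have [L _] := lift s s1 hs.
    by apply: filterS L => t [w' dw']; eexists; exact: pderiv_dot dw'.
  - move=> s s1 _; have [cb _] := cP s (D1 s s1).
    apply: le_trans (cauchy_schwarz _ _) _.
    by apply: mulr_ile1; rewrite ?enorm_ge0 //; exact: ltW.
  - by rewrite /q c0 -(scale0r (0 : V)) dotZ mul0r.
  - apply: pderiv_dot; have D0 := D1 _ z1.
    have HF0 : dmx F (c 0) (DF 0) by rewrite c0; apply: HF; exact: eball0.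
    apply: (inverse_path HF0 _ (dpsi 0 D0) (c_pcont 0 z1)).
      by rewrite unitmxE unitfE; exact: JF0.
    by apply: filterS (near_cc 0 z1) => t [].
  - exact: ltW.
have qy : cabs (q (RtoC p)) = enorm y.
  by rewrite /q cp wy cabs_RtoC gtr0_norm.
by rewrite qy in S.
Qed.

(** [transition_regular] extends to all points since both maps are open and the
    Jacobian determinant of [F] is nonzero on a dense set. *)
Theorem transition_bound x y : B < A -> eball x -> eball y -> F y = G x ->
  enorm y * (1 + B / A * enorm x) <= enorm x * (B / A + enorm x).
Proof.
move=> BA xb yb Fy.
have a0 : 0 <= B / A by rewrite divr_ge0 // ltW.
have a1 : B / A <= 1 by rewrite ler_pdivrMr // mul1r ltW.
have JF0 := jac_scalar_neq0 DF0 A_gt0.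
have JG0 := jac_scalar_neq0 DG0 B_gt0.
have ineq x' y' : eball x' -> eball y' -> F y' = G x' -> jac DF y' != 0 ->
    enorm y' * (1 + B / A * enorm x') <= enorm x' * (B / A + enorm x').
  move=> x'b y'b Fy' Jy'.
  have [y0|y0] := eqVneq y' 0.
    by rewrite y0 enorm0 mul0r mulr_ge0 ?addr_ge0 ?enorm_ge0.
  have x0 : x' != 0.
    apply: contra_neq y0 => x0; apply: Finj => //; first exact: eball0.
    by rewrite Fy' x0 F0 G0.
  apply: quadratic_limit => //; try exact: enorm_ge0.
  by move=> p xp p1; exact: (@transition_regular x').
apply: quadratic_perturb => //; try exact: enorm_ge0; first exact: ltW.
move=> d d0.
have [d1 d10 d1H] := open_mapping HG Ginj JG0 xb d0.
have [r r0 rH] := proj1 (nbhsV _ _) (dmx_continuous (HF yb) d10).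
have m0 : 0 < Num.min d r by rewrite lt_min d0.
have [y' [y'b]] := jac_dense HF JF0 yb m0.
rewrite lt_min => /andP[y'd y'r] Jy'.
have [|x' [x'd x'b Gx']] := d1H (F y'); first by rewrite -Fy; exact: rH.
exists (enorm x'), (enorm y'); split.
- exact: le_trans (enorm_dist _ _) (ltW x'd).
- exact: le_trans (enorm_dist _ _) (ltW y'd).
- by rewrite enorm_ge0 /=; exact: ltW.
- by rewrite enorm_ge0 /=; exact: ltW.
- exact: ineq.
Qed.

End Transition.

(** * Matrices of Frechet differentials *)

Section FrechetDerivative.
Variables (R : realType) (n : nat).
Local Notation C := (Cplx R).
Local Notation V := 'cV[C]_n.
Implicit Types (v x z : V) (F : V -> V).

Lemma mx_norm_enorm v : `|v| <= RtoC (enorm v).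
Proof.
have e0 : 0 <= RtoC (enorm v) by rewrite /RtoC ler0c enorm_ge0.
have nE : `|v| = mx_norm v by [].
have [v0|v0] := eqVneq (mx_norm v) 0; first by rewrite nE v0.
have [i vi] := mx_norm_neq0 v0.
rewrite nE vi cabsE /RtoC lecR (ord1 i.2).
exact: enorm_coord.
Qed.

Lemma enorm_mx_norm v (e : R) : `|v| <= RtoC e -> enorm v <= n%:R * e.
Proof.
move=> ve; apply: le_trans (enorm_sum _) _.
apply: (@le_trans _ _ (\sum_(i < n) e)); last by rewrite sumr_const card_ord mulr_natl.
apply: ler_sum => i _; rewrite -lecR.
apply: le_trans ve; rewrite -[X in X <= _]cabsE.
have -> : `|v| = mx_norm v by [].
rewrite mx_normE -[leLHS]nngE num_le.
exact: (le_bigmax _ (fun i : 'I_n * 'I_1 => `|v i.1 i.2|%:nng) (i, 0)).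
Qed.

Definition dmat F z : 'M[C]_n := \matrix_(i, j) ('d F z (bvec R j)) i 0.

Lemma dmatE F z v : 'd F z v = dmat F z *m v.
Proof.
have -> : v = \sum_j v j 0 *: bvec R j.
  apply/matrixP => i j; rewrite (ord1 j) summxE (bigD1 i) //= big1 => [|k ki].
    by rewrite /bvec !mxE !eqxx mulr1 addr0.
  by rewrite /bvec !mxE eq_sym (negbTE ki) mulr0.
rewrite linear_sum mulmx_sumr; apply: eq_bigr => j _.
rewrite linearZ -scalemxAr; congr (_ *: _).
apply/matrixP => i k; rewrite (ord1 k) /bvec -colE !mxE.
by [].
Qed.

Lemma differentiable_dmx F z : differentiable F z -> dmx F z (dmat F z).
Proof.
move=> /diff_locally dF e e0.
have n0 : 0 < n%:R + 1 :> R by rewrite ltr_wpDl.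
have e10 : 0 < RtoC (e / (n%:R + 1)) by rewrite /RtoC ltcR divr_gt0.
have /eqaddoP /(_ _ e10) /nbhsV [d d0 dH] := dF.
apply/nbhsV; exists d => // x xz.
have := dH (x - z); rewrite subr0 => /(_ xz) /=.
rewrite -[X in `|X|]/(F (x - z + z) - (F z + 'd F z (x - z))) subrK => H.
have {}H : `|F x - F z - dmat F z *m (x - z)| <= RtoC (e / (n%:R + 1) * enorm (x - z)).
  rewrite -dmatE rmorphM; apply: le_trans (ler_wpM2l (ltW e10) (mx_norm_enorm _)).
  by apply: le_trans H; rewrite -addrA -opprD.
apply: le_trans (enorm_mx_norm H) _.
rewrite mulrA ler_wpM2r ?enorm_ge0 // mulrCA ger_pMr // ler_pdivrMr // mul1r.
lra.
Qed.

Lemma dmxZ F z (M : 'M[C]_n) (a : C) : dmx F z M ->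
  dmx (fun x => a *: F x) z (a *: M).
Proof.
move=> dF e e0; have a0 := cabs_ge0 a.
have d0 : 0 < e / (cabs a + 1) by rewrite divr_gt0 //; lra.
apply: filterS (dF _ d0) => x H.
rewrite -scalemxAl -!scalerBr enormZ.
have h1 := ler_wpM2l a0 H; apply: le_trans h1 _.
rewrite mulrA ler_wpM2r ?enorm_ge0 // mulrCA ger_pMr // ler_pdivrMr; lra.
Qed.

End FrechetDerivative.

(** * The Koebe function *)

Section KoebeFunction.
Variable R : realType.
Implicit Types (a x y t s e : R).

Definition koebe x : R := x / (1 - x) ^+ 2.

Lemma koebe_ge0 x : 0 <= x -> 0 <= koebe x.
Proof. by move=> x0; rewrite divr_ge0 ?sqr_ge0. Qed.

Lemma koebe_ge x : 0 <= x -> x < 1 -> x <= koebe x.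
Proof.
move=> x0 x1; rewrite ler_pdivlMr ?exprn_gt0 ?subr_gt0 //.
by rewrite ler_piMr // expr_le1 ?subr_ge0 ?gerBl // ltW.
Qed.

Lemma koebe_le x y : 0 <= x -> x <= y -> y < 1 -> koebe x <= koebe y.
Proof.
move=> x0 xy y1; rewrite /koebe; apply: ler_pM => //; first by rewrite invr_ge0 sqr_ge0.
rewrite lef_pV2 ?posrE ?exprn_gt0 ?subr_gt0 //; last by lra.
by apply: lerXn2r; rewrite ?nnegrE; lra.
Qed.

(** Two factors [a + x] and [1 + a x] of sum [(1 + a) (1 + x)]: the
    arithmetic-geometric inequality bounds their product. *)
Lemma koebe_contraction a x y : 0 <= a -> a < 1 -> 0 <= x -> x < 1 -> 0 <= y -> y < 1 ->
  y * (1 + a * x) <= x * (a + x) -> koebe y <= ((1 + a) / 2) ^+ 2 * koebe x.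
Proof.
move=> a0 a1 x0 x1 y0 y1 H.
have ax : 0 <= a * x by rewrite mulr_ge0.
have d0 : 0 < 1 + a * x by lra.
pose x' := x * (a + x) / (1 + a * x).
have yx : y <= x' by rewrite ler_pdivlMr.
have x2 : 0 < 1 - x ^+ 2 by rewrite subr_gt0 exprn_ilt1.
have E : 1 - x' = (1 - x ^+ 2) / (1 + a * x) by rewrite /x'; field; rewrite gt_eqF.
have x'1 : x' < 1 by rewrite -subr_gt0 E divr_gt0.
apply: le_trans (koebe_le y0 yx x'1) _.
rewrite /koebe E /x'.
have x1' : 0 < 1 - x by lra.
have x1'' : 0 < 1 + x by lra.
have -> : x * (a + x) / (1 + a * x) / ((1 - x ^+ 2) / (1 + a * x)) ^+ 2 =
   ((a + x) * (1 + a * x) / (1 + x) ^+ 2) * (x / (1 - x) ^+ 2).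
  have -> : 1 - x ^+ 2 = (1 - x) * (1 + x) by ring.
  by field; rewrite !gt_eqF.
rewrite ler_wpM2r // ?divr_ge0 ?sqr_ge0 // ler_pdivrMr ?exprn_gt0 //.
have := sqr_ge0 ((a + x) - (1 + a * x)); lra.
Qed.

(** [(1 + e^-s) / 2] squared agrees with [e^-s] to first order in [s]. *)
Lemma half_expR_sqr s : 0 <= s -> s <= 1 / 2 ->
  ((1 + expR (- s)) / 2) ^+ 2 <= expR (- s) * expR (s ^+ 2).
Proof.
move=> s0 s1; set a := expR (- s).
have a1 : 1 - s <= a by have := expR_ge1Dx (- s); rewrite -/a.
have al : a <= 1 by rewrite -[leRHS]expR0 ler_expR oppr_le0.
have h := expR_ge1Dx (s ^+ 2).
have s2 := sqr_ge0 s.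
have h1 : a * (1 + s ^+ 2) <= a * expR (s ^+ 2) by rewrite ler_wpM2l ?expR_ge0.
apply: le_trans h1; have -> : ((1 + a) / 2) ^+ 2 = a + (1 - a) ^+ 2 / 4 by field.
have h2 : (1 - a) ^+ 2 <= s ^+ 2 by apply: lerXn2r; rewrite ?nnegrE; lra.
have h3 : 1 / 2 * s ^+ 2 <= a * s ^+ 2 by rewrite ler_wpM2r //; lra.
lra.
Qed.

Lemma expRN_small e : 0 < e -> exists2 t, 0 <= t & expR (- t) <= e.
Proof.
move=> e0; exists (e^-1); first by rewrite invr_ge0 ltW.
rewrite expRN -[leRHS]invrK lef_pV2 ?posrE ?expR_gt0 ?invr_gt0 //.
by apply: le_trans (expR_ge1Dx _); rewrite lerDr.
Qed.

(** Limit of the bounds obtained by cutting [0, t] into [N] equal steps. *)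
Lemma koebe_limit (t A B : R) : 0 <= t -> 0 <= A -> 0 <= B ->
  (forall N : nat, (0 < N)%N ->
     B <= (((1 + expR (- (t / N%:R))) / 2) ^+ 2) ^+ N * A) -> B <= expR (- t) * A.
Proof.
move=> t0 A0 B0 H; apply/ler_addgt0Pr => e e0.
pose N := (Num.bound (2 * t) + Num.bound (B * t ^+ 2 / e)).+1.
have Npos : 0 < (N%:R : R) by rewrite ltr0n.
have hN1 : 2 * t <= N%:R.
  apply: le_trans (ltW (archi_boundP _)) _; first by rewrite mulr_ge0.
  by rewrite ler_nat /N leqW // leq_addr.
have hN2 : B * t ^+ 2 / e <= N%:R.
  apply: le_trans (ltW (archi_boundP _)) _; first by rewrite divr_ge0 ?mulr_ge0 ?sqr_ge0 // ltW.
  by rewrite ler_nat /N leqW // leq_addl.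
pose s := t / N%:R; have s0 : 0 <= s by rewrite divr_ge0 // ltW.
have s1 : s <= 1 / 2 by rewrite ler_pdivrMr //; lra.
have Ns : N%:R * s = t by rewrite /s mulrC divfK // gt_eqF.
have := H N isT; rewrite -/s => h.
have h1 : (((1 + expR (- s)) / 2) ^+ 2) ^+ N <= (expR (- s) * expR (s ^+ 2)) ^+ N.
  apply: lerXn2r; rewrite ?nnegrE ?sqr_ge0 ?mulr_ge0 ?expR_ge0 //.
  exact: half_expR_sqr.
have E : (expR (- s) * expR (s ^+ 2)) ^+ N = expR (- t) * expR (t * s).
  rewrite -expRD -expRM_natl -expRD; congr expR.
  by rewrite -Ns; ring.
rewrite E in h1.
have h2 : B * expR (- (t * s)) <= expR (- t) * A.
  have h3 := le_trans h (ler_wpM2r A0 h1).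
  rewrite expRN ler_pdivrMr ?expR_gt0 //; lra.
have h4 : B * (1 - t * s) <= B * expR (- (t * s)).
  by rewrite ler_wpM2l // expR_ge1Dx.
have h5 : B * (t * s) <= e.
  rewrite /s; have -> : B * (t * (t / N%:R)) = B * t ^+ 2 / N%:R by ring.
  by rewrite ler_pdivrMr // (mulrC e) -ler_pdivrMr.
lra.
Qed.

End KoebeFunction.

(** * The growth theorem *)

Section Growth.
Variables (R : realType) (n : nat).
Local Notation C := (Cplx R).
Local Notation V := 'cV[C]_n.
Implicit Types (u v w x y z : V) (s t e : R).

(** The one-variable second order estimate on the line through [w], tested
    against a vector norming [G w - w]. *)
Lemma enorm_second_order (G : V -> V) (DG : V -> 'M[C]_n) (B : R) :
  (forall z, eball z -> dmx G z (DG z)) -> DG 0 = 1%:M -> G 0 = 0 -> 0 <= B ->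
  (forall z, enorm z <= 1 / 2 -> enorm (G z) <= B) ->
  forall w, enorm w <= 1 / 16 -> enorm (G w - w) <= 256 * B * enorm w ^+ 2.
Proof.
move=> HG DG0 G0 B0 GB w w1.
have [->|w0] := eqVneq w 0.
  by rewrite G0 subrr enorm0 expr0n /= mulr0.
have wn : 0 < enorm w by rewrite enorm_gt0.
have [u u1 uE] := norming_vector (G w - w).
pose d := RtoC (enorm w)^-1 *: w.
have dn : enorm d = 1.
  by rewrite /d enormZ cabs_RtoC gtr0_norm ?invr_gt0 // mulVf // gt_eqF.
pose l (q : C) : V := 0 + q *: d.
have ln q : enorm (l q) = cabs q by rewrite /l add0r enormZ dn mulr1.
pose g q : C := dot u (G (l q)).
have gd q : cabs q < 1 -> cderiv g q (dot u (DG (l q) *m d)).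
  move=> q1; have lb : eball (l q) by rewrite /eball /mkset ln.
  exact: (pderiv_dot u (@dmx_path _ _ G l q _ _ (HG _ lb) (pderiv_line 0 d q))).
have r0 : 0 < (1 / 2 : R) by lra.
have gb q : cabs (q - 0) < 1 / 2 -> cdiff g q /\ cabs (g q) <= B.
  rewrite subr0 => q1; split; first by eexists; apply: gd; lra.
  apply: le_trans (cauchy_schwarz _ _) _.
  have h : enorm (G (l q)) <= B by apply: GB; rewrite ln ltW.
  by apply: le_trans (ler_pM _ _ u1 h) _; rewrite ?enorm_ge0 ?mul1r.
have gd0 : cderiv g 0 (dot u d).
  have := gd 0; rewrite cabs0 ltr01 => /(_ isT).
  by rewrite /l scale0r addr0 DG0 mul1mx.
have w8 : cabs (RtoC (enorm w)) <= 1 / 2 / 8.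
  by rewrite cabs_RtoC gtr0_norm //; lra.
have := second_order r0 B0 gb gd0 w8.
have lw : l (RtoC (enorm w)) = w.
  by rewrite /l add0r /d scalerA -rmorphM mulfV ?gt_eqF // rmorph1 scale1r.
rewrite add0r /g lw /l scale0r addr0 G0 mulrC -dotZ.
have -> : RtoC (enorm w) *: d = w by rewrite -[RHS]lw /l add0r.
rewrite -!dotB subr0 uE !cabs_RtoC !ger0_norm ?enorm_ge0 //.
have -> : 64 * B / (1 / 2) ^+ 2 = 256 * B by field.
by [].
Qed.

Variable ft : R -> V -> V.
Hypothesis chain : normal_Loewner_chain ft.

Let G t := rescaled ft t.
Let DG t z := dmat (G t) z.

Lemma chain_dmx t : 0 <= t -> forall z, eball z -> dmx (G t) z (DG t z).
Proof.
move=> t0 z zb; apply: differentiable_dmx.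
by case: chain => -[_ /(_ t t0) [h _ _ _] _] _; exact: h.
Qed.

Lemma chain_inj t : 0 <= t -> forall x y, eball x -> eball y -> G t x = G t y -> x = y.
Proof.
move=> t0 x y xb yb; case: chain => -[_ /(_ t t0) [_ h _ _] _] _.
by apply: h; rewrite inE.
Qed.

Lemma chain_0 t : 0 <= t -> G t 0 = 0.
Proof. by move=> t0; case: chain => -[_ /(_ t t0) [_ _ h _] _] _. Qed.

Lemma chain_d0 t : 0 <= t -> DG t 0 = 1%:M.
Proof.
move=> t0; case: chain => -[_ /(_ t t0) [_ _ _ h] _] _.
apply/matrixP => i j; rewrite !mxE h /bvec !mxE eqxx andbT.
by [].
Qed.

Lemma chainE t z : ft t z = RtoC (expR t) *: G t z.
Proof. by rewrite /G /rescaled scalerA -rmorphM -expRD subrr expR0 rmorph1 scale1r. Qed.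

Lemma chain_sub s t x : 0 <= s -> s <= t -> eball x ->
  exists2 y, eball y & ft t y = ft s x.
Proof.
move=> s0 st xb; case: chain => -[_ _ /(_ s t s0 st) h] _.
by have [|y yb yE] := h (ft s x); [exists x|exists y].
Qed.

Lemma chain_step s t x y : 0 <= s -> s < t -> eball x -> eball y -> ft t y = ft s x ->
  koebe (enorm y) <= ((1 + expR (- (t - s))) / 2) ^+ 2 * koebe (enorm x).
Proof.
move=> s0 st xb yb E.
have t0 : 0 <= t by lra.
have e1 : 0 < 1 - expR (- (t - s)).
  by rewrite subr_gt0 -[ltRHS]expR0 ltr_expR; lra.
apply: koebe_contraction; rewrite ?expR_ge0 ?enorm_ge0 //; try exact: xb; try exact: yb.
  by rewrite -subr_gt0.
have -> : expR (- (t - s)) = expR s / expR t by rewrite -expRN -expRD; congr expR; ring.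
have df r : 0 <= r -> forall z, eball z -> dmx (ft r) z (RtoC (expR r) *: DG r z).
  move=> r0 z zb; have -> : ft r = (fun z => RtoC (expR r) *: G r z).
    by apply/funext => q; exact: chainE.
  by apply: dmxZ; exact: chain_dmx.
have inj r : 0 <= r -> forall x y, eball x -> eball y -> ft r x = ft r y -> x = y.
  move=> r0 p q pb qb; rewrite !chainE => /scalerI E'.
  by apply: (chain_inj r0) => //; apply: E'; rewrite RtoC_eq0 gt_eqF // expR_gt0.
have z0 r : 0 <= r -> ft r 0 = 0 by move=> r0; rewrite chainE chain_0 // scaler0.
have d0 r : 0 <= r -> RtoC (expR r) *: DG r 0 = (RtoC (expR r))%:M.
  by move=> r0; rewrite chain_d0 // scalemx1.
apply: (@transition_bound R n (ft t) (ft s) (fun z => RtoC (expR t) *: DG t z)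
  (fun z => RtoC (expR s) *: DG s z)) => //.
- exact: df.
- exact: df.
- exact: inj.
- exact: inj.
- by move=> q qb; apply: chain_sub => //; exact: ltW.
- exact: z0.
- exact: z0.
- exact: d0.
- exact: d0.
- exact: expR_gt0.
- exact: expR_gt0.
- by rewrite ltr_expR.
Qed.

(** Splitting [0, t] into short steps makes the one-step contraction sharp. *)
Lemma chain_decay t x y : 0 <= t -> eball x -> eball y -> ft t y = ft 0 x ->
  koebe (enorm y) <= expR (- t) * koebe (enorm x).
Proof.
move=> t0 xb yb E.
have [t00|tn0] := eqVneq t 0.
  rewrite t00 oppr0 expR0 mul1r; suff -> : y = x by [].
  apply: (chain_inj (lexx 0)) => //; move: E; rewrite t00 !chainE.
  by apply: scalerI; rewrite RtoC_eq0 gt_eqF // expR_gt0.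
have tp : 0 < t by rewrite lt_neqAle eq_sym tn0.
apply: koebe_limit; rewrite ?koebe_ge0 ?enorm_ge0 // => N N0.
have Np : 0 < (N%:R : R) by rewrite ltr0n.
pose tau := t / N%:R; have tau0 : 0 < tau by rewrite divr_gt0.
suff H k z : eball z -> ft (k%:R * tau) z = ft 0 x ->
    koebe (enorm z) <= (((1 + expR (- tau)) / 2) ^+ 2) ^+ k * koebe (enorm x).
  by apply: H => //; rewrite /tau mulrC divfK // gt_eqF.
elim: k z => [|k IH] z zb.
  rewrite mul0r => Ez; rewrite expr0 mul1r; suff -> : z = x by [].
  apply: (chain_inj (lexx 0)) => //; move: Ez; rewrite !chainE.
  by apply: scalerI; rewrite RtoC_eq0 gt_eqF // expR_gt0.
move=> Ez; have k0 : 0 <= k%:R * tau by rewrite mulr_ge0 // ltW.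
have [z' z'b Ez'] := chain_sub (lexx 0) k0 xb.
have kk : k%:R * tau < k.+1%:R * tau by rewrite ltr_pM2r // ltr_nat.
have := chain_step k0 kk z'b zb (etrans Ez (esym Ez')).
have -> : k.+1%:R * tau - k%:R * tau = tau by rewrite -addn1 natrD; ring.
move: IH; set Q := ((1 + expR (- tau)) / 2) ^+ 2 => IH h; apply: le_trans h _.
have Q0 : 0 <= Q by exact: sqr_ge0.
by rewrite (exprS Q) -mulrA ler_wpM2l // IH.
Qed.

Lemma cball_half_sub : cball (0 : V) (1 / 2) `<=` @eball R n.
Proof. by apply: cball_eball; rewrite enorm0; lra. Qed.

(** Normality yields a uniform bound: otherwise a sequence of rescaled maps with
    unbounded maxima on the compact ball would have a uniformly convergent
    subsequence. *)
Lemma chain_bounded : exists2 B : R, 0 <= B &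
  forall t z, 0 <= t -> enorm z <= 1 / 2 -> enorm (G t z) <= B.
Proof.
apply: contrapT => H.
have {}H (k : nat) : exists p : R * V, [/\ 0 <= p.1, enorm p.2 <= 1 / 2 &
    k%:R < enorm (G p.1 p.2)].
  apply: contrapT => Hk; apply: H; exists k%:R => // t z t0 z1.
  by rewrite leNgt; apply/negP => h; apply: Hk; exists (t, z).
have [p pP] := choice H.
pose U k := rescaled ft (p k).1.
have [_ nf] := chain.
have [|phi phim [g gcv]] := nf U.
  by move=> k; exists (p k).1 => //; have [] := pP k.
have K : compact_in_eball (cball (0 : V) (1 / 2)).
  by split; [exact: cball_compact|exact: cball_half_sub].
have phile k : (k <= phi k)%N.
  by elim: k => // k IH; apply: leq_ltn_trans IH (phim _ _ (ltnSn k)).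
have [N _ NP] : \forall k \near \oo, forall z, cball (0 : V) (1 / 2) z ->
    enorm (U (phi k) z - g z) < 1.
  move/fam_cvgP : gcv => /(_ _ K) gcv.
  pose d : C := @RtoC R (1 / (n%:R + 1)).
  have d0 : 0 < d by rewrite /d /RtoC ltcR divr_gt0 // ltr_wpDl.
  pose E := [set xy : V * V | ball xy.1 d xy.2].
  have entE : entourage E by rewrite -entourage_ballE; exists d.
  have : nbhs (g : {uniform` cball (0 : V) (1 / 2) -> V})
      [set h | forall z, cball (0 : V) (1 / 2) z -> E (g z, h z)].
    by apply/uniform_nbhs; exists E; split; [exact: entE|move=> h; apply].
  move=> /gcv ev.
  have {}ev : \forall k \near \oo, forall z, cball (0 : V) (1 / 2) z -> E (g z, U (phi k) z).
    exact: ev.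
  apply: filterS ev => k Hk z zK.
  have := Hk z zK; rewrite /E /= -ball_normE /ball_ /= => h.
  rewrite enormBC; apply: le_lt_trans (enorm_mx_norm (ltW h)) _.
  by rewrite mulrA mulr1 ltr_pdivrMr ?ltr_wpDl // mul1r ltrDl.
have [B BP] : exists B : R, forall z, cball (0 : V) (1 / 2) z -> enorm (U (phi N) z) <= B.
  have [||z zK zmin] := compact_min (f := fun z => - enorm (U (phi N) z - 0)) (@cball_compact R n 0 (1 / 2)).
  - by exists 0; apply: cball_center.
  - move=> z /cball_half_sub zb; apply: continuousN.
    have [pN _ _] := pP (phi N).
    exact: (@F_dist_continuous _ _ _ _ (chain_dmx pN) 0 z zb).
  exists (enorm (U (phi N) z)) => x xK.
  by have := zmin x xK; rewrite !subr0 lerN2.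
pose k := maxn N (Num.bound (B + 2)).
have kN : (N <= k)%N by rewrite leq_maxl.
have [q0 zk kk] := pP (phi k).
set z := (p (phi k)).2 in zk kk.
have zK : cball (0 : V) (1 / 2) z by rewrite /cball /mkset subr0.
have h1 := NP k kN z zK; have h2 := NP N (leqnn N) z zK; have h3 := BP z zK.
have h4 : B + 2 < (phi k)%:R.
  have h5 : 0 <= B + 2 by rewrite addr_ge0 // (le_trans (enorm_ge0 _) h3).
  apply: lt_le_trans (archi_boundP h5) _; rewrite ler_nat.
  by apply: leq_trans (phile k); rewrite leq_maxr.
have h5 := enormD (U (phi k) z - g z) (g z - U (phi N) z).
rewrite addrA subrK [enorm (g z - _)]enormBC in h5.
have h6 := enormD (U (phi k) z - U (phi N) z) (U (phi N) z); rewrite subrK in h6.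
have h7 : enorm (U (phi k) z) < B + 2.
  apply: le_lt_trans h6 _; rewrite addrC; apply: ler_ltD h3 _.
  by apply: le_lt_trans h5 _; exact: ltrD h1 h2.
by have := lt_trans h4 (lt_trans kk h7); rewrite ltxx.
Qed.

(** Transport [x] to time [t]: the image [y] has size about [e^-t] times the
    Koebe value of [enorm x], and near the origin [ft t] is [e^t] times the
    identity up to a second order error, uniformly in [t]. *)
Theorem growth x : eball x -> enorm (ft 0 x) <= koebe (enorm x).
Proof.
move=> xb; apply/ler_addgt0Pr => e e0.
have [B B0 BP] := chain_bounded.
set K := koebe (enorm x); have K0 : 0 <= K by rewrite koebe_ge0 ?enorm_ge0.
pose c := Num.min (1 / (16 * (K + 1))) (e / (256 * B * K ^+ 2 + 1)).
have D0 : 0 <= 256 * B * K ^+ 2.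
  exact: mulr_ge0 (mulr_ge0 (ler0n _ _) B0) (sqr_ge0 _).
have c0 : 0 < c.
  rewrite lt_min; apply/andP; split; first by apply: divr_gt0 => //; lra.
  by apply: divr_gt0 e0 _; lra.
have [t t0 tc] := expRN_small c0.
have [y yb E] := chain_sub (lexx 0) t0 xb.
have dec := chain_decay t0 xb yb E.
have y1 : enorm y <= expR (- t) * K.
  by apply: le_trans dec; apply: koebe_ge; [exact: enorm_ge0|exact: yb].
have cK : c * K <= 1 / 16.
  have : c <= 1 / (16 * (K + 1)) by rewrite ge_min lexx.
  rewrite ler_pdivlMr; last by rewrite mulr_gt0 //; lra.
  lra.
have tK : expR (- t) * K <= c * K by rewrite ler_wpM2r.
have y16 : enorm y <= 1 / 16 by lra.
have so := enorm_second_order (chain_dmx t0) (chain_d0 t0) (chain_0 t0) B0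
   (fun z => BP t z t0) y16.
rewrite -E chainE enormZ cabs_RtoC gtr0_norm ?expR_gt0 //.
have h1 : enorm (G t y) <= enorm y + 256 * B * enorm y ^+ 2.
  by have := enormD (G t y - y) y; rewrite subrK; lra.
have h2 : enorm y ^+ 2 <= (expR (- t) * K) ^+ 2.
  by apply: lerXn2r; rewrite ?nnegrE ?enorm_ge0 // mulr_ge0 ?expR_ge0.
have h3 : enorm (G t y) <= expR (- t) * K + 256 * B * (expR (- t) * K) ^+ 2.
  apply: le_trans h1 (lerD y1 _).
  exact: (ler_wpM2l (mulr_ge0 (ler0n _ _) B0) h2).
apply: le_trans (ler_wpM2l (expR_ge0 t) h3) _.
have ee : expR t * expR (- t) = 1 by rewrite -expRD subrr expR0.
have -> : expR t * (expR (- t) * K + 256 * B * (expR (- t) * K) ^+ 2) =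
  (expR t * expR (- t)) * (K + 256 * B * K ^+ 2 * expR (- t)) by ring.
rewrite ee mul1r lerD2l.
apply: le_trans (ler_wpM2l D0 tc) _.
have : c <= e / (256 * B * K ^+ 2 + 1) by rewrite ge_min lexx orbT.
rewrite ler_pdivlMr; last lra.
lra.
Qed.

End Growth.

(** * The distortion bound *)

Section Distortion.
Variables (R : realType) (n : nat).
Local Notation C := (Cplx R).
Local Notation V := 'cV[C]_n.
Implicit Types (u v w x y z d : V).

(** A complex line meets the ball of radius [rho] in a disc, whose centre is
    the foot of the perpendicular from the origin. *)
Lemma line_ball d z (s : C) : enorm d = 1 ->
  enorm (z - dot d z *: d + s *: d) ^+ 2 =
  enorm z ^+ 2 - cabs (dot d z) ^+ 2 + cabs s ^+ 2.
Proof.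
move=> d1.
have -> : z - dot d z *: d + s *: d = (s - dot d z) *: d + z.
  by rewrite scalerBl [RHS]addrC [_ *: d - _]addrC addrA.
rewrite enorm_sqrD enormZ d1 mulr1 dotZl !cabs_sqr !creM !cre_conj !cim_conj.
rewrite !creD !cimD !creN !cimN; ring.
Qed.

(** The line through [z] in direction [d] meets the ball of radius [rho] in a
    disc of radius [D <= rho]; the infinitesimal Schwarz-Pick inequality on that
    disc, tested against a vector norming [DF z *m d], gives the bound. *)
Theorem distortion (f : V -> V) (DF : V -> 'M[C]_n) (M rho : R) z d :
  (forall x, eball x -> dmx f x (DF x)) -> 0 <= M -> rho < 1 ->
  (forall x, enorm x <= rho -> enorm (f x) <= M) ->
  enorm z < rho -> enorm d = 1 ->
  enorm (DF z *m d) <= M * rho / (rho ^+ 2 - enorm z ^+ 2).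
Proof.
move=> Hf M0 rho1 fM zr d1.
have zn := enorm_ge0 z.
have rho0 : 0 < rho by lra.
have den : 0 < rho ^+ 2 - enorm z ^+ 2.
  by rewrite subr_gt0 ltrXn2r ?nnegrE //; lra.
pose b0 := dot d z.
have b0z : cabs b0 <= enorm z by have := cauchy_schwarz d z; rewrite d1 mul1r.
have b0n := cabs_ge0 b0.
have b0z2 : cabs b0 ^+ 2 <= enorm z ^+ 2 by apply: lerXn2r; rewrite ?nnegrE.
have b0s := sqr_ge0 (cabs b0).
pose D := Num.sqrt (rho ^+ 2 - enorm z ^+ 2 + cabs b0 ^+ 2).
have D2 : D ^+ 2 = rho ^+ 2 - enorm z ^+ 2 + cabs b0 ^+ 2 by rewrite sqr_sqrtr //; lra.
have D0 : 0 < D by rewrite sqrtr_gt0; lra.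
have Drho : D <= rho.
  rewrite -(@ler_pXn2r _ 2) ?nnegrE ?(ltW D0) ?(ltW rho0) // D2; lra.
have b0D : cabs b0 < D.
  rewrite -(@ltr_pXn2r _ 2) ?nnegrE ?(ltW D0) // D2; lra.
have cD : cabs (RtoC D) = D by rewrite cabs_RtoC gtr0_norm.
have D00 : RtoC D != 0 by rewrite RtoC_eq0 gt_eqF.
pose l (s : C) : V := (z - b0 *: d) + s *: (RtoC D *: d).
have lrho s : cabs s <= 1 -> enorm (l s) <= rho.
  move=> s1; rewrite -(@ler_pXn2r _ 2) ?nnegrE ?enorm_ge0 ?(ltW rho0) //.
  rewrite /l scalerA line_ball // cabsM cD exprMn D2 -/b0.
  have s2 : cabs s ^+ 2 <= 1 by rewrite expr_le1 ?cabs_ge0.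
  have D2' : 0 <= rho ^+ 2 - enorm z ^+ 2 + cabs b0 ^+ 2 by rewrite -D2 sqr_ge0.
  have := ler_wpM2r D2' s2; lra.
have lb s : cabs s <= 1 -> eball (l s).
  by move=> /lrho h; rewrite /eball /mkset; lra.
have [u u1 uE] := norming_vector (DF z *m d).
pose g (s : C) : C := dot u (f (l s)).
have gd s : eball (l s) -> cderiv g s (dot u (DF (l s) *m (RtoC D *: d))).
  move=> lsb; exact: (pderiv_dot u (@dmx_path _ _ f l s _ _ (Hf _ lsb) (pderiv_line _ _ s))).
pose b := b0 / RtoC D.
have bn : cabs b = cabs b0 / D by rewrite /b cabsM cabsV cD.
have b1 : cabs b < 1 by rewrite bn ltr_pdivrMr // mul1r.
have lbz : l b = z by rewrite /l /b scalerA divfK // subrK.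
have gb := gd b (lb b (ltW b1)).
have := @schwarz_pick_deriv R g b _ M M0 b1 _ _ gb.
rewrite lbz -scalemxAr dotZ uE cabsM cD cabs_RtoC ger0_norm ?enorm_ge0 // bn => SP.
have {}SP : D * enorm (DF z *m d) * (1 - (cabs b0 / D) ^+ 2) <= M.
  apply: SP => s s1.
    have cl := pderiv_continuous (pderiv_line (z - b0 *: d) (RtoC D *: d) s).
    by apply: filterS (pcont_near cl (eball_near (lb s s1))) => t tb; eexists; exact: gd.
  apply: le_trans (cauchy_schwarz _ _) _.
  have h := fM _ (lrho s s1).
  by apply: le_trans (ler_pM _ _ u1 h) _; rewrite ?enorm_ge0 ?mul1r.
have E : D * enorm (DF z *m d) * (1 - (cabs b0 / D) ^+ 2) =
    enorm (DF z *m d) * (rho ^+ 2 - enorm z ^+ 2) / D.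
  have -> : rho ^+ 2 - enorm z ^+ 2 = D ^+ 2 - cabs b0 ^+ 2 by rewrite D2; ring.
  by field; rewrite gt_eqF.
rewrite E ler_pdivrMr // in SP.
rewrite ler_pdivlMr //; apply: le_trans SP _.
exact: ler_wpM2l.
Qed.

End Distortion.

Theorem proposition1p6 (R : realType) (n : nat) (n_ge1 : (1 <= n)%N)
    (f : 'cV[Cplx R]_n -> 'cV[Cplx R]_n) (hf : class_S0 f)
    (r : R) (r_gt0 : 0 < r) (r_lt1 : r < 1)
    (z : 'cV[Cplx R]_n) (hz : eball z) (z_le : enorm z <= r) :
  opnorm ('d f z) <= (1 + Num.sqrt r) ^+ 2 / (1 - r) ^+ 3.
Proof.
have [[hol _ _ _] [ft chain ft0]] := hf.
(* The radius that makes the product of the growth and Schwarz-Pick bounds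
   equal to the claimed constant. *)
pose rho := Num.sqrt r.
have rhor : rho ^+ 2 = r by rewrite sqr_sqrtr // ltW.
have rho0 : 0 < rho by rewrite sqrtr_gt0.
have rho1 : rho < 1.
  by rewrite -(@ltr_pXn2r _ 2) ?nnegrE ?ler01 ?(ltW rho0) // rhor expr1n.
have zrho : enorm z < rho by apply: le_lt_trans z_le _; rewrite -rhor expr2 gtr_pMl.
have K0 : 0 <= koebe rho by rewrite koebe_ge0 // ltW.
have fK x : enorm x <= rho -> enorm (f x) <= koebe rho.
  move=> xr; have xb : eball x by exact: le_lt_trans xr rho1.
  rewrite -ft0 //; apply: le_trans (growth chain xb) _.
  by apply: koebe_le => //; exact: enorm_ge0.
have bound0 : 0 <= (1 + rho) ^+ 2 / (1 - r) ^+ 3.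
  by rewrite divr_ge0 ?sqr_ge0 // exprn_ge0 // subr_ge0 ltW.
have unit_bound d : enorm d = 1 ->
    enorm (dmat f z *m d) <= (1 + rho) ^+ 2 / (1 - r) ^+ 3.
  move=> d1.
  have := distortion (fun x xb => differentiable_dmx (hol x xb)) K0 rho1 fK zrho d1.
  move=> /le_trans; apply.
  have z2 : enorm z ^+ 2 <= r ^+ 2.
    by apply: lerXn2r; rewrite ?nnegrE ?enorm_ge0 ?(ltW r_gt0).
  have rr : 0 < r - r ^+ 2 by rewrite subr_gt0 expr2 gtr_pMl.
  have -> : (1 + rho) ^+ 2 / (1 - r) ^+ 3 = koebe rho * rho / (r - r ^+ 2).
    rewrite /koebe -rhor.
    have -> : 1 - rho ^+ 2 = (1 - rho) * (1 + rho) by ring.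
    have -> : rho ^+ 2 - rho ^+ 2 ^+ 2 = rho ^+ 2 * ((1 - rho) * (1 + rho)) by ring.
    by field; rewrite !gt_eqF //; lra.
  rewrite rhor; apply: ler_wpM2l; first by rewrite mulr_ge0 // ltW.
  by rewrite lef_pV2 ?posrE //; lra.
apply: ge_sup; first by exists (enorm ('d f z 0)); exists 0; rewrite //= enorm0.
move=> _ [v /= v1 <-]; rewrite dmatE.
have [->|v0] := eqVneq v 0; first by rewrite mulmx0 enorm0.
have vn : 0 < enorm v by rewrite enorm_gt0.
have vE : v = RtoC (enorm v) *: (RtoC (enorm v)^-1 *: v).
  by rewrite scalerA -rmorphM mulfV ?gt_eqF // rmorph1 scale1r.
rewrite vE -scalemxAr enormZ cabs_RtoC gtr0_norm //.
have d1 : enorm (RtoC (enorm v)^-1 *: v) = 1.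
  by rewrite enormZ cabs_RtoC gtr0_norm ?invr_gt0 // mulVf // gt_eqF.
apply: le_trans (unit_bound _ d1).
by rewrite ler_piMl ?enorm_ge0.
Qed.
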